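(* Let $G\subset\mathbb{R}^3$ be a bounded domain with smooth boundary $\Gamma$ of genus $\rho$. The system of vector functions $$\{\mathbf{q}_j(\mathbf{x})\}\cup\{\mathbf{h}_i(\mathbf{x})\}\cup\{\mathbf{q}_k^+(\mathbf{x})\}\cup\{\mathbf{q}_k^-(\mathbf{x})\},$$ where $\mathbf{q}_j$ ($\mu_j\in M$) are the eigenfunctions of $\mathcal{N}_d$ (gradient of divergence), $\mathbf{h}_i$ ($1\le i\le\rho$) are the basis functions of $\mathcal{B}_H$, and $\mathbf{q}_k^{\pm}$ ($\pm\lambda_k\in\Lambda$) are the eigenfunctions of $S$ (curl), forms an orthonormal basis of $\mathbf{L}_2(G)$. Every vector function $\mathbf{f}\in\mathbf{L}_2(G)$ can be expanded in the Fourier series with respect to this basis: $$\mathbf{f}(\mathbf{x})=\sum_{\mu_j\in M}(\mathbf{f},\mathbf{q}_j)\mathbf{q}_j(\mathbf{x})+\sum_{i=1}^{\rho}(\mathbf{f},\mathbf{h}_i)\mathbf{h}_i(\mathbf{x})+\sum_{\pm\lambda_k\in\Lambda}\big[(\mathbf{f},\mathbf{q}_k^+)\mathbf{q}_k^+(\mathbf{x})+(\mathbf{f},\mathbf{q}_k^-)\mathbf{q}_k^-(\mathbf{x})\big].$$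
   Context: $\mathbf{L}_2(G)$ is the space of square-integrable vector functions on $G$ over $\mathbb{C}$ with inner product $(\mathbf{u},\mathbf{v})=\int_G\mathbf{u}\cdot\overline{\mathbf{v}}\,dx$ and norm $\|\cdot\|$; $\mathbf{n}$ is the normal to $\Gamma$ and $\gamma(\mathbf{n}\cdot\mathbf{u})$ is the trace of the normal component on $\Gamma$, defined (with values in $H^{-1/2}(\Gamma)$) for $\mathbf{u}\in\mathbf{L}_2(G)$ with $\operatorname{div}\mathbf{u}\in L_2(G)$. Subspaces: $\mathcal{A}=\{\nabla h:\ h\in H^1(G)\}$; $\mathcal{B}$ is the orthogonal complement of $\mathcal{A}$ in $\mathbf{L}_2(G)$; $\mathcal{B}_H=\{\mathbf{u}\in\mathbf{L}_2(G):\ \operatorname{rot}\mathbf{u}=0,\ \operatorname{div}\mathbf{u}=0,\ \gamma(\mathbf{n}\cdot\mathbf{u})=0\}\subset\mathcal{B}$, a finite-dimensional space of dimension $\rho$; $\mathbf{V}^0(G)$ is the orthogonal complement of $\mathcal{B}_H$ in $\mathcal{B}$. Thus $\mathbf{L}_2(G)=\mathcal{A}\oplus\mathcal{B}_H\oplus\mathbf{V}^0(G)$. Operators: $\mathcal{A}_\gamma=\{\nabla h:\ h\in H^1(G),\ \gamma(\mathbf{n}\cdot\nabla h)=0\}$, which is dense in $\mathcal{A}$; $\mathcal{N}_d:\mathcal{A}_\gamma\to\mathcal{A}_\gamma$ has domain $\{\mathbf{v}\in\mathcal{A}_\gamma:\ \nabla\operatorname{div}\mathbf{v}\in\mathcal{A}_\gamma\}$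 and acts as $\nabla\operatorname{div}$. $S:\mathbf{V}^0(G)\to\mathbf{V}^0(G)$ has domain $\{\mathbf{u}\in\mathbf{V}^0(G):\ \operatorname{rot}\mathbf{u}\in\mathbf{V}^0(G)\}$ and acts as $\operatorname{rot}$ (curl); it is self-adjoint with compact inverse. Eigenfunctions (listed with multiplicity, of unit norm, chosen orthonormal within each eigenspace): $-\nabla\operatorname{div}\mathbf{q}_j=\mu_j\mathbf{q}_j$ with nonzero $\mu_j\in M\subset\mathbb{R}$; $\operatorname{rot}\mathbf{q}_k^{\pm}=\pm\lambda_k\mathbf{q}_k^{\pm}$, where $\Lambda\subset\mathbb{R}$ is the set of (nonzero) eigenvalues of $S$, written as $\pm\lambda_k$. The $\mathbf{h}_i$, $i=1,\dots,\rho$, form an orthonormal basis of $\mathcal{B}_H$. *)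

(* Defs.v *)
(* MathComp-Analysis; complex scalars are R[i] from mathcomp-real-closed. *)
From HB Require Import structures.
From mathcomp Require Import all_boot all_order all_algebra.
From mathcomp Require Import complex.
From mathcomp Require Import all_classical all_reals all_analysis.
Set Implicit Arguments.
Unset Strict Implicit.
Unset Printing Implicit Defensive.
Import Order.TTheory GRing.Theory Num.Theory.
Import numFieldNormedType.Exports.
Local Open Scope classical_set_scope.
Local Open Scope complex_scope.
Local Open Scope ring_scope.

Section Space.
Context (R : realType).

Local Notation R3 := (R * R * R)%type.

(* Fields are represented by functions on the whole of R3; only their values
   on G matter, and equality in L_2(G) is "the L_2-norm of the difference
   vanishes". *)
Definition sfield : Type := R3 -> R[i].
Definition vfield : Type := R3 -> 'rV[R[i]]_3.

(* R3 with its Borel sigma-algebra, presented in the form on which Lebesgue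
   measure is defined. *)
Local Notation mR3 :=
  (measurableTypeR R * measurableTypeR R * measurableTypeR R)%type.

Definition leb3 :=
  ((@lebesgue_measure R \x @lebesgue_measure R) \x @lebesgue_measure R)%E.

Definition basis3 (i : 'I_3) : R3 :=
  ((nat_of_ord i == 0%N)%:R, (nat_of_ord i == 1%N)%:R,
   (nat_of_ord i == 2%N)%:R).

Definition partial (i : 'I_3) (f : R3 -> R) : R3 -> R :=
  fun x => 'D_(basis3 i) f x.

Fixpoint classC (k : nat) (f : R3 -> R) : Prop :=
  continuous f /\
  if k is k'.+1 then
    forall i, (forall x, derivable f x (basis3 i)) /\ classC k' (partial i f)
  else True.

Definition smooth (f : R3 -> R) : Prop := forall k, classC k f.

Definition boundary (G : set R3) : set R3 := closure G `\` interior G.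

(* Near each boundary point G is the sublevel set {phi < 0} of a smooth phi
   with nonvanishing gradient there. *)
Definition smooth_bounded_domain (G : set R3) : Prop :=
  [/\ G !=set0, open G, connected G, bounded_set G &
    forall x, boundary G x -> exists phi : R3 -> R,
      [/\ smooth phi, exists i, partial i phi x != 0 &
          \forall y \near x, G y <-> phi y < 0]].

Definition simple_closed_curve (S : set R3) (c : R -> R3) : Prop :=
  [/\ {within `[0, 1], continuous c}, c 0 = c 1,
      {in `[0, 1[ &, injective c} & c @` `[0, 1] `<=` S].

(* n pairwise disjoint simple closed curves whose removal does not disconnect
   any connected component of the surface S. *)
Definition nonseparating_curves (S : set R3) (n : nat)
    (c : 'I_n -> R -> R3) : Prop :=
  let cut := S `\` \bigcup_i (c i @` `[0, 1]) in
  [/\ forall i, simple_closed_curve S (c i),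
      forall i j, i != j -> (c i @` `[0, 1]) `&` (c j @` `[0, 1]) = set0 &
      forall x y, cut x -> cut y ->
        connected_component S x y -> connected_component cut x y].

(* The genus of a closed surface is the largest number of such cuts; for a
   disconnected surface this is the sum of the genera of its components. *)
Definition has_genus (S : set R3) (rho : nat) : Prop :=
  (exists c : 'I_rho -> R -> R3, nonseparating_curves S c) /\
  (forall n (c : 'I_n -> R -> R3),
     nonseparating_curves S c -> (n <= rho)%N).

Variable G : set R3.

Definition square_integrable (f : R3 -> R) : Prop :=
  measurable_fun (G : set mR3) (f : mR3 -> R) /\
  leb3.-integrable G (fun x => (f x ^+ 2)%:E).

Definition L2s (h : sfield) : Prop :=
  square_integrable (fun x => complex.Re (h x)) /\
  square_integrable (fun x => complex.Im (h x)).

Definition L2 (u : vfield) : Prop := forall i, L2s (fun x => u x 0 i).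

Definition cint (f : sfield) : R[i] :=
  (\int[leb3]_(x in G) complex.Re (f x))
  +i* (\int[leb3]_(x in G) complex.Im (f x)).

Definition inner (u v : vfield) : R[i] :=
  cint (fun x => \sum_i u x 0 i * conjc (v x 0 i)).

Definition L2norm (u : vfield) : R := Num.sqrt (complex.Re (inner u u)).

Definition test_function (phi : R3 -> R) : Prop :=
  let supp := closure [set x | phi x != 0] in
  [/\ smooth phi, compact supp & supp `<=` G].

(* grad, div and rot are taken in the sense of distributions; real test
   functions suffice by linearity. *)
Definition weak_grad (h : sfield) (g : vfield) : Prop :=
  forall phi, test_function phi -> forall i,
    cint (fun x => h x * (partial i phi x)%:C) =
    - cint (fun x => g x 0 i * (phi x)%:C).

Definition weak_div (u : vfield) (d : sfield) : Prop :=
  forall phi, test_function phi ->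
    cint (fun x => \sum_i u x 0 i * (partial i phi x)%:C) =
    - cint (fun x => d x * (phi x)%:C).

(* (rot u)_i = d_{i+1} u_{i+2} - d_{i+2} u_{i+1}, indices being modulo 3. *)
Definition weak_rot (u w : vfield) : Prop :=
  forall phi, test_function phi -> forall i : 'I_3,
    cint (fun x => u x 0 (i + 2%:R) * (partial (i + 1) phi x)%:C
                 - u x 0 (i + 1) * (partial (i + 2%:R) phi x)%:C) =
    - cint (fun x => w x 0 i * (phi x)%:C).

(* h belongs to H^1(G), with gradient g. *)
Definition H1 (h : sfield) (g : vfield) : Prop :=
  [/\ L2s h, L2 g & weak_grad h g].

(* For u and d = div u in L_2, gamma(n.u) is the functional on the trace space
   H^{1/2}(Gamma) = H^1(G)/H^1_0(G) given by Green's formula; this is its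
   value at the trace of v, where g = grad v. *)
Definition normal_trace (u : vfield) (d : sfield) (v : sfield) (g : vfield) :
    R[i] :=
  cint (fun x => (\sum_i u x 0 i * g x 0 i) + d x * v x).

Definition zero_normal_trace (u : vfield) : Prop :=
  exists d, [/\ L2s d, weak_div u d &
    forall v g, H1 v g -> normal_trace u d v g = 0].

Definition spaceA (u : vfield) : Prop := exists h, H1 h u.

Definition spaceB (u : vfield) : Prop :=
  L2 u /\ forall a, spaceA a -> inner u a = 0.

Definition spaceBH (u : vfield) : Prop :=
  [/\ L2 u, weak_rot u 0, weak_div u (fun=> 0) & zero_normal_trace u].

Definition spaceV0 (u : vfield) : Prop :=
  spaceB u /\ forall b, spaceBH b -> inner u b = 0.

Definition spaceAgamma (u : vfield) : Prop := spaceA u /\ zero_normal_trace u.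

(* Unbounded operators are given by their graphs. *)
Definition operNd (v w : vfield) : Prop :=
  [/\ spaceAgamma v, spaceAgamma w &
      exists d, [/\ L2s d, weak_div v d & weak_grad d w]].

Definition operS (u w : vfield) : Prop :=
  [/\ spaceV0 u, spaceV0 w & weak_rot u w].

Definition orthonormal (I : eqType) (e : I -> vfield) : Prop :=
  forall i j, inner (e i) (e j) = (i == j)%:R.

(* e is an orthonormal basis of the subspace V of L_2(G): an orthonormal family
   in V whose finite linear combinations are dense in V. *)
Definition orthonormal_basis (V : vfield -> Prop) (I : eqType)
    (e : I -> vfield) : Prop :=
  [/\ forall i, V (e i), orthonormal e &
      forall f, V f -> forall eps : R, 0 < eps ->
        exists (s : seq I) (c : I -> R[i]),
          L2norm (f - \sum_(i <- s) c i *: e i) < eps].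

Definition eigenspace (T : vfield -> vfield -> Prop) (a : R) (u : vfield) :
    Prop :=
  T u (a%:C *: u).

(* The e j, with eigenvalues ev j, list the eigenfunctions of T for the
   eigenvalues satisfying P: for each such value a, the e j with ev j = a form
   an orthonormal basis of the eigenspace (an empty one when a is not an
   eigenvalue). *)
Definition eigenfunctions (T : vfield -> vfield -> Prop) (P : R -> Prop)
    (ev : nat -> R) (e : nat -> vfield) : Prop :=
  (forall j, P (ev j)) /\
  forall a, P a ->
    orthonormal_basis (eigenspace T a)
      (fun j : {j : nat | ev j == a} => e (val j)).

(* The union of the four families q, h, qP, qM, as a family indexed by the
   disjoint union of their index sets. *)
Definition union_system (rho : nat) (q : nat -> vfield) (h : 'I_rho -> vfield)
    (qP qM : nat -> vfield) (i : nat + 'I_rho + (nat + nat)) : vfield :=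
  match i with
  | inl (inl j) => q j
  | inl (inr i) => h i
  | inr (inl k) => qP k
  | inr (inr k) => qM k
  end.

Definition fourier_sum (rho : nat) (q : nat -> vfield) (h : 'I_rho -> vfield)
    (qP qM : nat -> vfield) (f : vfield) (m n : nat) : vfield :=
  \sum_(j < m) inner f (q j) *: q j + \sum_(i < rho) inner f (h i) *: h i
  + \sum_(k < n) (inner f (qP k) *: qP k + inner f (qM k) *: qM k).

End Space.

(* Main.v *)
(* Split a test function as [f = sum_i d_i (P_i f) + A f], where [A] averages over
   boxes of side [r] and [|P_i f| <= r |f|]; the square of [A] is, on a bounded
   set, a finite rank operator up to a small error.

   Paired with [h] in H^1 the derivatives move to [grad h], which gives Rellich's
   theorem: [|h|^2 <= eps |h|_{H^1}^2 + sum_k (x_k, h)^2] for finitely many [x_k].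
   Near the boundary [f] is first translated into [G]. For vector fields, the
   derivatives can be exchanged modulo gradients and curls, and the same splitting
   bounds [|u|^2] by [eps |rot u|^2 + sum_k (x_k, rot u)^2] on the closure of the
   curls of test fields.

   The spectral theorem on the graphs of [grad] and [rot] then says that a field
   orthogonal to all the q_j is orthogonal to every gradient, and one orthogonal
   to all the q_k^+ and q_k^- has zero curl. A field orthogonal to both families
   thus lies in B_H, and vanishes if it is orthogonal to the h_i as well. The
   projection theorem turns this into density, and best approximation turns
   density into convergence of the Fourier series. *)
Require Import Defs.
From HB Require Import structures.
From mathcomp Require Import all_boot all_order all_algebra.
From mathcomp Require Import complex.
From mathcomp Require Import all_classical all_reals all_analysis.
From mathcomp Require Import measurable_realfun ring lra.
Set Implicit Arguments.
Unset Strict Implicit.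
Unset Printing Implicit Defensive.
Import Order.TTheory GRing.Theory Num.Theory.
Import numFieldNormedType.Exports.
Local Open Scope classical_set_scope.
Local Open Scope complex_scope.
Local Open Scope ring_scope.

(** * Real Hilbert spaces *)

(** Functions equal almost everywhere are kept distinct, so every inner product is only
    semidefinite: an equality of vectors is replaced by an equality of pairings or by a vanishing
    squared norm. Compactness is an inequality, a small multiple of a squared norm plus finitely
    many squared functionals; in this form it passes through finite coverings and closures without
    subsequences. Boundary values are avoided by duality: norms are computed by pairing with test
    functions, or with curls of test fields, so only smooth compactly supported functions are ever
    estimated. The boundary of G enters only for gradients. There the weak equation may be tested
    only inside G, so averages must not leave G, and the test function is pushed inwards first. A
    field in the closure of the curls is instead orthogonal to gradients of functions that do not
    vanish at the boundary, so averages may leave G freely. The spectral theorem is applied to the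
    graph of an operator, with the L_2 product of the first components as a form that is compact for
    the graph norm; no resolvent has to be constructed. *)

Section Hilbert.
Variables (R : realType) (V : lmodType R).

(** Definiteness is not demanded, so that functions, rather than classes modulo null sets, can be
    the vectors. Completeness is phrased with squared norms to avoid square roots. *)
Record hilbert (ip : V -> V -> R) : Prop := Hilbert {
  ipC : forall x y, ip x y = ip y x;
  ipDl : forall x y z, ip (x + y) z = ip x z + ip y z;
  ipZl : forall a x y, ip (a *: x) y = a * ip x y;
  ip_ge0 : forall x, 0 <= ip x x;
  ip_complete : forall u : nat -> V,
    (forall e, 0 < e -> exists N, forall m n, (N <= m)%N -> (N <= n)%N ->
       ip (u m - u n) (u m - u n) < e) ->
    exists l, forall e, 0 < e -> exists N, forall n, (N <= n)%N ->
       ip (u n - l) (u n - l) < e }.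

Definition subspace (W : V -> Prop) : Prop :=
  W 0 /\ forall a x y, W x -> W y -> W (a *: x + y).

(** In the semidefinite setting a closed set contains, with each vector, every vector at distance
    zero from it. *)
Definition ip_closed (ip : V -> V -> R) (W : V -> Prop) : Prop :=
  forall x, (forall e, 0 < e -> exists2 y, W y & ip (x - y) (x - y) < e) -> W x.

Lemma subspaceD W x y : subspace W -> W x -> W y -> W (x + y).
Proof. by move=> [_ h] hx hy; rewrite -(scale1r x); exact: h. Qed.

Lemma subspaceZ W a x : subspace W -> W x -> W (a *: x).
Proof. by move=> [h0 h] hx; rewrite -(addr0 (a *: x)); exact: h. Qed.

Lemma subspaceB W x y : subspace W -> W x -> W y -> W (x - y).
Proof.
by move=> hW hx hy; apply: subspaceD => //; rewrite -scaleN1r; exact: subspaceZ.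
Qed.

End Hilbert.

Section HilbertTheory.
Variables (R : realType) (V : lmodType R) (ip : V -> V -> R).
Hypothesis hip : hilbert ip.

Lemma ipDr x y z : ip x (y + z) = ip x y + ip x z.
Proof. by rewrite (ipC hip) (ipDl hip) !(ipC hip x). Qed.

Lemma ipZr a x y : ip x (a *: y) = a * ip x y.
Proof. by rewrite (ipC hip) (ipZl hip) (ipC hip x). Qed.

Lemma ipNl x y : ip (- x) y = - ip x y.
Proof. by rewrite -scaleN1r (ipZl hip) mulN1r. Qed.

Lemma ipNr x y : ip x (- y) = - ip x y.
Proof. by rewrite -scaleN1r ipZr mulN1r. Qed.

Lemma ipBl x y z : ip (x - y) z = ip x z - ip y z.
Proof. by rewrite (ipDl hip) ipNl. Qed.

Lemma ipBr x y z : ip x (y - z) = ip x y - ip x z.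
Proof. by rewrite ipDr ipNr. Qed.

Lemma ip0l x : ip 0 x = 0.
Proof. by rewrite -(scale0r 0) (ipZl hip) mul0r. Qed.

Lemma nsB x y : ip (x - y) (x - y) = ip x x - 2 * ip x y + ip y y.
Proof. by rewrite !ipBl !ipBr (ipC hip y x); ring. Qed.

Lemma nsD x y : ip (x + y) (x + y) = ip x x + 2 * ip x y + ip y y.
Proof. by rewrite !(ipDl hip) !ipDr (ipC hip y x); ring. Qed.

Lemma nsZ a x : ip (a *: x) (a *: x) = a ^+ 2 * ip x x.
Proof. by rewrite (ipZl hip) ipZr; ring. Qed.

Lemma nsBC x y : ip (x - y) (x - y) = ip (y - x) (y - x).
Proof. by rewrite !nsB (ipC hip y x); ring. Qed.

Lemma nsD_le x y : ip (x + y) (x + y) <= 2 * ip x x + 2 * ip y y.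
Proof. by have := ip_ge0 hip (x - y); rewrite nsB nsD; lra. Qed.

Lemma nsB_le z x y :
  ip (x - y) (x - y) <= 2 * ip (x - z) (x - z) + 2 * ip (z - y) (z - y).
Proof.
rewrite -[x - y](_ : (x - z) + (z - y) = _) ?nsD_le //.
by rewrite addrA subrK.
Qed.

Lemma discriminant_le (a b c : R) : 0 <= a -> 0 <= c ->
  (forall t, 0 <= a - 2 * t * b + t ^+ 2 * c) -> b ^+ 2 <= a * c.
Proof.
move=> a0 c0 h.
have [c00|cn0] := eqVneq c 0.
  have [->|bn0] := eqVneq b 0; first by rewrite c00; lra.
  (* For [c = 0] the expression is affine in [t], and at this point it equals -1. *)
  have := h ((a + 1) / (2 * b)); rewrite c00.
  have -> : 2 * ((a + 1) / (2 * b)) * b = a + 1.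
    by field.
  by lra.
have cp : 0 < c by rewrite lt_def cn0.
have := h (b / c).
have -> : a - 2 * (b / c) * b + (b / c) ^+ 2 * c = (a * c - b ^+ 2) / c.
  by field.
by rewrite pmulr_lge0 ?invr_gt0// subr_ge0.
Qed.

Lemma cauchy_schwarz x y : ip x y ^+ 2 <= ip x x * ip y y.
Proof.
apply: discriminant_le; rewrite ?(ip_ge0 hip)// => t.
have := ip_ge0 hip (x - t *: y).
by rewrite nsB nsZ ipZr mulrA.
Qed.

Lemma ns0_ip x y : ip x x = 0 -> ip x y = 0.
Proof.
move=> h; have := cauchy_schwarz x y; rewrite h mul0r => h2.
by apply/eqP; rewrite -sqrf_eq0 eq_le h2 sqr_ge0.
Qed.

Lemma le_small (K x : R) : (forall e, 0 < e -> x <= K * e) -> x <= 0.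
Proof.
move=> h; rewrite leNgt; apply/negP => x0.
have h1 := h 1 ltr01; have K0 : 0 < K by lra.
have := h (x / (2 * K)); rewrite divr_gt0 ?mulr_gt0// => /(_ isT).
have -> : K * (x / (2 * K)) = x / 2 by field; rewrite gt_eqF.
by lra.
Qed.

Lemma sqr_small (K x : R) : (forall e, 0 < e -> x ^+ 2 <= K * e) -> x = 0.
Proof.
move=> h; apply/eqP; rewrite -sqrf_eq0 eq_le sqr_ge0 andbT.
exact: le_small h.
Qed.

Lemma invn_small (e : R) :
  0 < e -> exists N, forall n, (N <= n)%N -> n.+1%:R^-1 < e.
Proof.
move=> e0; exists (Num.truncn e^-1) => n hn.
rewrite invf_plt ?posrE//; apply: (lt_le_trans (truncnS_gt _)).
by rewrite ler_nat.
Qed.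

Section Projection.
Variable W : V -> Prop.
Hypotheses (sW : subspace W) (cW : ip_closed ip W).

(** A minimizing sequence for the distance to [W] is Cauchy by the parallelogram identity, because
    midpoints stay in [W]. *)
Lemma projection x : exists2 y, W y & forall w, W w -> ip (x - y) w = 0.
Proof.
pose S : set R := [set ip (x - y) (x - y) | y in [set y | W y]].
have S0 : S !=set0 by exists (ip (x - 0) (x - 0)); exists 0 => //; case: sW.
have lbS : lbound S 0 by move=> _ [y _ <-]; exact: ip_ge0.
have hS : has_inf S by split => //; exists 0.
pose d := inf S.
have dle y : W y -> d <= ip (x - y) (x - y).
  by move=> wy; apply: ge_inf; [exists 0|exists y].
have hy n : exists2 y, W y & ip (x - y) (x - y) < d + n.+1%:R^-1.
  have n0 : 0 < n.+1%:R^-1 :> R by rewrite invr_gt0.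
  by have [_ [y wy <-] hy] := inf_adherent n0 hS; exists y.
have /choice[y hyy] : forall n, exists z, W z /\
    ip (x - z) (x - z) < d + n.+1%:R^-1.
  by move=> n; have [z] := hy n; exists z.
have cau e : 0 < e -> exists N, forall m n, (N <= m)%N -> (N <= n)%N ->
    ip (y m - y n) (y m - y n) < e.
  move=> e0; have e40 : 0 < e / 4 by lra.
  have [N hN] := invn_small e40.
  exists N => m n hm hn.
  have := dle (2^-1 *: y m + 2^-1 *: y n).
  have hW2 : W (2^-1 *: y m + 2^-1 *: y n).
    by apply: subspaceD => //; apply: subspaceZ => //; apply: (hyy _).1.
  move=> /(_ hW2).
  have := (hyy m).2; have := (hyy n).2; have := hN _ hm; have := hN _ hn.
  rewrite !nsB !ipDr !(ipDl hip) !ipZr !(ipZl hip) (ipC hip (y n) (y m)).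
  by move: (n.+1%:R^-1 : R) (m.+1%:R^-1 : R) => u v; lra.
have [l hl] := ip_complete hip cau.
exists l.
  apply: cW => e e0; have [N hN] := hl _ e0; exists (y N); first exact: (hyy N).1.
  by rewrite nsBC; apply: hN.
move=> w ww.
apply: (@sqr_small (4 * ip w w)) => e e0.
have [N1 hN1] := hl _ e0; have [N2 hN2] := invn_small e0.
pose n := maxn N1 N2.
have h1 := hN1 n (leq_maxl _ _); have h2 := hN2 n (leq_maxr _ _).
(* Replacing [y n] by [y n + t *: w] cannot bring the squared distance below [d]; the discriminant
   of this quadratic in [t] bounds the pairing by the excess of [y n] over the infimum. *)
have h3 : ip (x - y n) w ^+ 2 <= e * ip w w.
  apply: (@le_trans _ _ ((ip (x - y n) (x - y n) - d) * ip w w)); last first.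
    apply: ler_wpM2r; first exact: ip_ge0.
    by rewrite lerBlDl; apply/ltW/(lt_trans (hyy n).2); rewrite ltrD2l.
  apply: discriminant_le; [by have := dle _ (hyy n).1; lra|exact: ip_ge0|].
  move=> t; have := dle (y n + t *: w).
  have hW2 : W (y n + t *: w).
    by apply: subspaceD => //; [exact: (hyy n).1|exact: subspaceZ].
  move=> /(_ hW2); rewrite opprD addrA (nsB (x - y n)) nsZ ipZr; lra.
have h4 : ip (y n - l) w ^+ 2 <= e * ip w w.
  apply: le_trans (cauchy_schwarz _ _) _.
  by apply: ler_wpM2r; [exact: ip_ge0|exact: ltW].
have -> : ip (x - l) w = ip (x - y n) w + ip (y n - l) w.
  by rewrite -(ipDl hip) addrA subrK.
have := sqr_ge0 (ip (x - y n) w - ip (y n - l) w).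
by rewrite sqrrB sqrrD; lra.
Qed.

End Projection.

(** The usual argument through the kernel of [l]: the bound makes the kernel closed and prevents a
    vector normal to it from having norm zero. *)
Lemma riesz (W : V -> Prop) (sW : subspace W) (cW : ip_closed ip W) (l : V -> R) (C : R) :
  (forall a x y, W x -> W y -> l (a *: x + y) = a * l x + l y) ->
  (forall x, W x -> l x ^+ 2 <= C * ip x x) ->
  exists2 y, W y & forall w, W w -> ip y w = l w.
Proof.
move=> lin bnd.
have l0 : l 0 = 0.
  apply/eqP; rewrite -sqrf_eq0 eq_le sqr_ge0 andbT.
  by have := bnd _ sW.1; rewrite ip0l mulr0.
have lZ a x : W x -> l (a *: x) = a * l x.
  by move=> wx; rewrite -(addr0 (a *: x)) lin ?l0 ?addr0//; exact: sW.1.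
have [h|] := pselect (forall x, W x -> l x = 0).
  by exists 0; [exact: sW.1|move=> w ww; rewrite ip0l h].
move=> /existsNP[w0 /not_implyP[ww0 /eqP lw0]].
pose K x := W x /\ l x = 0.
have sK : subspace K.
  split; first by split => //; exact: sW.1.
  by move=> a x y [wx lx] [wy ly]; split; [apply: sW.2|rewrite lin// lx ly; ring].
have cK : ip_closed ip K.
  move=> x hx; have wx : W x.
    by apply: cW => e e0; have [y [wy _] hy] := hx _ e0; exists y.
  split => //; apply: (@sqr_small `|C|) => e e0.
  have [y [wy ly] hy] := hx _ e0.
  have -> : l x = l (-1 *: y + x) by rewrite lin// ly; ring.
  apply: le_trans (bnd _ _) _; first by apply: sW.2.
  rewrite scaleN1r addrC.
  apply: (@le_trans _ _ (`|C| * ip (x - y) (x - y))).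
    by apply: ler_wpM2r; [exact: ip_ge0|exact: ler_norm].
  by apply: ler_wpM2l => //; exact: ltW.
have [y [wy ly] hy] := projection sK cK w0.
pose n := w0 - y; have wn : W n by exact: subspaceB.
have ln : l n = l w0.
  have -> : n = -1 *: y + w0 by rewrite scaleN1r addrC.
  by rewrite lin// ly; ring.
have nn0 : ip n n != 0.
  apply/eqP => h; have := bnd _ wn; rewrite h mulr0 ln => h2.
  by move: lw0; rewrite -sqrf_eq0 eq_le h2 sqr_ge0.
exists ((l n / ip n n) *: n); first exact: subspaceZ.
move=> w ww; rewrite (ipZl hip).
have l1 : l n != 0 by rewrite ln.
pose k := w - (l w / l n) *: n.
have kK : K k.
  split; first by apply: subspaceB => //; exact: subspaceZ.
  rewrite /k addrC -scaleNr lin//; by field.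
have := hy _ kK; rewrite -/n /k ipBr ipZr => /eqP; rewrite subr_eq0 => /eqP ->.
by field; rewrite l1.
Qed.

(** * Eigenvectors of compact symmetric forms *)

Section Spectral.
Variables (W : V -> Prop) (b : V -> V -> R).
Hypotheses (sW : subspace W) (cW : ip_closed ip W).
Hypothesis bC : forall x y, W x -> W y -> b x y = b y x.
Hypothesis bl : forall a x y z, W x -> W y -> W z ->
  b (a *: x + y) z = a * b x z + b y z.
(** Compactness of the operator [T] that represents [b]: the squared norm of [T x] is at most a
    small multiple of that of [x] plus the squares of finitely many functionals of [x]. *)
Hypothesis bcpt : forall e : R, 0 < e -> exists xs : seq V,
  forall x y, W x -> W y ->
    b x y ^+ 2 <= (e * ip x x + \sum_(z <- xs) ip z x ^+ 2) * ip y y.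

Definition eigenvector (e : V) : Prop :=
  W e /\ exists2 k, k != 0 & forall x, W x -> b e x = k * ip e x.

Let br a x y z : W x -> W y -> W z -> b z (a *: x + y) = a * b z x + b z y.
Proof.
move=> wx wy wz; have ws : W (a *: x + y) by exact: sW.2.
by rewrite (bC wz ws) bl// (bC wx wz) (bC wy wz).
Qed.

Let b_bound : exists2 C, 0 < C &
  forall x y, W x -> W y -> b x y ^+ 2 <= C * ip x x * ip y y.
Proof.
have [xs h] := bcpt ltr01.
exists (1 + \sum_(z <- xs) ip z z).
  by apply: ltr_wpDr => //; apply: sumr_ge0 => *; exact: ip_ge0.
move=> x y wx wy; apply: le_trans (h _ _ wx wy) _.
apply: ler_wpM2r; first exact: ip_ge0.
rewrite mulrDl lerD2l mulr_suml; apply: ler_sum => z _; exact: cauchy_schwarz.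
Qed.

(** The condition on [x] stands below the existential so that [choice] yields a total function. *)
Let T_ex x : exists t, W x -> W t /\ forall y, W y -> ip t y = b x y.
Proof.
have [wx|nwx] := pselect (W x); last by exists 0.
have [C _ hC] := b_bound.
have [||t wt ht] := @riesz W sW cW (b x) (C * ip x x).
- by move=> a y z wy wz; rewrite br.
- by move=> y wy; exact: hC.
by exists t.
Qed.

(** The chosen [T] is linear only up to vectors of norm zero; its algebraic identities are used in
    this form. *)
Lemma ns_eq x y : W x -> W y -> (forall v, W v -> ip x v = ip y v) ->
  ip x x = ip y y.
Proof. by move=> wx wy h; rewrite h// (ipC hip) h. Qed.

(** Bounded segments are compact, so the image ultrafilter converges. An ultrafilter makes every
    bounded functional converge at once, with no diagonal extraction. *)
Lemma ultra_bounded_cvg (U : set_system V) (f : V -> R) (B : R) (A : set V) :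
  UltraFilter U -> U A -> (forall x, A x -> f x ^+ 2 <= B) ->
  exists l, forall e, 0 < e -> exists2 A', U A' & forall x, A' x -> (f x - l) ^+ 2 < e.
Proof.
move=> UU UA hA.
have B0 : 0 <= B by have [x /hA] := filter_ex UA; apply: le_trans; exact: sqr_ge0.
have FU : ProperFilter (f @ U) by apply: fmap_proper_filter.
have [|l [_ hl]] := @segment_compact R (- Num.sqrt B) (Num.sqrt B) (f @ U) FU.
  suff: U (f @^-1` `[- Num.sqrt B, Num.sqrt B]) by [].
  apply: filterS UA => x /hA h; rewrite /=.
  rewrite in_itv /= -ler_norml -(sqrtr_sqr (f x)).
  by rewrite ler_wsqrtr.
exists l => e e0.
pose N : set R := [set y | (y - l) ^+ 2 < e].
have nN : nbhs l N.
  apply/nbhs_ballP; exists (Num.sqrt e) => /=; first by rewrite sqrtr_gt0.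
  move=> y; rewrite /ball /= distrC => h; rewrite /N /=.
  rewrite -(sqr_sqrtr (ltW e0)) -(ger0_norm (sqrtr_ge0 e)) -(real_normK (num_real (y - l))).
  by rewrite ltr_pXn2r ?nnegrE// (ger0_norm (sqrtr_ge0 e)).
have [h|h] := in_ultra_setVsetC (f @^-1` N) UU; first by exists (f @^-1` N).
have [z [z1 z2]] : (~` N `&` N) !=set0 by apply: hl.
by [].
Qed.

Lemma ultra_bounded_cauchy (U : set_system V) (B : R) (A : set V) (xs : seq V) :
  UltraFilter U -> U A -> (forall x, A x -> ip x x <= B) ->
  forall e, 0 < e -> exists2 A', U A' &
    forall x y, A' x -> A' y -> \sum_(z <- xs) ip z (x - y) ^+ 2 < e.
Proof.
move=> UU UA hA; elim: xs => [|z xs IH] e e0.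
  by exists setT; [exact: filterT|move=> x y _ _; rewrite big_nil].
have [|A1 UA1 h1] := IH (e / 2); first by lra.
have [|l hl] := @ultra_bounded_cvg U (ip z) (ip z z * B) A UU UA.
  move=> x /hA h; apply: le_trans (cauchy_schwarz _ _) _.
  by apply: ler_wpM2l => //; exact: ip_ge0.
(* Two values within [e / 8] of the limit, in squared distance, differ by at most
   [4 * (e / 8) = e / 2] in squared distance. *)
have [|A2 UA2 h2] := hl (e / 8); first by lra.
exists (A1 `&` A2); first exact: filterI.
move=> x y [x1 x2] [y1 y2]; rewrite big_cons.
have := h1 _ _ x1 y1; have := h2 _ x2; have := h2 _ y2; rewrite ipBr.
have := sqr_ge0 ((ip z x - l) + (ip z y - l)).
by rewrite sqrrD; nra.
Qed.

(* The form [b] is represented by an operator [T]; were [b w] nonzero, then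
   along a maximizing ultrafilter for [|T x|^2 / |x|^2] on the orthogonal of the
   eigenvectors, [T x] would converge to an eigenvector of [T^2], whence one of
   [T]. *)
Lemma spectral w : W w -> (forall e, eigenvector e -> ip w e = 0) ->
  forall x, W x -> b w x = 0.
Proof.
move=> ww wE; apply: contrapT => /existsNP[x0 /not_implyP[wx0 /eqP bx0]].
have [T hT] := choice T_ex.
have WT x : W x -> W (T x) by move=> wx; have [] := hT x wx.
have bT x y : W x -> W y -> ip (T x) y = b x y by move=> wx; have [_] := hT x wx; exact.
pose F x := W x /\ forall e, eigenvector e -> ip x e = 0.
have FW x : F x -> W x by case.
have sF : subspace F.
  split; first by split; [exact: sW.1|move=> e _; rewrite ip0l].
  move=> a x y [wx ex] [wy ey]; split; first exact: sW.2.
  by move=> e he; rewrite (ipDl hip) (ipZl hip) ex// ey//; ring.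
have cF : ip_closed ip F.
  move=> x hx; split.
    by apply: cW => e e0; have [y [wy _] hy] := hx _ e0; exists y.
  move=> e he; apply: (@sqr_small (ip e e)) => d d0.
  have [y [_ ye] hy] := hx _ d0.
  rewrite -(subrK y x) (ipDl hip) ye// addr0.
  apply: le_trans (cauchy_schwarz _ _) _; rewrite mulrC.
  by apply: ler_wpM2l; [exact: ip_ge0|exact: ltW].
have FT x : F x -> F (T x).
  move=> [wx ex]; split; first exact: WT.
  move=> e he; have [we [k k0 hk]] := he.
  by rewrite bT// bC// hk// (ipC hip) ex// mulr0.
have [C C0 hC] := b_bound.
have b0 v : W v -> b 0 v = 0.
  move=> wv; apply/eqP; rewrite -sqrf_eq0 eq_le sqr_ge0 andbT.
  by have := hC 0 v sW.1 wv; rewrite ip0l mulr0 mul0r.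
have TC x : W x -> ip (T x) (T x) <= C * ip x x.
  move=> wx; have := hC x (T x) wx (WT _ wx); rewrite -bT//; last exact: WT.
  have := ip_ge0 hip (T x); rewrite le_eqVlt => /orP[/eqP <- _|t0].
    by rewrite mulr_ge0 ?ip_ge0// ltW.
  by rewrite expr2 ler_pM2r.
have TZ a x : W x -> ip (T (a *: x)) (T (a *: x)) = a ^+ 2 * ip (T x) (T x).
  move=> wx; have wax : W (a *: x) by exact: subspaceZ.
  rewrite -nsZ; apply: ns_eq; [exact: WT|apply: subspaceZ => //; exact: WT|].
  move=> v wv; rewrite (ipZl hip) !bT// -(addr0 (a *: x)) bl//; last exact: sW.1.
  by rewrite b0// addr0.
have TB x y : W x -> W y ->
    ip (T x - T y) (T x - T y) = ip (T (x - y)) (T (x - y)).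
  move=> wx wy; have wxy : W (x - y) by exact: subspaceB.
  apply: ns_eq; [by apply: subspaceB => //; exact: WT|exact: WT|].
  move=> v wv; rewrite ipBl !bT//.
  have -> : x - y = (-1) *: y + x by rewrite scaleN1r addrC.
  by rewrite bl//; ring.
pose S : set R := [set r | exists2 x, F x & 0 < ip x x /\ r = ip (T x) (T x) / ip x x].
have Fw : F w by [].
have w0 : 0 < ip w w.
  rewrite lt_def ip_ge0// andbT; apply/eqP => h; move: bx0.
  by rewrite -sqrf_eq0 eq_le sqr_ge0 andbT; have := hC _ _ ww wx0; rewrite h mulr0 mul0r => ->.
have Tw0 : 0 < ip (T w) (T w).
  rewrite lt_def ip_ge0// andbT; apply/eqP => h; move: bx0.
  by rewrite -bT// ns0_ip// eqxx.
have Sw : S (ip (T w) (T w) / ip w w) by exists w.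
have hS : has_sup S.
  split; first by exists (ip (T w) (T w) / ip w w).
  by exists C => _ [x Fx [x0' ->]]; rewrite ler_pdivrMr//; apply: TC; exact: FW.
pose M := sup S.
have M0 : 0 < M.
  apply: (lt_le_trans (divr_gt0 Tw0 w0)); apply: ub_le_sup => //.
  by case: hS.
have TM x : F x -> ip (T x) (T x) <= M * ip x x.
  move=> Fx; have := ip_ge0 hip x; rewrite le_eqVlt => /orP[/eqP h|x0p].
    by have := TC x (FW _ Fx); rewrite -h !mulr0.
  rewrite -ler_pdivrMr//; apply: ub_le_sup; first by case: hS.
  by exists x.
pose A d : set V := [set x | F x /\ ip x x = 1 /\ M - d < ip (T x) (T x)].
have A_ex d : 0 < d -> A d !=set0.
  move=> d0; have [_ [x Fx [x0' ->]] hx] := sup_adherent d0 hS.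
  exists ((Num.sqrt (ip x x))^-1 *: x); split; first exact: subspaceZ.
  rewrite nsZ TZ; last exact: FW.
  have -> : (Num.sqrt (ip x x))^-1 ^+ 2 = (ip x x)^-1.
    by rewrite exprVn sqr_sqrtr// ltW.
  by rewrite mulVf ?gt_eqF// mulrC; split.
pose B : set_system V := filter_from [set d : R | 0 < d] A.
have FB : ProperFilter B.
  apply: filter_from_proper; last by move=> d; exact: A_ex.
  apply: filter_from_filter; first by exists 1 => /=.
  move=> d e /= d0 e0; exists (Num.min d e); first by rewrite /= lt_min d0.
  move=> x [Fx [x1 hx]]; split; (do 2 split => //); apply: le_lt_trans hx.
    by rewrite lerB// ge_min lexx.
  by rewrite lerB// ge_min lexx orbT.
have [U [UU BU]] := ultraFilterLemma FB.
have UA d : 0 < d -> U (A d) by move=> d0; apply: BU; exists d.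
(* [T] is Cauchy along [U]. For unit vectors the squared norm of [x - y] is at most 4, so [e / 8]
   contributes [e / 2], and the functionals [xs] contribute less than [e / 2]. *)
have cau e : 0 < e -> exists D, U D /\ forall x y, D x -> D y ->
    [/\ F x, ip x x = 1, M - e < ip (T x) (T x) & ip (T x - T y) (T x - T y) < e].
  move=> e0; have [|xs hxs] := bcpt (e := e / 8); first by lra.
  have A1 x : A 1 x -> ip x x <= 1 by move=> [_ [-> _]].
  have e20 : 0 < e / 2 by lra.
  have [D UD hD] := ultra_bounded_cauchy xs UU (UA _ ltr01) A1 e20.
  exists (A e `&` D); split; first by apply: filterI => //; exact: UA.
  move=> x y [[Fx [x1 hx]] Dx] [[Fy [y1 hy]] Dy]; split => //.
  have wx := FW _ Fx; have wy := FW _ Fy.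
  have wxy : W (x - y) by exact: subspaceB.
  rewrite TB//; set z := T (x - y); have wz : W z by exact: WT.
  have := hxs _ z wxy wz; rewrite -bT// -/z.
  have := ip_ge0 hip z; rewrite le_eqVlt => /orP[/eqP <- //|z0].
  rewrite expr2 ler_pM2r// => h; apply: (le_lt_trans h).
  have := hD _ _ Dx Dy; have := nsD_le x (- y).
  by rewrite ipNl ipNr opprK x1 y1; nra.
have hD n : exists D, U D /\ forall x y, D x -> D y ->
    [/\ F x, ip x x = 1, M - n.+1%:R^-1 < ip (T x) (T x) &
     ip (T x - T y) (T x - T y) < n.+1%:R^-1] by apply: cau; rewrite invr_gt0.
have {hD}[D hD] := choice hD.
(* Points common to finitely many members of [U] give a sequence, as completeness is stated for
   sequences. *)
have hu n : exists x, forall m, (m <= n)%N -> D m x.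
  suff [A' UA' hA'] : exists2 A', U A' & forall x, A' x -> forall m, (m <= n)%N -> D m x.
    by have [x /hA' hx] := filter_ex UA'; exists x.
  elim: n => [|n [A' UA' hA']].
    by exists (D 0%N) => [|x Dx m]; [exact: (hD _).1|rewrite leqn0 => /eqP ->].
  exists (A' `&` D n.+1) => [|x [Ax Dx] m]; first by apply: filterI => //; exact: (hD _).1.
  by rewrite leq_eqVlt => /orP[/eqP -> //|]; rewrite ltnS; exact: hA'.
have {hu}[u hu] := choice hu.
have uF n : F (u n) by have [] := (hD n).2 _ _ (hu n n (leqnn n)) (hu n n (leqnn n)).
have u1 n : ip (u n) (u n) = 1 by have [] := (hD n).2 _ _ (hu n n (leqnn n)) (hu n n (leqnn n)).
have uM n : M - n.+1%:R^-1 < ip (T (u n)) (T (u n)).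
  by have [] := (hD n).2 _ _ (hu n n (leqnn n)) (hu n n (leqnn n)).
have [|z hz] := ip_complete hip (u := T \o u).
  move=> e e0; have [N hN] := invn_small e0; exists N => m n Nm Nn /=.
  have [_ _ _ h] := (hD N).2 _ _ (hu m N Nm) (hu n N Nn).
  by apply: lt_trans h _; exact: hN.
have Fz : F z.
  apply: cF => e e0; have [N hN] := hz _ e0; exists (T (u N)); first exact: FT.
  by rewrite nsBC; apply: hN.
have near_u e : 0 < e -> exists n,
    ip (T (u n) - z) (T (u n) - z) < e /\ n.+1%:R^-1 < e.
  move=> e0; have [N1 h1] := hz _ e0; have [N2 h2] := invn_small e0.
  by exists (maxn N1 N2); rewrite h1 ?leq_maxl// h2 ?leq_maxr.
have z0 : 0 < ip z z.
  have [|n [h1 h2]] := near_u (M / 8); first by lra.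
  have := nsD_le (T (u n) - z) z; rewrite subrK; have := uM n; move: h2.
  by move: (n.+1%:R^-1 : R) => c; lra.
(* For a unit vector [u] of [F], with [a] the squared norm of [T u], the squared norm of
   [T (T u) - M *: u] is at most [M * a - 2 * M * a + M ^+ 2 = M * (M - a)]. The estimates [q2] to
   [q4] carry this over to the limit [z] of [T (u n)]. *)
have TTz : ip (T (T z) - M *: z) (T (T z) - M *: z) = 0.
  apply/eqP; rewrite eq_le ip_ge0// andbT.
  apply: (@le_small (8 * C * M + 2 * M ^+ 2)) => e e0.
  have [n [h1 h2]] := near_u _ e0.
  have wu := FW _ (uF n); have wTu := WT _ wu; have wz := FW _ Fz.
  have q1 : ip (T (T (u n)) - M *: u n) (T (T (u n)) - M *: u n) <= M * e.
    rewrite nsB nsZ ipZr u1 (bT _ _ wTu wu) (bC wTu wu) -(bT _ _ wu wTu).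
    have := TM _ (FT _ (uF n)); have := uM n.
    move: h2; set a := ip (T (u n)) (T (u n)); set c := n.+1%:R^-1 => h2 h3 h4.
    have : M * (M - a) <= M * e by rewrite ler_pM2l//; lra.
    lra.
  have q2 : ip (T z - M *: u n) (T z - M *: u n) <= 2 * M * e + 2 * (M * e).
    apply: le_trans (nsB_le (T (T (u n))) _ _) _.
    rewrite nsBC TB//.
    have : ip (T (T (u n) - z)) (T (T (u n) - z)) <= M * ip (T (u n) - z) (T (u n) - z).
      by apply: TM; apply: subspaceB => //; exact: FT.
    have : M * ip (T (u n) - z) (T (u n) - z) <= M * e by rewrite ler_pM2l// ltW.
    lra.
  have wMu : W (M *: u n) by exact: subspaceZ.
  have q3 : ip (T (T z) - T (M *: u n)) (T (T z) - T (M *: u n)) <= C * (4 * M * e).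
    rewrite TB//; last exact: WT.
    apply: le_trans (TC _ _) _; first by apply: subspaceB => //; exact: WT.
    by rewrite ler_pM2l//; lra.
  have q4 : ip (T (M *: u n) - M *: z) (T (M *: u n) - M *: z) <= M ^+ 2 * e.
    rewrite (_ : ip _ _ = ip (M *: (T (u n) - z)) (M *: (T (u n) - z))).
      by rewrite nsZ ler_pM2l ?exprn_gt0// ltW.
    apply: ns_eq.
    - by apply: subspaceB => //; [exact: WT|exact: subspaceZ].
    - by apply: subspaceZ => //; apply: subspaceB.
    move=> v wv; rewrite scalerBr !ipBl !(ipZl hip) !bT//.
    rewrite -(addr0 (M *: u n)) bl//; last exact: sW.1.
    rewrite b0//.
    by ring.
  apply: le_trans (nsB_le (T (M *: u n)) _ _) _; nra.
(* [T z + s *: z] satisfies the eigenvector equation for [s] and lies in [F], hence is orthogonal to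
   itself. The two signs of [s] together then annihilate [z]. *)
have hE (s : R) : s ^+ 2 = M -> ip (T z + s *: z) (T z + s *: z) = 0.
  move=> sM; have wz := FW _ Fz; have wTz := WT _ wz.
  have Fe : F (T z + s *: z) by apply: subspaceD => //; [exact: FT|exact: subspaceZ].
  apply: Fe.2; split; first exact: Fe.1.
  exists s; first by apply/eqP => s0; move: M0; rewrite -sM s0 expr0n ltxx.
  move=> x wx; rewrite addrC bl// -!bT// (ipDl hip) (ipZl hip).
  have -> : ip (T (T z)) x = M * ip z x.
    by apply/eqP; rewrite -subr_eq0 -(ipZl hip) -ipBl ns0_ip.
  by rewrite -sM; ring.
have h1 := hE _ (sqr_sqrtr (ltW M0)).
have h2 : ip (T z + - Num.sqrt M *: z) (T z + - Num.sqrt M *: z) = 0.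
  by apply: hE; rewrite sqrrN sqr_sqrtr// ltW.
have := nsD_le (T z + Num.sqrt M *: z) (- (T z + - Num.sqrt M *: z)).
rewrite ipNl ipNr opprK h1 h2 opprD addrACA subrr add0r -scaleNr opprK -scalerDl nsZ.
rewrite mulr0 addr0 leNgt => /negP; apply.
by rewrite mulr_gt0// exprn_gt0// addr_gt0 ?sqrtr_gt0.
Qed.

(** Here [x] may lie outside [W], as will a vector with only one nonzero component relative to a
    graph. Its projection inherits the orthogonality because eigenvectors lie in [W]. *)
Lemma spectral_orth x : (forall e, eigenvector e -> ip x e = 0) ->
  exists y, [/\ W y, forall v, W v -> ip (x - y) v = 0 & forall v, W v -> b y v = 0].
Proof.
move=> h; have [y wy hy] := projection sW cW x.
exists y; split => //; apply: spectral => // e he.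
by have := hy _ he.1; rewrite ipBl h// sub0r => /eqP; rewrite oppr_eq0 => /eqP.
Qed.

End Spectral.
End HilbertTheory.

(** * Square-integrable functions *)

Section L2.
Context d (T : measurableType d) (R : realType).
Variables (mu : {measure set T -> \bar R}) (D : set T).

Definition sqint (f : T -> R) : Prop :=
  measurable_fun D f /\ mu.-integrable D (fun x => (f x ^+ 2)%:E).

Definition ipi (f g : T -> R) : R := \int[mu]_(x in D) (f x * g x).

Hypothesis mD : measurable D.

Lemma sqint_mul f g : sqint f -> sqint g ->
  mu.-integrable D (fun x => (f x * g x)%:E).
Proof.
move=> [mf hf] [mg hg].
apply: (le_integrable mD _ _ (integrableD mD hf hg)).
  by apply/measurable_EFinP; exact: measurable_funM.
move=> x _ /=; rewrite lee_fin normrM.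
rewrite (ger0_norm (addr_ge0 (sqr_ge0 (f x)) (sqr_ge0 (g x)))).
have := sqr_ge0 (`|f x| - `|g x|); rewrite sqrrB !real_normK ?num_real// => h.
have := mulr_ge0 (normr_ge0 (f x)) (normr_ge0 (g x)); lra.
Qed.

Lemma sqint0 : sqint (fun=> 0).
Proof.
split; first exact: measurable_cst.
by rewrite expr0n /=; exact: integrable0.
Qed.

Lemma sqintZD a f g : sqint f -> sqint g -> sqint (fun x => a * f x + g x).
Proof.
move=> [mf hf] [mg hg]; have hfg := sqint_mul (conj mf hf) (conj mg hg).
split.
  apply: measurable_funD => //; apply: measurable_funM => //; exact: measurable_cst.
apply: eq_integrable (integrableD mD (integrableZl mD (a ^+ 2) hf)
  (integrableD mD (integrableZl mD (2 * a) hfg) hg)) => //.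
by move=> x _; rewrite /= -!EFinM -!EFinD; congr EFin; ring.
Qed.

Lemma sqintZ a f : sqint f -> sqint (fun x => a * f x).
Proof.
move=> hf; have := sqintZD a hf sqint0.
by under [X in sqint X -> _]eq_fun do rewrite addr0.
Qed.

Lemma sqintD f g : sqint f -> sqint g -> sqint (fun x => f x + g x).
Proof.
by move=> hf hg; have := sqintZD 1 hf hg; under eq_fun do rewrite mul1r.
Qed.

Lemma sqintB f g : sqint f -> sqint g -> sqint (fun x => f x - g x).
Proof.
move=> hf hg; have := sqintZD (-1) hg hf.
by under eq_fun do rewrite mulN1r addrC.
Qed.

Lemma ipiC f g : ipi f g = ipi g f.
Proof. by apply: eq_Rintegral => x _; rewrite mulrC. Qed.

Lemma ipiZDl a f g h : sqint f -> sqint g -> sqint h ->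
  ipi (fun x => a * f x + g x) h = a * ipi f h + ipi g h.
Proof.
move=> hf hg hh; have hfh := sqint_mul hf hh; have hgh := sqint_mul hg hh.
rewrite /ipi -RintegralZl// -RintegralD//; last exact: (integrableZl mD a hfh).
by apply: eq_Rintegral => x _; ring.
Qed.

Lemma ipi_ge0 f : 0 <= ipi f f.
Proof. by apply: Rintegral_ge0 => x _; rewrite -expr2 sqr_ge0. Qed.

Lemma integral_sqr f : sqint f ->
  (\int[mu]_(x in D) (f x ^+ 2)%:E)%E = (ipi f f)%:E.
Proof.
move=> hf; rewrite /ipi /Rintegral fineK.
  by apply: eq_integral => x _; rewrite expr2.
by apply: integrable_fin_num => //; exact: sqint_mul.
Qed.

Lemma eq_ipi f f' g g' : {in D, f =1 f'} -> {in D, g =1 g'} ->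
  ipi f g = ipi f' g'.
Proof. by move=> h1 h2; apply: eq_Rintegral => x xD; rewrite h1// h2. Qed.

Lemma limn_einf_le (a : nat -> \bar R) (c : \bar R) k :
  (forall n, (k <= n)%N -> (a n <= c)%E) -> (limn_einf a <= c)%E.
Proof.
move=> h; rewrite limn_einf_lim; apply: lime_le; first exact: is_cvg_einfs.
apply: nearW => n; apply: (@le_trans _ _ (a (maxn n k))); last first.
  by apply: h; rewrite leq_maxr.
by apply: ereal_inf_lbound; exists (maxn n k) => //=; rewrite leq_maxl.
Qed.

Lemma cvg_of_geometric (v : nat -> R) C :
  (forall n, `|v n.+1 - v n| <= C * (1 / 2) ^+ n) -> cvgn v.
Proof.
move=> h.
have C0 : 0 <= C.
  by have := h 0%N; rewrite expr0 mulr1; apply: le_trans.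
have q1 : `|1 / 2 : R| < 1 by rewrite ger0_norm; lra.
have : cvgn (series (fun n => v n.+1 - v n)).
  apply: normed_cvg.
  apply: (series_le_cvg _ _ h) => [n|n|]; first exact: normr_ge0.
    by rewrite mulr_ge0// exprn_ge0//; lra.
  by have := @is_cvg_geometric_series R C _ q1.
have E : (fun n => v 0%N + series (fun n => v n.+1 - v n) n) = v.
  by apply/funext => n; rewrite /series /= telescope_sumr// addrC subrK.
move=> h1; rewrite -[X in cvgn X]E; apply: is_cvgD => //.
exact: (@is_cvg_cst R^o).
Qed.

(** The Riesz-Fischer theorem: a fast subsequence converges almost everywhere, and Fatou's lemma
    turns this into convergence in mean of the whole sequence. *)
Lemma sqint_complete (u : nat -> T -> R) : (forall n, sqint (u n)) ->
  (forall e, 0 < e -> exists N, forall m n, (N <= m)%N -> (N <= n)%N ->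
     ipi (fun x => u m x - u n x) (fun x => u m x - u n x) < e) ->
  exists2 l, sqint l & forall e, 0 < e -> exists N, forall n, (N <= n)%N ->
     ipi (fun x => u n x - l x) (fun x => u n x - l x) < e.
Proof.
move=> hu cau.
have hN k : exists N, forall m n, (N <= m)%N -> (N <= n)%N ->
    ipi (fun x => u m x - u n x) (fun x => u m x - u n x) < (1 / 8) ^+ k.
  by apply: cau; rewrite exprn_gt0//; lra.
have {hN}[N hN] := choice hN.
pose M k := (k + \max_(j < k.+1) N j)%N.
have MN k j : (j <= k)%N -> (N j <= M k)%N.
  move=> jk; rewrite /M; apply: leq_trans (leq_addl _ _).
  by have := @leq_bigmax _ (fun j : 'I_k.+1 => N j) (inord j); rewrite inordK.
pose w k := u (M k).
have dw k : ipi (fun x => w k.+1 x - w k x) (fun x => w k.+1 x - w k x) < (1 / 8) ^+ k.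
  by apply: hN; apply: MN.
have hd k : sqint (fun x => w k.+1 x - w k x) by apply: sqintB; exact: hu.
(* The weight [4 ^+ k] is small enough against [(1 / 8) ^+ k] for [S] to be integrable, and large
   enough for finiteness of [S x] to force increments of order [(1 / 2) ^+ k]. *)
pose S x := (\sum_(0 <= k <oo) (4 ^+ k * (w k.+1 x - w k x) ^+ 2)%:E)%E.
have mt k : measurable_fun D (fun x => (4 ^+ k * (w k.+1 x - w k x) ^+ 2)%:E).
  apply/measurable_EFinP; apply: measurable_funM; first exact: measurable_cst.
  by apply: measurable_funX; exact: (hd k).1.
have t0 k x : (0 <= (4 ^+ k * (w k.+1 x - w k x) ^+ 2)%:E)%E.
  by rewrite lee_fin; apply: mulr_ge0; [exact: exprn_ge0|exact: sqr_ge0].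
have iS : mu.-integrable D S.
  apply/integrableP; split.
    by apply: ge0_emeasurable_sum => // k x _ _; exact: t0.
  have S0 x : (0 <= S x)%E by apply: nneseries_ge0 => k _ _; exact: t0.
  under eq_integral do rewrite gee0_abs//.
  rewrite /S integral_nneseries//.
  apply: (@le_lt_trans _ _ (\sum_(0 <= k <oo) (2 / (2 ^ (k + 1))%:R)%:E)%E).
    apply: lee_nneseries => [k _ _|k _].
      by apply: integral_ge0 => x _; exact: t0.
    under eq_integral do rewrite EFinM.
    rewrite integralZl//; last exact: (hd k).2.
    rewrite integral_sqr// -EFinM lee_fin.
    have := dw k; set a := ipi _ _ => h.
    rewrite natrX exprD expr1 invfM mulrCA mulfV ?mulr1//.
    apply: (@le_trans _ _ (4 ^+ k * (1 / 8) ^+ k)).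
      by rewrite ler_pM2l ?exprn_gt0// ltW.
    rewrite -exprMn -exprVn; apply: lerXn2r; rewrite ?nnegrE; lra.
  have := @cvg_geometric_eseries_half R 2 0.
  by move=> /cvg_lim => ->//; rewrite ltry.
have [A [mA A0 hA]] := integrable_ae mD iS.
have Sfin x : D x -> ~ A x -> S x \is a fin_num.
  by move=> Dx nAx; apply: contrapT => h; apply: nAx; apply: hA => /= /(_ Dx).
(* Setting the functions to zero on the null set [A] makes the limit exist everywhere on [D], hence
   measurable. *)
pose v k x := \1_(~` A) x * w k x.
have vA k x : ~ A x -> v k x = w k x by move=> h; rewrite /v indicE mem_set// mul1r.
have v0 k x : A x -> v k x = 0.
  by move=> h; rewrite /v indicE memNset ?mul0r// => /(_ h).
have cv x : D x -> cvgn (v ^~ x).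
  move=> Dx; have [Ax|nAx] := pselect (A x).
    have -> : v ^~ x = (fun=> 0) by apply/funext => k; exact: v0.
    exact: (@is_cvg_cst R^o).
  have -> : v ^~ x = w ^~ x by apply/funext => k; exact: vA.
  have := Sfin _ Dx nAx; case ES : (S x) => [s| |]// _.
  have hs k : 4 ^+ k * (w k.+1 x - w k x) ^+ 2 <= s.
    rewrite -lee_fin -ES; apply: le_trans (nneseries_lim_ge k.+1 _).
      rewrite big_nat_recr//= leeDr// big_nat.
      by apply: sume_ge0 => i _; exact: t0.
    by move=> i _ _; exact: t0.
  have s0 : 0 <= s by apply: le_trans (hs 0%N); apply: mulr_ge0; [exact: exprn_ge0|exact: sqr_ge0].
  (* [1 + s] serves as a bound for the square root of [s]. *)
  apply: (@cvg_of_geometric _ (1 + s)) => k.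
  rewrite div1r exprVn ler_pdivlMr ?exprn_gt0//.
  rewrite -(@ler_pXn2r _ 2)// ?nnegrE ?mulr_ge0 ?exprn_ge0 ?addr_ge0//.
  rewrite exprMn real_normK ?num_real// mulrC -exprM mulnC exprM.
  have -> : 2 ^+ 2 = 4 :> R by ring.
  by apply: le_trans (hs k) _; nra.
pose f x := limn (v ^~ x).
have mv k : measurable_fun D (v k).
  apply: measurable_funM; last exact: (hu _).1.
  exact: measurable_indic (measurableC mA).
have mf : measurable_fun D f by apply: (measurable_fun_cvg mv) => x; exact: cv.
have bnd m c k : (forall j, (k <= j)%N ->
    ipi (fun x => u m x - w j x) (fun x => u m x - w j x) <= c) ->
    (\int[mu]_(x in D) ((u m x - f x) ^+ 2)%:E <= c%:E)%E.
  move=> h.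
  have mvj j : measurable_fun D (fun x => ((u m x - v j x) ^+ 2)%:E).
    apply/measurable_EFinP; apply: measurable_funX; apply: measurable_funB => //.
    exact: (hu m).1.
  have -> : (\int[mu]_(x in D) ((u m x - f x) ^+ 2)%:E =
      \int[mu]_(x in D) limn_einf (fun j => ((u m x - v j x) ^+ 2)%:E))%E.
    apply: eq_integral => x; rewrite inE => Dx; apply/esym.
    suff : (fun j => ((u m x - v j x) ^+ 2)%:E) @ \oo --> ((u m x - f x) ^+ 2)%:E.
      by move=> /cvg_limn_einf_sup[].
    apply: cvg_EFin; first by near=> j.
    have cB : (fun j => u m x - v j x) @ \oo --> u m x - f x.
      by apply: cvgB; [exact: (@cvg_cst R^o)|exact: cv].
    exact: (cvgM cB cB).
  apply: le_trans (fatou _ _ _ _) _ => //.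
    by move=> j x _; rewrite lee_fin sqr_ge0.
  apply: (@limn_einf_le _ _ k) => j kj.
  rewrite (ae_eq_integral (fun x => ((u m x - w j x) ^+ 2)%:E))//.
  - by rewrite integral_sqr ?lee_fin ?h//; apply: sqintB => //; exact: hu.
  - apply/measurable_EFinP; apply: measurable_funX; exact: (sqintB (hu m) (hu _)).1.
  - exists A; split => // x /= /not_implyP[Dx]; apply: contra_notP => nA.
    by rewrite vA.
have sq m c k : (forall j, (k <= j)%N ->
    ipi (fun x => u m x - w j x) (fun x => u m x - w j x) <= c) ->
    sqint (fun x => u m x - f x).
  move=> /bnd h; split; first by apply: measurable_funB => //; exact: (hu m).1.
  apply/integrableP; split.
    apply/measurable_EFinP; apply: measurable_funX; apply: measurable_funB => //.
    exact: (hu m).1.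
  under eq_integral do rewrite gee0_abs ?lee_fin ?sqr_ge0//.
  by apply: le_lt_trans h _; rewrite ltry.
have key e : 0 < e -> exists k, forall m, (k <= m)%N -> forall j, (k <= j)%N ->
    ipi (fun x => u m x - w j x) (fun x => u m x - w j x) <= e.
  move=> e0; have [K hK] := cau _ e0; exists K => m Km j Kj.
  by apply/ltW/hK => //; apply: leq_trans Kj _; exact: leq_addr.
exists f.
  have [k hk] := key _ ltr01; have := sqintB (hu k) (sq _ _ _ (hk k (leqnn k))).
  by under eq_fun do rewrite opprB addrC subrK.
move=> e e0; have [|k hk] := key (e / 2); first by lra.
exists k => m km; have h := bnd _ _ _ (hk m km).
rewrite integral_sqr in h; last exact: sq (hk m km).
by move: h; rewrite lee_fin; lra.
Unshelve. all: by end_near. Qed.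

End L2.

(** * Square-integrable functions as a Hilbert space, and direct sums *)

Section L2type.
Context d (T : measurableType d) (R : realType).
Variables (mu : {measure set T -> \bar R}) (D : set T).
Hypothesis mD : measurable D.

(** The measurability proof is an argument because the submodule structure attached to this
    predicate depends on it. *)
Definition sqint_pred of measurable D : {pred T -> R} := mem [set f | sqint mu D f].

Record L2type := L2Type { L2val :> T -> R; _ : L2val \in sqint_pred mD }.

HB.instance Definition _ := [isSub for L2val].
HB.instance Definition _ := [Choice of L2type by <:].

Lemma sqint_submod_closed : submod_closed (sqint_pred mD).
Proof.
split; first by rewrite inE; exact: sqint0.
by move=> a f g /set_mem hf /set_mem hg; rewrite inE; exact: sqintZD.
Qed.

HB.instance Definition _ :=
  GRing.isSubmodClosed.Build _ _ (sqint_pred mD) sqint_submod_closed.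
HB.instance Definition _ := [SubChoice_isSubLmodule of L2type by <:].

Lemma L2typeP (f : L2type) : sqint mu D f.
Proof. by case: f => f /= /set_mem. Qed.

Definition toL2 f (hf : sqint mu D f) : L2type := @L2Type f (mem_set hf).

Lemma L2_hilbert : hilbert (fun f g : L2type => ipi mu D f g).
Proof.
split.
- by move=> f g; exact: ipiC.
- move=> f g h; rewrite -[ipi _ _ f h]mul1r -ipiZDl; try exact: L2typeP.
  by apply: eq_ipi => // x _ /=; rewrite mul1r.
  exact: mD.
- move=> a f g; rewrite -[RHS]addr0.
  have -> : 0 = ipi mu D (fun=> 0) g.
    rewrite /ipi; under eq_Rintegral do rewrite mul0r.
    by rewrite Rintegral_cst// mul0r.
  rewrite -ipiZDl; try exact: L2typeP; try exact: sqint0; try exact: mD.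
  by apply: eq_ipi => // x _ /=; rewrite addr0.
- by move=> f; exact: ipi_ge0.
move=> u cau; have [l hl hcv] := sqint_complete mD (fun n => L2typeP (u n)) cau.
by exists (toL2 hl).
Qed.

End L2type.

Section Sum.
Variables (R : realType) (V : lmodType R) (ip : V -> V -> R) (I : finType).
Hypothesis hip : hilbert ip.

(** Direct sums are used for vector fields, for the graphs of grad and rot, and for pairs of real
    and imaginary parts. *)
Definition ipsum (f g : I -> V) : R := \sum_i ip (f i) (g i).

Lemma ipsum_hilbert : hilbert ipsum.
Proof.
split.
- by move=> f g; apply: eq_bigr => i _; rewrite (ipC hip).
- by move=> f g h; rewrite /ipsum -big_split; apply: eq_bigr => i _; rewrite /= (ipDl hip).
- by move=> a f g; rewrite /ipsum mulr_sumr; apply: eq_bigr => i _; rewrite /= (ipZl hip).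
- by move=> f; apply: sumr_ge0 => i _; exact: ip_ge0.
move=> u cau.
have le_sum (f : I -> V) i : ip (f i) (f i) <= ipsum f f.
  rewrite /ipsum (bigD1 i)//= lerDl; apply: sumr_ge0 => j _; exact: ip_ge0.
have hl i : exists l, forall e, 0 < e -> exists N, forall n, (N <= n)%N ->
    ip (u n i - l) (u n i - l) < e.
  apply: (ip_complete hip (u := fun n => u n i)) => e e0.
  have [N hN] := cau _ e0; exists N => m n hm hn.
  by apply: le_lt_trans (hN _ _ hm hn); apply: (le_sum (u m - u n)).
have {hl}[l hl] := choice hl.
exists l => e e0.
(* The successor keeps the divisor positive and the last inequality strict, also for empty [I]. *)
pose e' := e / #|I|.+1%:R; have e'0 : 0 < e' by rewrite divr_gt0.
have {hl}[N hN] := choice (fun i => hl i e' e'0).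
exists (\max_i N i)%N => n hn.
apply: (@le_lt_trans _ _ (\sum_(i : I) e')).
  apply: ler_sum => i _; apply: ltW; apply: hN; apply: leq_trans hn.
  exact: leq_bigmax.
rewrite sumr_const -mulr_natr /e' -mulrA -[ltRHS]mulr1 ltr_pM2l// mulrC.
by rewrite ltr_pdivrMr// mul1r ltr_nat.
Qed.

End Sum.

(** * Lebesgue measure and test functions on the space *)

Section Space3.
Variable R : realType.
Notation mR := (measurableTypeR R).
Notation mR3 := (mR * mR * mR)%type.
Notation R3 := (R * R * R)%type.
Notation mu3 := (@leb3 R).
Notation leb := (@lebesgue_measure R).

Definition preserving d (T : measurableType d) (mu : set T -> \bar R) (f : T -> T) := measurable_fun setT f /\
  forall A, measurable A -> mu (f @^-1` A) = mu A.

Lemma preserving_shift (a : R) : preserving leb (fun x : mR => (a + x : mR)).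
Proof.
have mf : measurable_fun setT (fun x : mR => (a + x : mR)).
  by apply: measurable_funD; [exact: measurable_cst|exact: measurable_id].
split => // A mA.
apply/esym.
apply: (@lebesgue_measure_unique R (pushforward leb (fun x : mR => (a + x : mR)))).
  2: exact: mA.
move=> X [[x y] _ <-] /=; rewrite /pushforward.
have -> : (fun z : mR => (a + z : mR)) @^-1` `]x, y] = `](x - a), (y - a)]%classic.
  by apply/seteqP; split => z /=; rewrite !in_itv /= ltrBlDl lerBrDl.
rewrite !lebesgue_measure_itv /= !lte_fin ltrD2r; case: ifP => // _.
by rewrite -!EFinB; congr EFin; ring.
Qed.

Lemma preserving_prod d1 d2 (T1 : measurableType d1) (T2 : measurableType d2)
  (m1 : {sigma_finite_measure set T1 -> \bar R})
  (m2 : {sigma_finite_measure set T2 -> \bar R}) f g :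
  preserving m1 f -> preserving m2 g ->
  preserving (m1 \x m2)%E (fun x => (f x.1, g x.2)).
Proof.
move=> [mf hf] [mg hg].
have mfg : measurable_fun setT (fun x : T1 * T2 => (f x.1, g x.2)).
  by apply/measurable_fun_pairP; split;
    [exact: (measurableT_comp mf measurable_fst)|exact: (measurableT_comp mg measurable_snd)].
split => // A mA.
apply/esym.
apply: (@product_measure_unique _ _ _ _ _ m1 m2
  (pushforward (m1 \x m2)%E (fun x : T1 * T2 => (f x.1, g x.2)))) => // B C mB mC.
rewrite /pushforward.
transitivity ((m1 \x m2)%E ((f @^-1` B) `*` (g @^-1` C))); first by [].
have mfB : measurable (f @^-1` B) by rewrite -[X in measurable X]setTI; exact: mf.
have mgC : measurable (g @^-1` C) by rewrite -[X in measurable X]setTI; exact: mg.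
by rewrite product_measure1E//; congr (_ * _)%E; [exact: hf|exact: hg].
Qed.

(* The library's sigma-finite structure on products is keyed to probability
   measures, hence this copy. *)
Definition leb2 : set (mR * mR)%type -> \bar R := (leb \x leb)%E.

HB.instance Definition _ := Measure.on leb2.

Lemma leb2_sigma_finite : sigma_finite setT leb2.
Proof.
have /sigma_finiteP[F [TF ndF Foo]] := sigma_finiteT leb.
exists (fun n => F n `*` F n).
  rewrite -setXTT TF predeqE => -[x y]; split.
    move=> [/= [n _ Fnx] [k _ Gky]]; exists (maxn n k) => //; split.
    - by move: x Fnx; exact/subsetPset/ndF/leq_maxl.
    - by move: y Gky; exact/subsetPset/ndF/leq_maxr.
  by move=> [n _ []/= ? ?]; split; exists n.
move=> k; have [? ?] := Foo k.
split; first exact: measurableX.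
by rewrite /leb2 product_measure1E// lte_mul_pinfty// ge0_fin_numE.
Qed.

HB.instance Definition _ := Measure_isSigmaFinite.Build _ _ _ leb2 leb2_sigma_finite.

Lemma preserving_shift3 (v : R3) : preserving mu3 (fun x : mR3 => (v + x : mR3)).
Proof.
have h1 : preserving leb2 (fun x : mR * mR => (v.1.1 + x.1, v.1.2 + x.2)).
  exact: preserving_prod (preserving_shift v.1.1) (preserving_shift v.1.2).
have h := preserving_prod h1 (preserving_shift v.2).
have E : (fun x : mR3 => ((v.1.1 + x.1.1, v.1.2 + x.1.2), v.2 + x.2)) = (fun x : mR3 => v + x : mR3).
  by apply/funext => -[[a b] c].
rewrite -E.
exact h.
Qed.

Lemma measurable_shift3 (v : R3) : measurable_fun setT (fun x : mR3 => (v + x : mR3)).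
Proof. by have [] := preserving_shift3 v. Qed.

Lemma ge0_integral_shift3 (v : R3) (f : mR3 -> \bar R) :
  measurable_fun setT f -> (forall x, 0 <= f x)%E ->
  (\int[mu3]_x f (v + x)%R = \int[mu3]_x f x)%E.
Proof.
move=> mf f0; have [mv hv] := preserving_shift3 v.
transitivity (\int[pushforward mu3 (fun x : mR3 => (v + x)%R : mR3)]_x f x)%E.
  apply/esym; apply: (ge0_integral_pushforward mv) => //.
by apply: eq_measure_integral => A mA _; exact: (hv A mA).
Qed.

Lemma integral_shift3 (v : R3) (f : mR3 -> \bar R) :
  measurable_fun setT f ->
  mu3.-integrable setT (fun x => f (v + x)) ->
  (\int[mu3]_x f (v + x)%R = \int[mu3]_x f x)%E.
Proof.
move=> mf hf; have [mv hv] := preserving_shift3 v.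
transitivity (\int[pushforward mu3 (fun x : mR3 => (v + x)%R : mR3)]_x f x)%E.
  apply/esym; apply: (integral_pushforward mv) => //.
by apply: eq_measure_integral => A mA _; exact: (hv A mA).
Qed.

(** A countable base of the topology; for the maximum norm its members are boxes, which are
    measurable in the product. *)
Definition qball (n : nat) : set R3 :=
  if unpickle n is Some (p, q, s, m) then
    ball ((ratr p, ratr q, ratr s) : R3) (m.+1%:R^-1 : R)
  else set0.

Lemma ball3E (x y : R3) (r : R) : ball x r y <->
  [/\ `|x.1.1 - y.1.1| < r, `|x.1.2 - y.1.2| < r & `|x.2 - y.2| < r].
Proof. by split => [[[? ?] ?]|[? ? ?]] //; split. Qed.

Lemma measurable_ball3 (x : R3) (r : R) : measurable (ball x r : set mR3).
Proof.
have -> : ball x r = (ball x.1.1 r `*` ball x.1.2 r) `*` ball x.2 r :> set R3.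
  by [].
by apply: measurableX; [apply: measurableX|]; exact: measurable_ball.
Qed.

Lemma measurable_qball n : measurable (qball n : set mR3).
Proof.
rewrite /qball; case: unpickle => [[[[p q] s] m]|]; last exact: measurable0.
exact: measurable_ball3.
Qed.

(** The doubled ball is recorded too: later, closed boxes that reach the faces of the small ball
    must still lie in [U]. *)
Lemma qball_basis (U : set R3) x : open U -> U x ->
  exists2 n, qball n x & exists y r, [/\ 0 < r, qball n = ball y r &
    forall z, ball y (r + r) z -> U z].
Proof.
move=> oU Ux.
have /nbhs_ballP[e /= e0 he] : nbhs x U by exact: open_nbhs_nbhs.
(* A point of the doubled ball is within [3 r] of [x], where [r < e / 4]. *)
have [m _ hm] : exists2 m, True & m.+1%:R^-1 < e / 4 :> R.
  have [|m hm] := @invn_small R (e / 4); first by lra.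
  by exists m => //; exact: hm.
have r0 : 0 < m.+1%:R^-1 :> R by rewrite invr_gt0.
move: r0 hm; set r := m.+1%:R^-1 => r0 hm.
have rat_close (a : R) : exists q : rat, `|ratr q - a| < r.
  have [|q] := @rat_in_itvoo R (a - r) (a + r); first by lra.
  by rewrite in_itv /= => /andP[h1 h2]; exists q; rewrite ltr_norml; lra.
have [p hp] := rat_close x.1.1; have [q hq] := rat_close x.1.2.
have [s hs] := rat_close x.2.
exists (pickle (p, q, s, m)); rewrite /qball pickleK.
  by apply/ball3E; split.
exists (ratr p, ratr q, ratr s), r; split => // z /ball3E /= [h1 h2 h3].
have close (a b c : R) : `|c - a| < r -> `|c - b| < r + r -> `|a - b| < e.
  by rewrite !ltr_norml => /andP[? ?] /andP[? ?]; apply/andP; split; lra.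
by apply: he; apply/ball3E; split; [exact: close hp h1|exact: close hq h2|exact: close hs h3].
Qed.

Lemma open_measurable3 (U : set R3) : open U -> measurable (U : set mR3).
Proof.
move=> oU.
have -> : U = \bigcup_(n in [set n | qball n `<=` U]) qball n.
  apply/seteqP; split => [x Ux|x [n hn]]; last exact: hn.
  have [n nx [y [r [r0 E h]]]] := qball_basis oU Ux.
  exists n => //= z; rewrite E => hz; apply: h.
  by apply: le_ball hz; lra.
by apply: bigcup_measurable => n _; exact: measurable_qball.
Qed.

Lemma continuous_measurable3 (f : R3 -> R) :
  continuous f -> measurable_fun setT (f : mR3 -> R).
Proof.
move=> cf; apply: (measurability _ (RGenOInfty.measurableE R)).
move=> /= _ [_ [a ->] <-]; rewrite setTI; apply: open_measurable3.
by apply: open_comp => // x _; exact: cf.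
Qed.

Definition cube (r : R) : set R3 := [set x | [/\ `|x.1.1| <= r, `|x.1.2| <= r & `|x.2| <= r]].

Lemma cubeE (r : R) : cube r = (`[- r, r] `*` `[- r, r]) `*` `[- r, r].
Proof.
apply/seteqP; split => x; rewrite /cube /= !in_itv /= -!ler_norml.
  by case.
by move=> [[]].
Qed.

Lemma measurable_cube r : measurable (cube r : set mR3).
Proof. by rewrite cubeE; apply: measurableX; [apply: measurableX|]; exact: measurable_itv. Qed.

Lemma leb3_itv (i j k : interval R) :
  mu3 (([set` i] `*` [set` j]) `*` [set` k]) =
  (leb [set` i] * leb [set` j] * leb [set` k])%E.
Proof.
rewrite /leb3 product_measure1E; [|by apply: measurableX; exact: measurable_itv|exact: measurable_itv].
by congr (_ * _)%E; apply: product_measure1E; exact: measurable_itv.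
Qed.

Lemma leb3_cube r : (mu3 (cube r) < +oo)%E.
Proof.
rewrite cubeE leb3_itv lebesgue_measure_itv /=; case: ifP => _; last by rewrite !mul0e.
by rewrite -EFinB -!EFinM ltry.
Qed.

Lemma compact_cube (K : set R3) : compact K -> exists2 r, 0 < r & K `<=` cube r.
Proof.
move=> /compact_bounded [M [_ hM]]; exists (`|M| + 1); first by have := normr_ge0 M; lra.
move=> x Kx; have /(_ _ Kx) : forall x, K x -> `|x| <= `|M| + 1.
  by apply: hM; have := ler_norm M; lra.
by rewrite /cube /= [`|x|]/(Num.max (Num.max `|x.1.1| `|x.1.2|) `|x.2|) !ge_max => /andP[/andP[]].
Qed.

End Space3.

(** * Calculus of smooth functions and of test functions *)

Section SmoothCalculus.
Variable R : realType.
Notation R3 := (R * R * R)%type.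
Implicit Types (f g : R3 -> R) (x y : R3) (i j : 'I_3).

Lemma classC_continuous k f : classC k f -> continuous f.
Proof. by case: k => [|k] []. Qed.

Lemma classCS k f : classC k.+1 f -> classC k f.
Proof.
elim: k f => [|k IH] f [cf hf]; first by split.
by split => // i; have [df cd] := hf i; split => //; exact: IH.
Qed.

Lemma partialD f g i : (forall x, derivable f x (basis3 R i)) ->
  (forall x, derivable g x (basis3 R i)) ->
  partial i (fun x => f x + g x) = (fun x => partial i f x + partial i g x).
Proof. by move=> hf hg; apply/funext => x; rewrite /partial deriveD. Qed.

Lemma partialZ a f i : (forall x, derivable f x (basis3 R i)) ->
  partial i (fun x => a * f x) = (fun x => a * partial i f x).
Proof. by move=> hf; apply/funext => x; rewrite /partial (deriveZ a (hf x)). Qed.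

Lemma partialM f g i : (forall x, derivable f x (basis3 R i)) ->
  (forall x, derivable g x (basis3 R i)) ->
  partial i (fun x => f x * g x) =
  (fun x => f x * partial i g x + g x * partial i f x).
Proof. by move=> hf hg; apply/funext => x; rewrite /partial (deriveM (hf x) (hg x)). Qed.

Lemma classCD k f g : classC k f -> classC k g -> classC k (fun x => f x + g x).
Proof.
elim: k f g => [|k IH] f g [cf hf] [cg hg]; (split; first by
  move=> x; apply: cvgD; [exact: cf|exact: cg]) => // i.
have [df pf] := hf i; have [dg pg] := hg i; split.
  by move=> x; exact: derivableD.
by rewrite partialD//; exact: IH.
Qed.

Lemma classCM k f g : classC k f -> classC k g -> classC k (fun x => f x * g x).
Proof.
elim: k f g => [|k IH] f g Cf Cg; have [cf hf] := Cf; have [cg hg] := Cg; (split; first by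
  move=> x; apply: cvgM; [exact: cf|exact: cg]) => // i.
have [df pf] := hf i; have [dg pg] := hg i; split.
  by move=> x; exact: derivableM.
by rewrite partialM//; apply: classCD; apply: IH => //; exact: classCS.
Qed.

Lemma partial_cst (a : R) i : partial i (fun=> a) = (fun=> 0).
Proof. by apply/funext => x; rewrite /partial derive_cst. Qed.

Lemma classC_cst k (a : R) : classC k (fun=> a).
Proof.
elim: k a => [|k IH] a; (split; first by move=> x; exact: cvg_cst) => // i.
by split; [move=> x; exact: derivable_cst|rewrite partial_cst; exact: IH].
Qed.

Lemma derivable_shift3 f (v x w : R3) :
  derivable f (v + x) w -> derivable (fun z => f (v + z)) x w.
Proof.
rewrite /derivable.
by under [X in cvg (X @ _) -> _]eq_fun do rewrite /= addrCA.
Qed.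

Lemma partial_shift3 f (v : R3) i :
  partial i (fun z : R3 => f (v + z)) = (fun x => partial i f (v + x)).
Proof.
apply/funext => x; rewrite /partial /derive.
by under [X in _ = lim (X @ _)]eq_fun do rewrite /= addrCA.
Qed.

Lemma continuous_shift3 f (v : R3) :
  continuous f -> continuous (fun z : R3 => f (v + z)).
Proof.
move=> cf x; apply: (@continuous_comp _ _ _ (fun z : R3 => v + z) f); last exact: cf.
by apply: cvgD; [exact: cvg_cst|exact: cvg_id].
Qed.

Lemma classC_shift3 k f (v : R3) : classC k f -> classC k (fun z : R3 => f (v + z)).
Proof.
elim: k f => [|k IH] f [cf hf]; (split; first exact: continuous_shift3) => // i.
have [df pf] := hf i; split; first by move=> x; exact: derivable_shift3.
by rewrite partial_shift3; exact: IH.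
Qed.

Lemma smoothD f g : smooth f -> smooth g -> smooth (fun x => f x + g x).
Proof. by move=> hf hg k; exact: classCD. Qed.

Lemma smoothM f g : smooth f -> smooth g -> smooth (fun x => f x * g x).
Proof. by move=> hf hg k; exact: classCM. Qed.

Lemma smooth_cst (a : R) : smooth (fun=> a).
Proof. by move=> k; exact: classC_cst. Qed.

Lemma smoothZ a f : smooth f -> smooth (fun x => a * f x).
Proof. by move=> hf; apply: smoothM => //; exact: smooth_cst. Qed.

Lemma smooth_shift3 f (v : R3) : smooth f -> smooth (fun z : R3 => f (v + z)).
Proof. by move=> hf k; exact: classC_shift3. Qed.

Lemma smooth_continuous f : smooth f -> continuous f.
Proof. by move=> /(_ 0%N)[]. Qed.

Lemma smooth_derivable f x i : smooth f -> derivable f x (basis3 R i).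
Proof. by move=> /(_ 1%N)[_ /(_ i)[]]. Qed.

Lemma smooth_partial f i : smooth f -> smooth (partial i f).
Proof. by move=> hf k; have [_ /(_ i)[]] := hf k.+1. Qed.

Lemma is_derive_slice f x i (t : R) : derivable f (t *: basis3 R i + x) (basis3 R i) ->
  is_derive t 1 (fun s : R => f (s *: basis3 R i + x)) (partial i f (t *: basis3 R i + x)).
Proof.
set e := basis3 R i => df.
have E : (fun h : R => h^-1 *: (((fun s : R => f (s *: e + x)) \o shift t) (h *: 1) -
     (fun s : R => f (s *: e + x)) t)) =
   (fun h : R => h^-1 *: ((f \o shift (t *: e + x)) (h *: e) - f (t *: e + x))).
  apply/funext => h /=; congr (_ *: (f _ - _)).
  by rewrite addrA -scalerDl [h *: 1]mulr1.
by split; rewrite /derivable /derive /partial E.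
Qed.

Lemma slice_mvt f x i (h : R) : smooth f -> exists2 c : R, `|c| <= `|h| &
  f (h *: basis3 R i + x) - f x = h * partial i f (c *: basis3 R i + x).
Proof.
move=> sf; set e := basis3 R i.
pose g (s : R) := f (s *: e + x).
have dg (t : R) : is_derive t 1 g (partial i f (t *: e + x)).
  by apply: is_derive_slice; exact: smooth_derivable.
have cg (I : interval R) : {within [set` I], continuous g}.
  by apply: derivable_within_continuous => t _; have [] := dg t.
have g0 : g 0 = f x by rewrite /g scale0r add0r.
have [h0|h0] := leP 0 h.
  have [c] := MVT_segment h0 (fun t _ => dg t) (cg _).
  rewrite in_itv /= => /andP[c0 ch]; rewrite g0 subr0 mulrC => E.
  by exists c => //; rewrite !ger0_norm.
have [c] := MVT_segment (ltW h0) (fun t _ => dg t) (cg _).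
rewrite in_itv /= => /andP[c0 ch]; rewrite g0 sub0r mulrN => E.
exists c; first by rewrite ler0_norm// ltr0_norm// lerN2.
by rewrite mulrC; apply: oppr_inj; rewrite opprB.
Qed.

Lemma decomp3 (v x : R3) : v + x = v.1.1 *: basis3 R ord0 +
   (v.1.2 *: basis3 R (inord 1) + (v.2 *: basis3 R (inord 2) + x)).
Proof.
rewrite !addrA; congr (_ + x); case: v => [[a b] c].
rewrite /basis3 /= !inordK//=.
transitivity (a * 1 + b * 0 + c * 0, a * 0 + b * 1 + c * 0, a * 0 + b * 0 + c * 1).
  by congr (_, _, _); ring.
by [].
Qed.

(** [K] is any compact set outside which [f] vanishes, not its exact support; sums, products,
    translates and averages then come with an obvious [K]. *)
Definition csupp (K : set R3) f := compact K /\ forall x, ~ K x -> f x = 0.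

Definition tst (G : set R3) f :=
  smooth f /\ exists2 K, csupp K f & K `<=` G.

Lemma hausdorff3 : hausdorff_space R3.
Proof. exact: norm_hausdorff. Qed.

Lemma csupp_closed K f : csupp K f -> closed K.
Proof. by move=> [cK _]; apply: compact_closed => //; exact: hausdorff3. Qed.

Lemma tst_test G f : tst G f <-> test_function G f.
Proof.
split=> [[sf [K [cK hK] KG]]|[sf cs sG]].
  have sub : closure [set x | f x != 0] `<=` K.
    have /closure_id -> := csupp_closed (conj cK hK); apply: closure_subset.
    by move=> x /eqP fx; apply: contrapT => /hK.
  split => //; last by move=> x /sub /KG.
  by apply: (subclosed_compact _ cK sub); exact: closed_closure.
split => //; exists (closure [set x | f x != 0]) => //; split => // x nx.
by apply: contrapT => /eqP fx; apply: nx; exact: subset_closure.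
Qed.

Lemma tst_sub G G' f : G `<=` G' -> tst G f -> tst G' f.
Proof.
move=> GG' [sf [K cK KG]]; split => //; exists K => //; exact: subset_trans GG'.
Qed.

Lemma csuppU K K' f g : csupp K f -> csupp K' g ->
  [/\ csupp (K `|` K') f, csupp (K `|` K') g & csupp (K `|` K') (fun x => f x + g x)].
Proof.
move=> [cK hK] [cK' hK'].
have c : compact (K `|` K') by exact: compactU.
split; split => // x /not_orP[h1 h2].
- exact: hK.
- exact: hK'.
- by rewrite hK// hK'// addr0.
Qed.

Lemma tstD G f g : tst G f -> tst G g -> tst G (fun x => f x + g x).
Proof.
move=> [sf [K hK KG]] [sg [K' hK' KG']]; split; first exact: smoothD.
by exists (K `|` K'); [by have [] := csuppU hK hK'|move=> x [/KG|/KG']].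
Qed.

Lemma tstM G f g : smooth f -> tst G g -> tst G (fun x => f x * g x).
Proof.
move=> sf [sg [K [cK hK] KG]]; split; first exact: smoothM.
by exists K => //; split => // x /hK ->; rewrite mulr0.
Qed.

Lemma tstZ G a f : tst G f -> tst G (fun x => a * f x).
Proof. by apply: tstM; exact: smooth_cst. Qed.

Lemma tstB G f g : tst G f -> tst G g -> tst G (fun x => f x - g x).
Proof.
move=> hf hg; have := tstD hf (tstZ (-1) hg).
by under [X in tst _ X -> _]eq_fun do rewrite mulN1r.
Qed.

Lemma tst0 G : tst G (fun=> 0).
Proof.
split; first exact: smooth_cst.
by exists set0 => //; split => //; exact: compact0.
Qed.

Lemma tst_sum G (I : Type) (s : seq I) (F : I -> R3 -> R) :
  (forall a, tst G (F a)) -> tst G (fun x => \sum_(a <- s) F a x).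
Proof.
move=> hF; elim: s => [|a s IH].
  by under eq_fun do rewrite big_nil; exact: tst0.
by under eq_fun do rewrite big_cons; exact: tstD.
Qed.

Lemma csupp_partial K f i : csupp K f -> csupp K (partial i f).
Proof.
move=> hK; have [cK h0] := hK; split => // x nKx.
have oK : open (~` K) by apply: closed_openC; exact: csupp_closed hK.
have nx : \forall y \near x, f y = 0.
  by apply: filterS (open_nbhs_nbhs (conj oK nKx)) => y; exact: h0.
rewrite /partial -(derive_cst (0 : R) x (basis3 R i)).
by apply: near_eq_derive => //; apply: filterS nx => y ->.
Qed.

Lemma tst_partial G f i : tst G f -> tst G (partial i f).
Proof.
move=> [sf [K hK KG]]; split; first exact: smooth_partial.
by exists K => //; exact: csupp_partial.
Qed.

Lemma csupp_bounded K f : csupp K f -> continuous f ->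
  exists2 C, 0 <= C & forall x, `|f x| <= C.
Proof.
move=> [cK h0] cf.
have /compact_bounded[M [_ hM]] : compact (f @` K).
  by apply: continuous_compact => //; exact: continuous_subspaceT.
exists (`|M| + 1); first by rewrite addr_ge0.
move=> x; have [Kx|/h0 ->] := pselect (K x); last by rewrite normr0 addr_ge0.
by apply: (hM (`|M| + 1)); [have := ler_norm M; lra|exists x].
Qed.

Lemma tst_bounded G f : tst G f -> exists2 C, 0 <= C & forall x, `|f x| <= C.
Proof.
by move=> [sf [K hK _]]; apply: csupp_bounded hK _; exact: smooth_continuous.
Qed.

(** The remainder is uniform in [x], so it survives averaging: this is how averages are
    differentiated under the integral sign. *)
Lemma tst_taylor G f i : tst G f -> exists2 C, 0 <= C & forall x (h : R),
  `|f (h *: basis3 R i + x) - f x - h * partial i f x| <= C * h ^+ 2.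
Proof.
move=> hf; have [C C0 hC] := tst_bounded (tst_partial i (tst_partial i hf)).
exists C => // x h.
have [c ch ->] := slice_mvt x i h hf.1.
rewrite -mulrBr.
have [c' _ ->] := slice_mvt x i c (smooth_partial i hf.1).
rewrite !normrM -(real_normK (num_real h)) mulrA expr2 mulrC.
apply: ler_pM; rewrite ?mulr_ge0//.
by apply: ler_pM.
Qed.

Lemma tst_lipschitz G f : tst G f -> exists2 C, 0 <= C & forall v x,
  `|f (v + x) - f x| <= C * (`|v.1.1| + `|v.1.2| + `|v.2|).
Proof.
move=> hf.
have [C0 h0 H0] := tst_bounded (tst_partial ord0 hf).
have [C1 h1 H1] := tst_bounded (tst_partial (inord 1) hf).
have [C2 h2 H2] := tst_bounded (tst_partial (inord 2) hf).
exists (C0 + C1 + C2); first by rewrite !addr_ge0.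
move=> v x; rewrite decomp3.
set z := v.2 *: _ + x; set y := _ *: _ + z; set w := _ *: _ + y.
have -> : f w - f x = (f w - f y) + (f y - f z) + (f z - f x) by ring.
have [a _ ->] := slice_mvt y ord0 v.1.1 hf.1.
have [b _ ->] := slice_mvt z (inord 1) v.1.2 hf.1.
have [c _ ->] := slice_mvt x (inord 2) v.2 hf.1.
have aux (p q C : R) : `|q| <= C -> `|p * q| <= C * `|p|.
  by move=> hq; rewrite normrM mulrC ler_wpM2r.
apply: le_trans (ler_normD _ _) _; apply: le_trans (lerD (ler_normD _ _) (lexx _)) _.
have A := aux v.1.1 _ _ (H0 (a *: basis3 R ord0 + y)).
have B := aux v.1.2 _ _ (H1 (b *: basis3 R (inord 1) + z)).
have D := aux v.2 _ _ (H2 (c *: basis3 R (inord 2) + x)).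
have n1 := normr_ge0 v.1.1; have n2 := normr_ge0 v.1.2; have n3 := normr_ge0 v.2.
apply: le_trans (lerD (lerD A B) D) _.
by have := mulr_ge0 h0 n2; have := mulr_ge0 h0 n3; have := mulr_ge0 h1 n1;
  have := mulr_ge0 h1 n3; have := mulr_ge0 h2 n1; have := mulr_ge0 h2 n2; lra.
Qed.

Lemma is_derive_of_taylor f x (v : R3) (d C : R) :
  (forall h : R, `|f (h *: v + x) - f x - h * d| <= C * h ^+ 2) -> is_derive x v f d.
Proof.
move=> hC.
have C0 : 0 <= C by have := hC 1; rewrite expr1n mulr1; apply: le_trans.
have cv : (fun h : R => h^-1 *: ((f \o shift x) (h *: v) - f x)) @ 0^' --> d.
  apply/cvgrPdist_le => e e0.
  have e'0 : 0 < e / (C + 1) by rewrite divr_gt0// ltr_wpDl.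
  near=> h.
  have h0 : h != 0 by near: h; exact: nbhs_dnbhs_neq.
  rewrite distrC /= -[d in X in X <= _](mulKf h0) -[_ *: _]/(h^-1 * _) -mulrBr normrM.
  rewrite normfV ler_pdivrMl ?normr_gt0//.
  apply: le_trans (hC h) _.
  rewrite -(real_normK (num_real h)) expr2 mulrCA ler_wpM2l//.
  have : `|h| <= e / (C + 1).
    by near: h; apply: dnbhs0_le.
  rewrite ler_pdivlMr ?ltr_wpDl// => h1; have := normr_ge0 h; nra.
by split; [apply/cvg_ex; exists d|exact/cvg_lim].
Unshelve. all: by end_near. Qed.

Lemma continuous_of_lipschitz f C : (forall v x,
  `|f (v + x) - f x| <= C * (`|v.1.1| + `|v.1.2| + `|v.2|)) -> continuous f.
Proof.
move=> hC x; apply/cvgrPdist_le => e e0.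
have C0 : 0 <= C.
  have := hC (1, 0, 0) x; rewrite /= normr1 normr0 !addr0 mulr1.
  exact: le_trans.
have d0 : 0 < e / (3 * C + 1) by rewrite divr_gt0// ltr_wpDl// mulr_ge0.
suff : nbhs x [set y | `|f x - f y| <= e] by [].
apply/nbhs_ballP; exists (e / (3 * C + 1)) => // y /ball3E[h1 h2 h3] /=.
rewrite distrC.
rewrite -(subrK x y); apply: le_trans (hC _ _) _.
move: h1 h2 h3; rewrite (distrC x.1.1) (distrC x.1.2) (distrC x.2) => h1 h2 h3.
set s := _ + _ + _.
have : s <= 3 * (e / (3 * C + 1)).
  by move: h1 h2 h3; rewrite /s /=; lra.
move=> hs; apply: le_trans (ler_wpM2l C0 hs) _.
have -> : C * (3 * (e / (3 * C + 1))) = e * (3 * C) / (3 * C + 1) by ring.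
rewrite ler_pdivrMr; last by rewrite ltr_wpDl// mulr_ge0.
by rewrite ler_pM2l//; lra.
Qed.

End SmoothCalculus.

(** * Averages along segments and over boxes *)

Section LineAverage.
Variable R : realType.
Notation R3 := (R * R * R)%type.
Notation leb := (@lebesgue_measure R).
Implicit Types (f g : R3 -> R) (x y : R3) (i j : 'I_3) (a b c p q t C : R).

Lemma continuous_line f (v x : R3) : continuous f -> continuous (fun t : R => f (t *: v + x)).
Proof.
move=> cf t; apply: (@continuous_comp _ _ _ (fun t : R => t *: v + x) f); last exact: cf.
apply: cvgD; last exact: cvg_cst.
by apply: cvgZr_tmp; exact: cvg_id.
Qed.

Lemma continuous_itv_integrable (F : R -> R) a b : continuous F ->
  leb.-integrable `[a, b] (EFin \o F).
Proof.
move=> cF; apply: continuous_compact_integrable; first exact: segment_compact.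
exact: continuous_subspaceT.
Qed.

Lemma continuous_affine p q : continuous (fun t : R => p * t + q).
Proof.
move=> t; apply: cvgD; last exact: cvg_cst.
by apply: cvgM; [exact: cvg_cst|exact: cvg_id].
Qed.

(** The affine weight serves two purposes: a constant [r^-1] gives the mean over a segment of length
    [r], and [r^-1 * t - 1] gives a function whose derivative is [f] minus that mean. *)
Definition lineavg i a b p q f x : R :=
  \int[leb]_(t in `[a, b]) ((p * t + q) * f (t *: basis3 R i + x)).

Lemma lineavg_integrand i p q f x : continuous f ->
  continuous (fun t : R => (p * t + q) * f (t *: basis3 R i + x)).
Proof.
move=> cf t; apply: cvgM; [exact: continuous_affine|exact: continuous_line].
Qed.

Lemma lineavgD i a b p q f g : continuous f -> continuous g ->
  lineavg i a b p q (fun x => f x + g x) =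
  (fun x => lineavg i a b p q f x + lineavg i a b p q g x).
Proof.
move=> cf cg; apply/funext => x; rewrite /lineavg -RintegralD//.
- by apply: eq_Rintegral => t _; rewrite mulrDr.
- by apply: continuous_itv_integrable; exact: lineavg_integrand.
- by apply: continuous_itv_integrable; exact: lineavg_integrand.
Qed.

Lemma lineavgZ i a b p q c f : continuous f ->
  lineavg i a b p q (fun x => c * f x) = (fun x => c * lineavg i a b p q f x).
Proof.
move=> cf; apply/funext => x; rewrite /lineavg -RintegralZl//.
- by apply: eq_Rintegral => t _; rewrite mulrCA.
- by apply: continuous_itv_integrable; exact: lineavg_integrand.
Qed.

Lemma lineavgB i a b p q f g : continuous f -> continuous g ->
  lineavg i a b p q (fun x => f x - g x) =
  (fun x => lineavg i a b p q f x - lineavg i a b p q g x).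
Proof.
move=> cf cg; have cNg : continuous (fun x => -1 * g x).
  by move=> x; apply: cvgM; [exact: cvg_cst|exact: cg].
have := lineavgD i a b p q cf cNg; rewrite lineavgZ// => h.
apply/funext => x; move/(congr1 (@^~ x)): h => /=; rewrite mulN1r => <-.
by congr (lineavg _ _ _ _ _ _ x); apply/funext => y; rewrite mulN1r.
Qed.

Lemma lineavg_shift i a b p q f (v x : R3) :
  lineavg i a b p q f (v + x) = lineavg i a b p q (fun z : R3 => f (v + z)) x.
Proof. by apply: eq_Rintegral => t _; rewrite addrCA. Qed.

Lemma lebesgue_measure_cc (a b : R) : a <= b -> leb `[a, b] = (b - a)%:E.
Proof.
rewrite lebesgue_measure_itv /= lte_fin le_eqVlt => /orP[/eqP ->|->//].
by rewrite ltxx subrr.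
Qed.

Lemma Rintegral_itv_bound (F : R -> R) (a b C : R) : a <= b -> continuous F ->
  (forall t, a <= t <= b -> `|F t| <= C) ->
  `|\int[leb]_(t in `[a, b]) F t| <= C * (b - a).
Proof.
move=> ab cF hC; have mI : measurable (`[a, b] : set (measurableTypeR R)) by exact: measurable_itv.
have iF := continuous_itv_integrable a b cF.
have /le_trans := le_normr_Rintegral mI iF; apply.
have -> : C * (b - a) = \int[leb]_(t in `[a, b]) C.
  rewrite (Rintegral_cst _ mI); congr (_ * _).
  exact: (esym (congr1 fine (lebesgue_measure_cc ab))).
apply: le_Rintegral => //.
- exact: integrable_norm iF.
- by apply: continuous_itv_integrable => t; exact: cvg_cst.
Qed.

Lemma lineavg_bound i a b p q f C x : a <= b -> continuous f ->
  (forall y, `|f y| <= C) ->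
  `|lineavg i a b p q f x| <= (`|p| * (`|a| + `|b|) + `|q|) * (b - a) * C.
Proof.
move=> ab cf hC; rewrite mulrAC; apply: Rintegral_itv_bound => //.
  exact: lineavg_integrand.
move=> t /andP[at_ tb]; rewrite normrM; apply: ler_pM => //.
apply: le_trans (ler_normD _ _) _; rewrite lerD2r normrM ler_wpM2l//.
have := ler_norm b; have := ler_norm (- a); rewrite normrN.
have := normr_ge0 a; have := normr_ge0 b.
by rewrite ler_norml => *; apply/andP; split; lra.
Qed.

Lemma lineavg_lipschitz G i a b p q f : a <= b -> tst G f ->
  exists C, forall v x,
  `|lineavg i a b p q f (v + x) - lineavg i a b p q f x| <= C * (`|v.1.1| + `|v.1.2| + `|v.2|).
Proof.
move=> ab hf; have [C C0 hC] := tst_lipschitz hf.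
have cf := smooth_continuous hf.1.
exists ((`|p| * (`|a| + `|b|) + `|q|) * (b - a) * C) => v x.
have cs : continuous (fun z : R3 => f (v + z)) by exact: continuous_shift3.
have := lineavgB i a b p q cs cf => /(congr1 (@^~ x)) /=.
rewrite lineavg_shift => <-; rewrite -(mulrA _ C).
apply: lineavg_bound => //.
by move=> z; apply: cvgB; [exact: cs|exact: cf].
Qed.

Lemma is_derive_lineavg G i j a b p q f x : a <= b -> tst G f ->
  is_derive x (basis3 R j) (lineavg i a b p q f) (lineavg i a b p q (partial j f) x).
Proof.
move=> ab hf; have [C C0 hC] := tst_taylor j hf.
have cf := smooth_continuous hf.1.
have cd := smooth_continuous (smooth_partial j hf.1).
apply: (@is_derive_of_taylor _ _ _ _ _ ((`|p| * (`|a| + `|b|) + `|q|) * (b - a) * C)) => h.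
have cs : continuous (fun z : R3 => f (h *: basis3 R j + z)) by exact: continuous_shift3.
have cB : continuous (fun z : R3 => f (h *: basis3 R j + z) - f z).
  by move=> z; apply: cvgB; [exact: cs|exact: cf].
have cZ : continuous (fun z : R3 => h * partial j f z).
  by move=> z; apply: cvgM; [exact: cvg_cst|exact: cd].
have := lineavgB i a b p q cB cZ => /(congr1 (@^~ x)) /=.
rewrite (lineavgB _ _ _ _ _ cs cf) (lineavgZ _ _ _ _ _ _ cd) -lineavg_shift => <-; rewrite -(mulrA _ C).
apply: lineavg_bound => //.
by move=> z; apply: cvgB; [exact: cB|exact: cZ].
Qed.

Lemma partial_lineavg G i j a b p q f : a <= b -> tst G f ->
  partial j (lineavg i a b p q f) = lineavg i a b p q (partial j f).
Proof.
move=> ab hf; apply/funext => x.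
by have [_] := is_derive_lineavg i j p q x ab hf.
Qed.

Lemma smooth_lineavg G i a b p q f : a <= b -> tst G f -> smooth (lineavg i a b p q f).
Proof.
move=> ab hf k; elim: k f hf => [|k IH] f hf; have [C hC] := lineavg_lipschitz i p q ab hf.
  by split => //; exact: continuous_of_lipschitz hC.
split; first exact: continuous_of_lipschitz hC.
move=> j; split; first by move=> x; have [] := is_derive_lineavg i j p q x ab hf.
by rewrite (partial_lineavg _ _ _ _ ab hf); apply: IH; exact: tst_partial.
Qed.

(** The value at [x] reads [f] at [x + t e_i], so the support moves by [- t e_i]. *)
Lemma tst_lineavg (G : set R3) i a b p q f K : a <= b -> smooth f -> csupp K f ->
  (forall x t, K x -> a <= t <= b -> G (x - t *: basis3 R i)) ->
  tst G (lineavg i a b p q f).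
Proof.
move=> ab sf hK KG.
have hf : tst setT f by split => //; exists K.
split; first exact: smooth_lineavg ab hf.
pose h (z : R3 * R) : R3 := z.1 - z.2 *: basis3 R i.
exists (h @` (K `*` `[a, b])); last first.
  by move=> _ [[x t] /= [Kx tab] <-]; apply: KG => //; rewrite in_itv in tab.
split.
  apply: continuous_compact; last by apply: compact_setX; [exact: hK.1|exact: segment_compact].
  apply: continuous_subspaceT => z; apply: cvgB; first exact: cvg_fst.
  by apply: cvgZr_tmp; exact: cvg_snd.
move=> x nx; rewrite /lineavg.
under eq_Rintegral => t tab.
  rewrite hK.2; first rewrite mulr0; first over.
  move=> Kt; apply: nx; exists (t *: basis3 R i + x, t).
    by split => //; move: tab; rewrite inE.
  by rewrite /h /= addrAC subrr add0r.
by rewrite Rintegral_cst// mul0r.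
Qed.

(** Integration by parts along the segment, the weight having constant derivative [p]. *)
Lemma lineavg_ftc i a b p q f x : a < b -> smooth f ->
  lineavg i a b p q (partial i f) x = (p * b + q) * f (b *: basis3 R i + x)
    - (p * a + q) * f (a *: basis3 R i + x) - p * lineavg i a b 0 1 f x.
Proof.
move=> ab sf; have cf := smooth_continuous sf.
have cd := smooth_continuous (smooth_partial i sf).
pose w (t : R) := p * t + q; pose F (t : R) := f (t *: basis3 R i + x).
have dw t : is_derive t 1 w p.
  have := is_deriveD (is_deriveZ p (is_derive_id t 1)) (is_derive_cst q t 1).
  by rewrite addr0 [p%:A]mulr1.
have dF t : is_derive t 1 F (partial i f (t *: basis3 R i + x)).
  by apply: is_derive_slice; exact: smooth_derivable.
pose g (t : R) := w t * partial i f (t *: basis3 R i + x) + F t * p.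
have dwF t : is_derive t 1 (w * F) (g t) by exact: is_deriveM.
have cg : continuous g.
  move=> t; apply: cvgD; first exact: lineavg_integrand.
  by apply: cvgM; [exact: continuous_line|exact: cvg_cst].
have cwF : continuous (w * F) by exact: lineavg_integrand.
have ftc : (\int[leb]_(t in `[a, b]) (g t)%:E = ((w * F) b)%:E - ((w * F) a)%:E)%E.
  apply: continuous_FTC2 => //; first exact: continuous_subspaceT.
    split.
    - by move=> t _; have [] := dwF t.
    - by apply: cvg_at_right_filter; exact: cwF.
    - by apply: cvg_at_left_filter; exact: cwF.
  by move=> t _; rewrite derive1E; have [_] := dwF t.
have E : \int[leb]_(t in `[a, b]) g t = w b * F b - w a * F a.
  by rewrite /Rintegral ftc.
have iw := continuous_itv_integrable a b (@lineavg_integrand i p q _ x cd).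
have iF : leb.-integrable `[a, b] (EFin \o (fun t => F t * p)).
  by apply: continuous_itv_integrable => t; apply: cvgM; [exact: continuous_line|exact: cvg_cst].
move: E; rewrite RintegralD//.
have -> : \int[leb]_(t in `[a, b]) (F t * p) = p * lineavg i a b 0 1 f x.
  rewrite /lineavg -RintegralZl//; last first.
    by apply: continuous_itv_integrable; exact: lineavg_integrand.
  by apply: eq_Rintegral => t _; rewrite mul0r add0r mul1r mulrC.
by rewrite /lineavg => <-; rewrite addrK.
Qed.

End LineAverage.

(** * Symmetry of second derivatives *)

Section Clairaut.
Variable R : realType.
Notation R3 := (R * R * R)%type.

Lemma norm_basis3 (i : 'I_3) : `|basis3 R i| <= 1.
Proof.
by rewrite [`|_|]/(Num.max (Num.max `|_| `|_|) `|_|) /= !ge_max !normr_nat !lern1;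
  do 3 case: (_ == _).
Qed.

(** The second difference is symmetric in [i] and [j], while two applications of the mean value
    theorem express it through either mixed derivative at a nearby point. *)
Lemma mixed_difference (f : R3 -> R) i j (h : R) x : smooth f ->
  exists c d : R, [/\ `|c| <= `|h|, `|d| <= `|h| &
  f (h *: basis3 R i + (h *: basis3 R j + x)) - f (h *: basis3 R i + x)
    - (f (h *: basis3 R j + x) - f x) =
  h * (h * partial j (partial i f) (d *: basis3 R j + (c *: basis3 R i + x)))].
Proof.
move=> sf; pose v : R3 := h *: basis3 R j.
pose g (z : R3) := f (v + z) + -1 * f z.
have sv : smooth (fun z : R3 => f (v + z)) by exact: smooth_shift3.
have sg : smooth g by apply: smoothD => //; exact: smoothZ.
have [c hc] := slice_mvt x i h sg.
have -> : partial i g = (fun x => partial i f (v + x) + -1 * partial i f x).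
  rewrite partialD; last by move=> z; apply: smooth_derivable; exact: smoothZ.
    by rewrite partial_shift3 partialZ// => z; exact: smooth_derivable.
  by move=> z; exact: smooth_derivable.
rewrite !mulN1r => E.
have [d hd E2] := slice_mvt (c *: basis3 R i + x) j h (smooth_partial i sf).
exists c, d; split => //; rewrite -E2 -E /g !mulN1r addrCA; ring.
Qed.

Lemma partialC (f : R3 -> R) i j : smooth f ->
  partial j (partial i f) = partial i (partial j f).
Proof.
move=> sf; apply/funext => x.
have tri (s1 s2 s3 e : R) : `|s1 - s2| <= e -> `|s1 - s3| <= e -> `|s2 - s3| <= 2 * e.
  by rewrite !ler_norml => /andP[? ?] /andP[? ?]; apply/andP; split; lra.
have key k l e : 0 < e -> \forall h \near (0 : R), forall c d : R, `|c| <= `|h| -> `|d| <= `|h| ->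
    `|partial l (partial k f) (d *: basis3 R l + (c *: basis3 R k + x)) -
      partial l (partial k f) x| <= e.
  move=> e0.
  have /(_ x)/cvgrPdist_le/(_ _ e0) :=
    smooth_continuous (smooth_partial l (smooth_partial k sf)).
  move=> /nbhs_ballP[r /= r0 hr].
  have r20 : 0 < r / 2 by lra.
  apply/nbhs_ballP; exists (r / 2) => // h; rewrite /ball /= sub0r normrN => hh c d hc hd.
  rewrite distrC; apply: hr.
  rewrite -ball_normE /ball_ /= opprD opprD addrCA addrA.
  have -> : - (d *: basis3 R l) + x + (- (c *: basis3 R k) - x) =
    - (d *: basis3 R l + c *: basis3 R k).
    by rewrite opprD -addrA (addrCA x) subrr addr0.
  rewrite normrN; apply: le_lt_trans (ler_normD _ _) _; rewrite !normrZ.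
  have := norm_basis3 l; have := norm_basis3 k.
  have := normr_ge0 c; have := normr_ge0 d; nra.
apply/eqP; rewrite -subr_eq0 -normr_le0; apply: (@le_small R 2) => e e0.
have [h [h0 H1 H2]] : exists h : R, [/\ h != 0,
    forall c d : R, `|c| <= `|h| -> `|d| <= `|h| ->
    `|partial j (partial i f) (d *: basis3 R j + (c *: basis3 R i + x)) -
      partial j (partial i f) x| <= e &
    forall c d : R, `|c| <= `|h| -> `|d| <= `|h| ->
    `|partial i (partial j f) (d *: basis3 R i + (c *: basis3 R j + x)) -
      partial i (partial j f) x| <= e].
  have /nbhs_ballP[r1 /= r10 h1] := key i j _ e0.
  have /nbhs_ballP[r2 /= r20 h2] := key j i _ e0.
  pose h := Num.min r1 r2 / 2.
  have m0 : 0 < Num.min r1 r2 by rewrite lt_min r10.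
  have h0 : 0 < h by rewrite /h; lra.
  have hm : h < Num.min r1 r2 by rewrite /h; lra.
  move: (hm); rewrite lt_min => /andP[hr1 hr2].
  exists h; split; first by rewrite gt_eqF.
    by apply: h1; rewrite /ball /= sub0r normrN gtr0_norm.
  by apply: h2; rewrite /ball /= sub0r normrN gtr0_norm.
have [c [d [hc hd E]]] := mixed_difference i j h x sf.
have [c' [d' [hc' hd' E']]] := mixed_difference j i h x sf.
have EE : partial j (partial i f) (d *: basis3 R j + (c *: basis3 R i + x)) =
  partial i (partial j f) (d' *: basis3 R i + (c' *: basis3 R j + x)).
  have /(mulfI h0)/(mulfI h0) // : h * (h * partial j (partial i f) (d *: basis3 R j + (c *: basis3 R i + x))) =
    h * (h * partial i (partial j f) (d' *: basis3 R i + (c' *: basis3 R j + x))).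
  apply: (etrans (esym E)); apply: (etrans _ E'); rewrite (addrCA (h *: basis3 R i)).
  by move: (f _) (f (h *: basis3 R i + x)) (f (h *: basis3 R j + x)) (f x) => s1 s2 s3 s4; ring.
have := H1 c d hc hd; have := H2 c' d' hc' hd'; rewrite -EE => h2 h1.
exact: (tri _ _ _ _ h1 h2).
Qed.

End Clairaut.

(** * Integrals of test functions and integration by parts *)

Section TestIntegrals.
Variable R : realType.
Notation R3 := (R * R * R)%type.
Notation mR := (measurableTypeR R).
Notation mR3 := (mR * mR * mR)%type.
Notation mu3 := (@leb3 R).
Notation leb := (@lebesgue_measure R).
Implicit Types (f g : R3 -> R) (G : set R3).

(** A squared norm, taken over the whole space since averages of a test function may spread beyond
    [G]. *)
Definition nrm f : R := ipi mu3 (setT : set mR3) f f.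

Lemma csupp_cube K f : csupp K f -> exists2 r, 0 < r & forall x, ~ cube r x -> f x = 0.
Proof.
move=> [cK h0]; have [r r0 hr] := compact_cube cK; exists r => // x nx.
by apply: h0 => /hr.
Qed.

Lemma bounded_cube_integrable r C f : continuous f -> (forall x, ~ cube r x -> f x = 0) ->
  (forall x, `|f x| <= C) ->
  mu3.-integrable (setT : set mR3) (EFin \o f) /\
  `|\int[mu3]_(x in (setT : set mR3)) f x| <= C * fine (mu3 (cube r)).
Proof.
move=> cf h0 hC.
have C0 : 0 <= C by apply: le_trans (hC 0).
have mc : measurable (cube r : set mR3) by exact: measurable_cube.
have mf := continuous_measurable3 cf.
have le x : (`|(f x)%:E| <= C%:E * (\1_(cube r) x)%:E)%E.
  rewrite -EFinM lee_fin indicE; case: (boolP (x \in _)) => [_|/negP nx].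
    by rewrite mulr1.
  by rewrite h0 ?normr0 ?mulr0// => /mem_set.
have int : (\int[mu3]_(x in (setT : set mR3)) `|(f x)%:E| <= C%:E * mu3 (cube r))%E.
  apply: (@le_trans _ _ (\int[mu3]_(x in (setT : set mR3)) (C%:E * (\1_(cube r) x)%:E))%E).
    apply: ge0_le_integral => //.
      by apply: measurableT_comp => //; exact/measurable_EFinP.
    by apply/measurable_EFinP; apply: measurable_funM; [exact: measurable_cst|exact: measurable_indic].
  rewrite ge0_integralZl//; last by apply/measurable_EFinP; exact: measurable_indic.
  by rewrite integral_indic// setIT.
have fm : mu3 (cube r) \is a fin_num.
  by rewrite ge0_fin_numE ?leb3_cube.
have iF : mu3.-integrable (setT : set mR3) (EFin \o f).
  apply/integrableP; split; first exact/measurable_EFinP.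
  apply: le_lt_trans int _; rewrite -(fineK fm) -EFinM; exact: ltry.
split => //; rewrite -lee_fin.
apply: (@le_trans _ _ (\int[mu3]_(x in (setT : set mR3)) `|(f x)%:E|)%E); last first.
  by rewrite EFinM fineK.
have := le_normr_Rintegral (@measurableT _ mR3) iF.
rewrite -lee_fin => /le_trans; apply.
rewrite /Rintegral fineK//; apply: integrable_fin_num => //.
exact: integrable_norm iF.
Qed.

Lemma csupp_integrable G K f : measurable (G : set mR3) -> continuous f -> csupp K f ->
  mu3.-integrable (G : set mR3) (EFin \o f).
Proof.
move=> mG cf hK; have [C C0 hC] := csupp_bounded hK cf.
have [r r0 hr] := csupp_cube hK.
by apply: integrableS (bounded_cube_integrable cf hr hC).1.
Qed.

Lemma csuppMl K f g : csupp K f -> csupp K (fun x => g x * f x).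
Proof. by move=> [cK h0]; split => // x /h0 ->; rewrite mulr0. Qed.

Lemma csuppMr K f g : csupp K f -> csupp K (fun x => f x * g x).
Proof. by move=> [cK h0]; split => // x /h0 ->; rewrite mul0r. Qed.

Lemma continuousM3 f g : continuous f -> continuous g -> continuous (fun x => f x * g x).
Proof. by move=> cf cg x; apply: cvgM; [exact: cf|exact: cg]. Qed.

Lemma csupp_sqint G K f : measurable (G : set mR3) -> continuous f -> csupp K f ->
  sqint mu3 (G : set mR3) f.
Proof.
move=> mG cf hK; split.
  by apply: measurable_funTS; exact: continuous_measurable3.
have := csupp_integrable mG (continuousM3 cf cf) (csuppMl f hK).
by apply: eq_integrable => // x _; rewrite /= expr2.
Qed.

Lemma tst_sqint G G' f : measurable (G : set mR3) -> tst G' f ->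
  sqint mu3 (G : set mR3) f.
Proof.
by move=> mG [sf [K hK _]]; apply: csupp_sqint hK => //; exact: smooth_continuous.
Qed.

Lemma Rintegral_csupp G K f : csupp K f -> K `<=` G ->
  \int[mu3]_(x in (G : set mR3)) f x = \int[mu3]_(x in (setT : set mR3)) f x.
Proof.
move=> [_ h0] KG; rewrite Rintegral_mkcond; apply: eq_Rintegral => x _.
by rewrite patchE; case: ifPn => // /negP nx; rewrite h0// => /KG /mem_set.
Qed.

Lemma nrm_ge0 f : 0 <= nrm f.
Proof. exact: ipi_ge0. Qed.

Lemma ipi_le_nrm G K f : measurable (G : set mR3) -> continuous f -> csupp K f ->
  ipi mu3 (G : set mR3) f f <= nrm f.
Proof.
move=> mG cf hK.
have i1 := csupp_sqint mG cf hK; have i2 := csupp_sqint (@measurableT _ mR3) cf hK.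
rewrite -lee_fin -(integral_sqr mG i1) -(integral_sqr (@measurableT _ mR3) i2).
apply: ge0_subset_integral => //; first exact: (measurable_int _ i2.2).
by move=> x _; rewrite lee_fin sqr_ge0.
Qed.

Lemma csupp_shift (v : R3) K f : csupp K f ->
  csupp ((fun x : R3 => x - v) @` K) (fun x : R3 => f (v + x)).
Proof.
move=> [cK h0]; split.
  apply: continuous_compact => //; apply: continuous_subspaceT => x.
  by apply: cvgB; [exact: cvg_id|exact: cvg_cst].
move=> x nx; apply: h0 => Kx; apply: nx; exists (v + x) => //.
by rewrite addrAC subrr add0r.
Qed.

Lemma Rintegral_shift (v : R3) K f : continuous f -> csupp K f ->
  \int[mu3]_(x in (setT : set mR3)) f (v + x) = \int[mu3]_(x in (setT : set mR3)) f x.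
Proof.
move=> cf hK; rewrite /Rintegral; congr fine.
apply: (@integral_shift3 R v (EFin \o f)).
  by apply/measurable_EFinP; exact: continuous_measurable3.
apply: csupp_integrable (csupp_shift v hK) => //.
exact: continuous_shift3.
Qed.

Lemma nrm_shift (v : R3) K f : continuous f -> csupp K f ->
  nrm (fun x : R3 => f (v + x)) = nrm f.
Proof.
move=> cf hK; exact: (Rintegral_shift v (continuousM3 cf cf) (csuppMl f hK)).
Qed.

(** By translation invariance the increment of [f] over [h e_i] has integral zero; it equals [h]
    times the derivative up to an error of order [h ^+ 2] on a bounded set. *)
Lemma integral_partial0 G f i : tst G f ->
  \int[mu3]_(x in (setT : set mR3)) partial i f x = 0.
Proof.
move=> hf; have [sf [K hK _]] := hf.
have cf := smooth_continuous sf; have cd := smooth_continuous (smooth_partial i sf).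
have [C C0 hC] := tst_taylor i hf; have [r r0 hr] := csupp_cube hK.
have hr' x : ~ cube r x -> partial i f x = 0.
  move=> nx; have [r1 r10 hr1] := csupp_cube (csupp_partial i hK).
  have cK : csupp (cube r) f; last by have [_] := csupp_partial i cK; exact.
  split => //; rewrite cubeE; apply: compact_setX; last exact: segment_compact.
  by apply: compact_setX; exact: segment_compact.
set I := \int[mu3]_(x in _) _.
apply/eqP; rewrite -normr_le0; apply: (@le_small R (C * fine (mu3 (cube (r + 1))))) => e e0.
(* With [h <= 1] both [f] and its translate vanish outside the fixed cube of half-side [r + 1]. *)
pose h := Num.min e 1; have h0 : 0 < h by rewrite lt_min e0 ltr01.
have h1 : h <= 1 by rewrite ge_min lexx orbT.
have he : h <= e by rewrite ge_min lexx.
pose v : R3 := h *: basis3 R i.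
pose g x := f (v + x) - f x - h * partial i f x.
have csf : continuous (fun x : R3 => f (v + x)) by exact: continuous_shift3.
have cg : continuous g.
  move=> x; apply: cvgB; [apply: cvgB; [exact: csf|exact: cf]|].
  by apply: cvgM; [exact: cvg_cst|exact: cd].
have g0 x : ~ cube (r + 1) x -> g x = 0.
  move=> nx; have n1 : ~ cube r x by move=> -[? ? ?]; apply: nx; split; lra.
  rewrite /g (hr x)// (hr' x)// hr; first by ring.
  move=> -[]; rewrite /v /= => q1 q2 q3; apply: nx.
  have b (k : nat) (y : R) : `|h * (nat_of_ord i == k)%:R + y| <= r -> `|y| <= r + 1.
    have : 0 <= h * (nat_of_ord i == k)%:R <= 1.
      by case: (_ == _); rewrite ?mulr1 ?mulr0 ?h1 ?(ltW h0) ?ler01 ?lexx.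
    by rewrite !ler_norml => /andP[? ?] /andP[? ?]; apply/andP; split; lra.
  by split; [exact: b q1|exact: b q2|exact: b q3].
have gC x : `|g x| <= C * h ^+ 2 by exact: hC.
have [ig hg] := bounded_cube_integrable cg g0 gC.
have iT := @measurableT _ mR3.
have i1 := csupp_integrable iT csf (csupp_shift v hK).
have i2 := csupp_integrable iT cf hK.
have i3 := csupp_integrable iT cd (csupp_partial i hK).
have E : \int[mu3]_(x in (setT : set mR3)) g x = - (h * I).
  rewrite /g RintegralB//; [|exact: (integrableB iT i1 i2)|exact: (integrableZl iT h i3)].
  by rewrite RintegralB// (Rintegral_shift v cf hK) subrr sub0r RintegralZl.
move: hg; rewrite E normrN normrM gtr0_norm// expr2 => hg.
have : h * `|I| <= h * (C * fine (mu3 (cube (r + 1))) * h).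
  by apply: le_trans hg _; rewrite le_eqVlt; apply/orP; left; apply/eqP; ring.
rewrite ler_pM2l// => /le_trans; apply.
by apply: ler_wpM2l => //; rewrite mulr_ge0// fine_ge0.
Qed.

Lemma integral_by_parts G f g i : measurable (G : set mR3) -> smooth f -> tst G g ->
  ipi mu3 (G : set mR3) (partial i f) g = - ipi mu3 (G : set mR3) f (partial i g).
Proof.
move=> mG sf hg; have [sg [K hK KG]] := hg.
have := integral_partial0 i (tstM sf hg).
rewrite partialM; try by move=> x; exact: smooth_derivable.
have dK := csupp_partial i hK.
have c1 := continuousM3 (smooth_continuous sf) (smooth_continuous (smooth_partial i sg)).
have c2 := continuousM3 (smooth_continuous sg) (smooth_continuous (smooth_partial i sf)).
have s1 := csuppMl f dK; have s2 := csuppMr (partial i f) hK.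
rewrite RintegralD//; last 2 first.
  exact: csupp_integrable s1.
  exact: csupp_integrable s2.
rewrite -(Rintegral_csupp s1 KG) -(Rintegral_csupp s2 KG) => /eqP.
rewrite addr_eq0 => /eqP h; rewrite /ipi h opprK.
by apply: eq_Rintegral => x _; rewrite mulrC.
Qed.

End TestIntegrals.

(** * Norm estimates for averages along segments *)

Section Tonelli.
Variable R : realType.
Notation R3 := (R * R * R)%type.
Notation mR := (measurableTypeR R).
Notation mR3 := (mR * mR * mR)%type.
Notation mu3 := (@leb3 R).
Notation leb := (@lebesgue_measure R).
Implicit Types (f g : R3 -> R) (G : set R3) (a b p q W : R).

Lemma ipi_cauchy_schwarz d (T : measurableType d) (mu : {measure set T -> \bar R})
  (D : set T) (f g : T -> R) : measurable D -> sqint mu D f -> sqint mu D g ->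
  ipi mu D f g ^+ 2 <= ipi mu D f f * ipi mu D g g.
Proof.
by move=> mD hf hg; exact: (cauchy_schwarz (L2_hilbert mu mD) (toL2 mD hf) (toL2 mD hg)).
Qed.

Lemma continuous_itv_sqint (F : R -> R) a b : continuous F ->
  sqint leb (`[a, b] : set mR) F.
Proof.
move=> cF; split; first by apply: measurable_funTS; exact: continuous_measurable_fun.
have cFF : continuous (fun x => F x ^+ 2).
  by move=> x; apply: (@cvgM _ _ _ _ F F); exact: cF.
exact: continuous_itv_integrable.
Qed.

Lemma lineavg_sq_le i a b p q W f x : a <= b -> continuous f ->
  (forall t, a <= t <= b -> `|p * t + q| <= W) ->
  ((lineavg i a b p q f x ^+ 2)%:E <=
   (W ^+ 2 * (b - a))%:E * \int[leb]_(t in `[a, b]) (f (t *: basis3 R i + x) ^+ 2)%:E)%E.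
Proof.
move=> ab cf hw; have mI : measurable (`[a, b] : set mR) by exact: measurable_itv.
have sF := continuous_itv_sqint a b (@continuous_line R f (basis3 R i) x cf).
have sW := continuous_itv_sqint a b (@continuous_affine R p q).
rewrite (integral_sqr mI sF) -EFinM lee_fin.
apply: le_trans (ipi_cauchy_schwarz mI sW sF) _.
apply: ler_wpM2r; first exact: ipi_ge0.
have -> : W ^+ 2 * (b - a) = \int[leb]_(t in (`[a, b] : set mR)) (W ^+ 2).
  rewrite (Rintegral_cst _ mI); congr (_ * _).
  exact: (esym (congr1 fine (lebesgue_measure_cc ab))).
apply: le_Rintegral => //.
- exact: sqint_mul.
- by apply: continuous_itv_integrable => t; exact: cvg_cst.
move=> t; rewrite /= in_itv /= => /hw h; rewrite -expr2.
by rewrite -(real_normK (num_real _)); apply: lerXn2r => //; rewrite nnegrE// (le_trans _ h).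
Qed.

Lemma measurable_line (i : 'I_3) (h : mR3 -> \bar R) : measurable_fun setT h ->
  measurable_fun setT (fun z : mR3 * mR => h ((z.2 : R) *: basis3 R i + (z.1 : R3))).
Proof.
move=> mh; apply: (@measurableT_comp _ _ _ _ _ _ h) => //.
have m1 (c : R) (k : mR3 * mR -> mR) : measurable_fun setT k ->
    measurable_fun setT (fun z : mR3 * mR => ((z.2 : R) * c + k z : mR)).
  move=> mk; apply: measurable_funD => //; apply: measurable_funM; last exact: measurable_cst.
  exact: measurable_snd.
have f1 : measurable_fun setT (fun z : mR3 * mR => z.1.1 : mR * mR).
  exact: (measurableT_comp measurable_fst measurable_fst).
apply/measurable_fun_pairP; split; [apply/measurable_fun_pairP; split|].
- exact: (m1 (basis3 R i).1.1 _ (measurableT_comp measurable_fst f1)).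
- exact: (m1 (basis3 R i).1.2 _ (measurableT_comp measurable_snd f1)).
- exact: (m1 (basis3 R i).2 _ (measurableT_comp measurable_snd measurable_fst)).
Qed.

Definition leb3s : set mR3 -> \bar R := @leb3 R.

HB.instance Definition _ := Measure.on leb3s.

Lemma leb3s_sigma_finite : sigma_finite setT leb3s.
Proof.
exists (fun n => cube n%:R); last first.
  by move=> n; split; [exact: measurable_cube|exact: leb3_cube].
apply/esym; rewrite -subTset => x _.
have [n hn] : exists n : nat, `|x.1.1| + `|x.1.2| + `|x.2| <= n%:R.
  by exists (Num.truncn (`|x.1.1| + `|x.1.2| + `|x.2|)).+1; exact/ltW/truncnS_gt.
have n1 := normr_ge0 x.1.1; have n2 := normr_ge0 x.1.2; have n3 := normr_ge0 x.2.
by exists n => //; split; lra.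
Qed.

HB.instance Definition _ := Measure_isSigmaFinite.Build _ _ _ leb3s leb3s_sigma_finite.

(** The indicator of the segment lets both integrals in Tonelli's theorem run over whole spaces. *)
Let lineF (i : 'I_3) a b (h : mR3 -> \bar R) (z : mR3 * mR) : \bar R :=
  (h ((z.2 : R) *: basis3 R i + (z.1 : R3))%R * (\1_(`[a, b] : set mR) z.2)%:E)%E.

Let lineF_ge0 i a b h z : (forall x, 0 <= h x)%E -> (0 <= lineF i a b h z)%E.
Proof. by move=> h0; rewrite mule_ge0// lee_fin. Qed.

Let measurable_lineF i a b h : measurable_fun setT h -> measurable_fun setT (lineF i a b h).
Proof.
move=> mh; apply: emeasurable_funM; first exact: measurable_line.
apply/measurable_EFinP; apply: measurableT_comp; last exact: measurable_snd.
by apply: measurable_indic; exact: measurable_itv.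
Qed.

Let lineFE i a b h (x : mR3) :
  (\int[leb]_(t in `[a, b]) h (t *: basis3 R i + (x : R3))%R =
   \int[leb]_t lineF i a b h (x, t))%E.
Proof.
by rewrite integral_mkcond; apply: eq_integral => t _; rewrite epatch_indic.
Qed.

Lemma measurable_line_integral (i : 'I_3) a b (h : mR3 -> \bar R) :
  measurable_fun setT h -> (forall x, 0 <= h x)%E ->
  measurable_fun setT
    (fun x : mR3 => \int[leb]_(t in `[a, b]) h (t *: basis3 R i + (x : R3))%R)%E.
Proof.
move=> mh h0; under eq_fun do rewrite lineFE.
by apply: measurable_fun_fubini_tonelli_F; [exact: measurable_lineF|move=> z; exact: lineF_ge0].
Qed.

Lemma tonelli_line (i : 'I_3) a b (h : mR3 -> \bar R) : a <= b ->
  measurable_fun setT h -> (forall x, 0 <= h x)%E ->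
  (\int[mu3]_x \int[leb]_(t in `[a, b]) h (t *: basis3 R i + x)%R =
   (b - a)%:E * \int[mu3]_x h x)%E.
Proof.
move=> ab mh h0; have mI : measurable (`[a, b] : set mR) by exact: measurable_itv.
pose F := lineF i a b h.
transitivity (\int[leb3s]_x \int[leb]_t F (x, t))%E.
  by apply: eq_integral => x _; exact: lineFE.
rewrite (fubini_tonelli (m1 := leb3s) (m2 := leb) F); last 2 first.
- exact: measurable_lineF.
- by move=> z; exact: lineF_ge0.
transitivity (\int[leb]_(t in `[a, b]) (\int[mu3]_x h x))%E.
  rewrite [RHS]integral_mkcond; apply: eq_integral => t _.
  rewrite epatch_indic /F /lineF /= muleC.
  transitivity (\int[leb3s]_x ((\1_(`[a, b] : set mR) t)%:E * h ((t *: basis3 R i : R3) + x)%R))%E.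
    by apply: eq_integral => x _; rewrite muleC.
  have mht : measurable_fun setT (fun x : mR3 => h ((t *: basis3 R i : R3) + (x : R3))%R).
    exact: (measurableT_comp mh (@measurable_shift3 R (t *: basis3 R i))).
  have it0 : (0%:E <= (\1_(`[a, b] : set mR) t : R)%:E)%E by rewrite lee_fin indicE ler0n.
  rewrite (ge0_integralZl leb3s (@measurableT _ mR3) mht (fun x _ => h0 _) it0).
  congr (_ * _)%E.
  exact: (@ge0_integral_shift3 R (t *: basis3 R i) h mh h0).
by rewrite integral_cst// muleC; congr (_ * _)%E; exact: lebesgue_measure_cc.
Qed.

(** Cauchy-Schwarz on each segment gives one factor [W ^+ 2 * (b - a)]; Tonelli and translation
    invariance give the other [b - a]. *)
Lemma nrm_lineavg G i a b p q W f : a <= b -> tst G f ->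
  (forall t, a <= t <= b -> `|p * t + q| <= W) ->
  nrm (lineavg i a b p q f) <= (W * (b - a)) ^+ 2 * nrm f.
Proof.
move=> ab hf hw; have [sf [K hK _]] := hf.
have cf := smooth_continuous sf.
have iT := @measurableT _ mR3.
have sJ : tst setT (lineavg i a b p q f) by exact: tst_lineavg ab sf hK _.
have i1 := tst_sqint iT sJ; have i2 := tst_sqint iT hf.
rewrite -lee_fin EFinM /nrm -(integral_sqr iT i1) -(integral_sqr iT i2).
have mf2 : measurable_fun setT (fun x : mR3 => (f x ^+ 2)%:E) by exact: (measurable_int _ i2.2).
have f20 (x : mR3) : (0 <= (f x ^+ 2)%:E)%E by rewrite lee_fin sqr_ge0.
apply: (@le_trans _ _ (\int[mu3]_(x in (setT : set mR3))
   ((W ^+ 2 * (b - a))%:E * \int[leb]_(t in `[a, b]) (f (t *: basis3 R i + x) ^+ 2)%:E))%E).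
  apply: ge0_le_integral => //.
  - by move=> x _; rewrite lee_fin sqr_ge0.
  - exact: (measurable_int _ i1.2).
  - apply: (emeasurable_funM (f := cst (W ^+ 2 * (b - a))%:E)); first exact: measurable_cst.
    exact: (measurable_line_integral i a b mf2 f20).
  - by move=> x _; exact: lineavg_sq_le.
rewrite ge0_integralZl//; last 3 first.
- exact: (measurable_line_integral i a b mf2 f20).
- by move=> x _; apply: integral_ge0 => t _; rewrite lee_fin sqr_ge0.
- by rewrite lee_fin mulr_ge0 ?sqr_ge0 ?subr_ge0.
by rewrite (tonelli_line i ab mf2 f20) muleA -EFinM exprMn (expr2 (b - a)) mulrA.
Qed.

End Tonelli.

(** * Averages over boxes and their potentials *)

Section BoxAverage.
Variable R : realType.
Notation R3 := (R * R * R)%type.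
Notation mR := (measurableTypeR R).
Notation mR3 := (mR * mR * mR)%type.
Notation mu3 := (@leb3 R).
Notation leb := (@lebesgue_measure R).
Implicit Types (f g : R3 -> R) (G : set R3) (i j : 'I_3) (r : R).

Lemma ord3P i : [\/ i = ord0, i = inord 1 | i = inord 2].
Proof.
case: i => [[|[|[|m]]] lt]//; [apply: Or31|apply: Or32|apply: Or33]; apply: val_inj => //=;
  by rewrite inordK.
Qed.

Definition avg1 i r f := lineavg i 0 r 0 r^-1 f.
(** The weight is -1 at [0] and vanishes at [r], so integration by parts keeps only the value of [f]
    at [x] and gives [f - avg1 i r f] as the [i]-th derivative. *)
Definition pot1 i r f := lineavg i 0 r r^-1 (-1) f.
Definition avg3 r f := avg1 (inord 2) r (avg1 (inord 1) r (avg1 ord0 r f)).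
(** Each potential acts on the function already averaged along the preceding axes, so that the
    one-axis decompositions telescope. *)
Definition boxpot r i f :=
  if i == ord0 then pot1 ord0 r f
  else if i == inord 1 then pot1 (inord 1) r (avg1 ord0 r f)
  else pot1 (inord 2) r (avg1 (inord 1) r (avg1 ord0 r f)).

(** The set in which [f] must be supported for its average over [[0, r]] along the axis [i] to be
    supported in [G]. *)
Definition core1 i r G : set R3 := [set x | forall t, 0 <= t <= r -> G (x - t *: basis3 R i)].
Definition core3 r G := core1 ord0 r (core1 (inord 1) r (core1 (inord 2) r G)).

Lemma core1_sub i r G : 0 <= r -> core1 i r G `<=` G.
Proof. by move=> r0 x /(_ 0); rewrite scale0r subr0; apply; rewrite lexx. Qed.

Lemma core3_sub r G : 0 <= r -> core3 r G `<=` G.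
Proof. by move=> r0 x /(core1_sub r0)/(core1_sub r0)/(core1_sub r0). Qed.

Lemma core1T i r : core1 i r setT = setT. Proof. by apply/seteqP; split. Qed.

Lemma core3T r : core3 r setT = setT. Proof. by rewrite /core3 !core1T. Qed.

Section Fixed.
Variable r : R.
Hypothesis r0 : 0 < r.
Let r0' : 0 <= r := ltW r0.

Lemma tst_line i p q G f : tst (core1 i r G) f -> tst G (lineavg i 0 r p q f).
Proof.
move=> [sf [K hK KG]]; apply: (@tst_lineavg R _ _ _ _ _ _ _ K) => //.
by move=> x t /KG; apply.
Qed.

Lemma tst_avg3 G f : tst (core3 r G) f -> tst G (avg3 r f).
Proof. by move=> hf; do 3 apply: tst_line. Qed.

Lemma tst_boxpot i G f : tst (core3 r G) f -> tst G (boxpot r i f).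
Proof.
move=> hf; have h1 := tst_line r^-1 (-1) hf; have h2 := tst_line 0 r^-1 hf.
rewrite /boxpot; case: ifP => _.
  by apply: tst_sub h1 => x /(core1_sub r0')/(core1_sub r0').
case: ifP => _.
  by have := tst_line r^-1 (-1) h2; apply: tst_sub => x /(core1_sub r0').
by do 2 apply: tst_line.
Qed.

Lemma nrm_avg1 G i f : tst G f -> nrm (avg1 i r f) <= nrm f.
Proof.
move=> hf; apply: (le_trans (@nrm_lineavg R G i 0 r 0 r^-1 r^-1 f r0' hf _)).
  by move=> t _; rewrite mul0r add0r ger0_norm ?invr_ge0.
by rewrite subr0 mulVf ?gt_eqF// expr1n mul1r.
Qed.

Lemma nrm_pot1 G i f : tst G f -> nrm (pot1 i r f) <= r ^+ 2 * nrm f.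
Proof.
move=> hf; apply: (le_trans (@nrm_lineavg R G i 0 r r^-1 (-1) 1 f r0' hf _)).
  move=> t /andP[t0 tr]; rewrite ler_norml.
  have : 0 <= r^-1 * t <= 1.
    by rewrite mulr_ge0 ?invr_ge0//= mulrC ler_pdivrMr// mul1r.
  by move=> /andP[? ?]; apply/andP; split; lra.
by rewrite subr0 mul1r.
Qed.

Lemma tstT_avg1 G i f : tst G f -> tst setT (avg1 i r f).
Proof. by move=> hf; apply: tst_line; rewrite core1T; exact: tst_sub hf. Qed.

Lemma nrm_avg3 G f : tst G f -> nrm (avg3 r f) <= nrm f.
Proof.
move=> hf; have h1 := tstT_avg1 ord0 hf; have h2 := tstT_avg1 (inord 1) h1.
apply: le_trans (nrm_avg1 _ h2) _; apply: le_trans (nrm_avg1 _ h1) _.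
exact: nrm_avg1 hf.
Qed.

Lemma nrm_boxpot G i f : tst G f -> nrm (boxpot r i f) <= r ^+ 2 * nrm f.
Proof.
move=> hf; have h1 := tstT_avg1 ord0 hf; have h2 := tstT_avg1 (inord 1) h1.
rewrite /boxpot; case: ifP => _; first exact: nrm_pot1 hf.
case: ifP => _.
  by apply: le_trans (nrm_pot1 _ h1) _; rewrite ler_pM2l ?exprn_gt0//; exact: nrm_avg1 hf.
apply: le_trans (nrm_pot1 _ h2) _; rewrite ler_pM2l ?exprn_gt0//.
by apply: le_trans (nrm_avg1 _ h1) _; exact: nrm_avg1 hf.
Qed.

Lemma partial_avg1 G i j f : tst G f -> partial j (avg1 i r f) = avg1 i r (partial j f).
Proof. exact: partial_lineavg. Qed.

Lemma partial_avg3 G j f : tst G f -> partial j (avg3 r f) = avg3 r (partial j f).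
Proof.
move=> hf; have h1 := tstT_avg1 ord0 hf; have h2 := tstT_avg1 (inord 1) h1.
by rewrite /avg3 (partial_avg1 _ _ h2) (partial_avg1 _ _ h1) (partial_avg1 _ _ hf).
Qed.

Lemma partial_boxpot G i j f : tst G f -> partial j (boxpot r i f) = boxpot r i (partial j f).
Proof.
move=> hf; have h1 := tstT_avg1 ord0 hf; have h2 := tstT_avg1 (inord 1) h1.
rewrite /boxpot /pot1; case: (i == ord0); first exact: (partial_lineavg _ _ _ _ r0' hf).
case: (i == inord 1).
  by rewrite (partial_lineavg _ _ _ _ r0' h1) (partial_avg1 _ _ hf).
by rewrite (partial_lineavg _ _ _ _ r0' h2) (partial_avg1 _ _ h1) (partial_avg1 _ _ hf).
Qed.

Lemma boxpotB G i f g : tst G f -> tst G g ->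
  boxpot r i (fun x => f x - g x) = (fun x => boxpot r i f x - boxpot r i g x).
Proof.
move=> hf hg; have h1 := tstT_avg1 ord0 hf; have h2 := tstT_avg1 (inord 1) h1.
have k1 := tstT_avg1 ord0 hg; have k2 := tstT_avg1 (inord 1) k1.
have B (k : 'I_3) (u v : R3 -> R) p q : tst setT u -> tst setT v ->
    lineavg k 0 r p q (fun x => u x - v x) = (fun x => lineavg k 0 r p q u x - lineavg k 0 r p q v x).
  move=> [su _] [sv _]; apply: lineavgB; exact: smooth_continuous.
have {hf}hf : tst setT f by exact: tst_sub hf.
have {hg}hg : tst setT g by exact: tst_sub hg.
rewrite /boxpot; case: (i == ord0); first exact: (B _ _ _ _ _ hf hg).
rewrite /avg1 (B ord0 f g 0 r^-1 hf hg); case: (i == inord 1); first exact: (B _ _ _ _ _ h1 k1).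
by rewrite (B (inord 1) _ _ 0 r^-1 h1 k1); exact: (B _ _ _ _ _ h2 k2).
Qed.

Lemma avg1_decomposition G i f x : tst G f -> f x = avg1 i r f x + partial i (pot1 i r f) x.
Proof.
move=> hf; rewrite /pot1 (partial_lineavg _ _ _ _ r0' hf) (lineavg_ftc i r^-1 (-1) x r0 hf.1).
rewrite mulVf ?gt_eqF// subrr mul0r mulr0 scale0r !add0r mulN1r opprK.
rewrite /avg1; have := lineavgZ i 0 r 0 1 r^-1 (smooth_continuous hf.1) => /(congr1 (@^~ x)) /= <-.
have -> : lineavg i 0 r 0 r^-1 f x = lineavg i 0 r 0 1 (fun x => r^-1 * f x) x.
  by apply: eq_Rintegral => t _; rewrite !mul0r !add0r mul1r.
by rewrite addrC subrK.
Qed.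

Lemma box_decomposition G f x : tst G f ->
  f x = \sum_i partial i (boxpot r i f) x + avg3 r f x.
Proof.
move=> hf; have h1 := tstT_avg1 ord0 hf; have h2 := tstT_avg1 (inord 1) h1.
rewrite (avg1_decomposition ord0 x hf) (avg1_decomposition (inord 1) x h1).
rewrite (avg1_decomposition (inord 2) x h2) -/(avg3 r f).
rewrite !big_ord_recl big_ord0.
have -> : lift ord0 ord0 = inord 1 :> 'I_3 by apply: val_inj; rewrite /= inordK.
have -> : lift ord0 (lift ord0 ord0) = inord 2 :> 'I_3 by apply: val_inj; rewrite /= inordK.
have n1 : (inord 1 == ord0 :> 'I_3) = false by rewrite -val_eqE /= inordK.
have n2 : (inord 2 == ord0 :> 'I_3) = false by rewrite -val_eqE /= inordK.
have n3 : (inord 2 == inord 1 :> 'I_3) = false by rewrite -val_eqE /= !inordK.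
have aux (a b c d : R) : a + b + c + d = d + (c + (b + 0)) + a by ring.
by rewrite /boxpot eqxx n1 eqxx n2 n3; exact: aux.
Qed.

(** The derivative of a mean along its own axis is a difference quotient of step [r]; the 4 is the
    cost of squaring a difference of two functions of equal norm. *)
Lemma nrm_partial_avg1 G i f : tst G f ->
  nrm (partial i (avg1 i r f)) <= r^-1 ^+ 2 * (4 * nrm f).
Proof.
move=> hf; have [sf [K hK _]] := hf; have cf := smooth_continuous sf.
rewrite (partial_avg1 _ _ hf).
pose g (x : R3) := f (r *: basis3 R i + x) - f x.
have -> : avg1 i r (partial i f) = (fun x => r^-1 * g x).
  apply/funext => x; rewrite /avg1 (lineavg_ftc i 0 r^-1 x r0 sf).
  by rewrite !mul0r !add0r scale0r add0r subr0 /g mulrBr.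
have iT := @measurableT _ mR3.
have s1 : sqint mu3 (setT : set mR3) (fun x : R3 => f (r *: basis3 R i + x)).
  by apply: csupp_sqint (csupp_shift (r *: basis3 R i) hK) => //; exact: continuous_shift3.
have s2 := tst_sqint iT hf.
pose H := L2_hilbert mu3 iT.
pose F1 := toL2 iT s1; pose F2 := toL2 iT s2.
have E : nrm (fun x => r^-1 * g x) = ipi mu3 (setT : set mR3) (r^-1 *: (F1 - F2)) (r^-1 *: (F1 - F2)).
  by [].
rewrite E (nsZ H) ler_pM2l ?exprn_gt0 ?invr_gt0//.
have le := nsD_le H F1 (- F2); rewrite (ipNl H) (ipNr H) opprK in le.
apply: le_trans le _.
have -> : ipi mu3 (setT : set mR3) F1 F1 = nrm f by exact: (nrm_shift (r *: basis3 R i) cf hK).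
have -> : ipi mu3 (setT : set mR3) F2 F2 = nrm f by [].
by move: (nrm f) => z; lra.
Qed.

Lemma nrm_partial_avg3 G j f : tst G f ->
  nrm (partial j (avg3 r f)) <= r^-1 ^+ 2 * (4 * nrm f).
Proof.
move=> hf; have h1 := tstT_avg1 ord0 hf; have h2 := tstT_avg1 (inord 1) h1.
have a0 : 0 <= r^-1 ^+ 2 * 4 by rewrite mulr_ge0// sqr_ge0.
have [->|->|->] := ord3P j; rewrite /avg3.
- rewrite (partial_avg1 _ _ h2) (partial_avg1 _ _ h1).
  have d1 := tst_partial ord0 h1.
  apply: le_trans (nrm_avg1 _ (tstT_avg1 (inord 1) d1)) _.
  by apply: le_trans (nrm_avg1 _ d1) _; exact: nrm_partial_avg1 hf.
- rewrite (partial_avg1 _ _ h2).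
  apply: le_trans (nrm_avg1 _ (tst_partial (inord 1) h2)) _.
  apply: le_trans (nrm_partial_avg1 _ h1) _.
  by rewrite !mulrA ler_wpM2l//; exact: nrm_avg1 hf.
- apply: le_trans (nrm_partial_avg1 _ h2) _.
  rewrite !mulrA ler_wpM2l//; apply: le_trans (nrm_avg1 _ h1) _; exact: nrm_avg1 hf.
Qed.

Lemma avg1_sq_le i f x (A : mR -> \bar R) : continuous f -> measurable_fun setT A ->
  (forall t, ((f ((t : R) *: basis3 R i + x) ^+ 2)%:E <= A t)%E) ->
  ((avg1 i r f x ^+ 2)%:E <= (r^-1)%:E * \int[leb]_t A t)%E.
Proof.
move=> cf mA hA.
have A0 t : (0 <= A t)%E by apply: le_trans (hA t); rewrite lee_fin sqr_ge0.
apply: (le_trans (@lineavg_sq_le R i 0 r 0 r^-1 r^-1 f x r0' cf _)).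
  by move=> t _; rewrite mul0r add0r ger0_norm ?invr_ge0.
rewrite subr0 expr2 -mulrA mulVf ?gt_eqF// mulr1.
apply: lee_wpmul2l; first by rewrite lee_fin invr_ge0.
have mI : measurable (`[0, r] : set mR) by exact: measurable_itv.
apply: (@le_trans _ _ (\int[leb]_(t in (`[0%R, r] : set mR)) A t)%E).
  apply: ge0_le_integral => //.
  - by move=> t _; rewrite lee_fin sqr_ge0.
  - apply: measurable_int (continuous_itv_sqint 0 r (@continuous_line R f (basis3 R i) x cf)).2.
  - exact: measurable_funTS.
by apply: ge0_subset_integral.
Qed.

(** Cauchy-Schwarz along one axis at a time yields three factors [r^-1], and Tonelli reassembles the
    iterated integral of [f ^+ 2]. *)
Lemma avg3_sup G f x : tst G f -> avg3 r f x ^+ 2 <= r^-1 ^+ 3 * nrm f.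
Proof.
move=> hf; have h1 := tstT_avg1 ord0 hf; have h2 := tstT_avg1 (inord 1) h1.
have cf := smooth_continuous hf.1; have iT := @measurableT _ mR3.
pose H (z : mR3) := (f ((z : R3) + x) ^+ 2)%:E.
have H0 z : (0 <= H z)%E by rewrite lee_fin sqr_ge0.
have mH : measurable_fun setT H.
  apply/measurable_EFinP; apply: measurable_funX; apply: continuous_measurable3.
  by under eq_fun do rewrite addrC; exact: continuous_shift3.
pose A := fubini_G (@leb2 R) H.
pose mA : measurable_fun setT A := measurable_fun_fubini_tonelli_G H mH H0.
have intH : (\int[leb]_u A u)%E = (nrm f)%:E.
  rewrite -(fubini_tonelli2 (m1 := @leb2 R) (m2 := leb) H mH H0).
  rewrite /nrm -(integral_sqr iT (tst_sqint iT hf)).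
  rewrite -(@ge0_integral_shift3 R x (fun z => (f z ^+ 2)%:E))//.
  - by apply: eq_integral => z _; rewrite /H addrC.
  - by apply/measurable_EFinP; apply: measurable_funX; exact: continuous_measurable3.
  - by move=> z; rewrite lee_fin sqr_ge0.
have ir0 : (0 <= r^-1%:E :> \bar R)%E by rewrite lee_fin invr_ge0.
rewrite -lee_fin [leRHS]EFinM -intH.
apply: (le_trans (@avg1_sq_le _ _ x (fun u => ((r^-1)%:E * ((r^-1)%:E * A u))%E) _ _ _)).
- exact: smooth_continuous h2.1.
- by apply: (emeasurable_funM (f := cst _)) => //; apply: (emeasurable_funM (f := cst _)).
- move=> u; set y := (u : R) *: basis3 R (inord 2) + x.
  pose Hu (p : mR * mR) := H (p, u).
  have mHu : measurable_fun setT Hu.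
    by apply: (measurableT_comp mH); exact: pair2_measurable.
  have Hu0 p : (0 <= Hu p)%E by exact: H0.
  pose B := fubini_G leb Hu.
  have mB : measurable_fun setT B := measurable_fun_fubini_tonelli_G Hu mHu Hu0.
  have -> : A u = (\int[leb]_t B t)%E.
    by rewrite -(fubini_tonelli2 (m1 := leb) (m2 := leb) Hu mHu Hu0).
  rewrite -[X in (_ <= _ * X)%E]ge0_integralZl//; last first.
    by move=> t _; exact: integral_ge0.
  apply: avg1_sq_le.
  + exact: smooth_continuous h1.1.
  + by apply: (emeasurable_funM (f := cst _)).
  move=> t; apply: avg1_sq_le => //.
    by apply: (measurableT_comp mHu); exact: pair2_measurable.
  by move=> s; have E := @decomp3 R ((s, t), u) x; rewrite /= -/y in E; rewrite /Hu /H E.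
rewrite ge0_integralZl//; last 2 first.
- by apply: (emeasurable_funM (f := cst _)).
- by move=> u _; rewrite mule_ge0//; exact: integral_ge0.
rewrite ge0_integralZl//; last by move=> u _; exact: integral_ge0.
by rewrite !muleA -!EFinM -!expr2 -exprSr.
Qed.

End Fixed.
End BoxAverage.

(** * Finite rank approximation of double averages *)

Section FiniteRank.
Variable R : realType.
Notation R3 := (R * R * R)%type.
Notation mR := (measurableTypeR R).
Notation mR3 := (mR * mR * mR)%type.
Notation mu3 := (@leb3 R).
Implicit Types (f g : R3 -> R) (i j : 'I_3) (r : R).

(** Near-covering compactness, for the filter of finite sequences that contain a given one. The
    centre returned is known to lie in [K], so local data attached to it are available. *)
Lemma compact_seq_cover (K : set R3) (U : R3 -> set R3) : compact K ->
  (forall x, K x -> open (U x) /\ U x x) ->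
  exists cs : seq R3, forall y, K y -> exists2 c, c \in cs & K c /\ U c y.
Proof.
rewrite compact_near_coveringP => cK hU.
pose F : set_system (seq R3) := filter_from setT (fun s0 : seq R3 => [set s : seq R3 | {subset s0 <= s}]).
have FF : Filter F.
  apply: filter_from_filter; first by exists [::].
  move=> s1 s2 _ _; exists (s1 ++ s2) => // s hs; split => c hc; apply: hs;
    by rewrite mem_cat hc ?orbT.
have [|s0 _ hs0] := cK _ F (fun cs y => exists2 c, c \in cs & K c /\ U c y) FF.
  move=> x Kx; have [oU Ux] := hU _ Kx.
  exists (U x, [set s : seq R3 | {subset [:: (x : R3)] <= s}]).
    by split; [exact: open_nbhs_nbhs|exists [:: x]].
  move=> [y s] /= [Uy hs]; exists x => //; apply: hs; exact: mem_head.
by exists s0; exact: (hs0 s0).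
Qed.

(** The factor [2 ^+ size s] is crude, but follows by induction from the case of two terms. *)
Lemma sqr_sum_le (T : Type) (s : seq T) (F : T -> R) :
  (\sum_(a <- s) F a) ^+ 2 <= 2 ^+ (size s) * \sum_(a <- s) F a ^+ 2.
Proof.
elim: s => [|a s IH]; first by rewrite !big_nil expr0n mulr0.
rewrite !big_cons /= [2 ^+ _]exprS.
set S := \sum_(_ <- s) F _; set Q := \sum_(_ <- s) _ ^+ 2; set n := 2 ^+ size s.
have n1 : 1 <= n by rewrite /n exprn_ege1// ler1n.
have Q0 : 0 <= Q by apply: sumr_ge0 => b _; exact: sqr_ge0.
have a0 := sqr_ge0 (F a).
have := sqr_ge0 (F a - S); rewrite sqrrB sqrrD.
have : F a ^+ 2 <= n * F a ^+ 2 by rewrite ler_peMl.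
move: IH; rewrite -/S -/Q -/n; lra.
Qed.

Section Domain.
Variable G : set R3.
Hypothesis mG : measurable (G : set mR3).
Hypothesis Gfin : (mu3 G < +oo)%E.

Lemma indic_sqint (D : set mR3) : measurable D -> sqint mu3 (G : set mR3) (\1_D : mR3 -> R).
Proof.
move=> mD; split; first exact: measurable_indic.
apply/integrableP; split.
  by apply/measurable_EFinP; apply: measurable_funX; exact: measurable_indic.
apply: (@le_lt_trans _ _ (\int[mu3]_(x in (G : set mR3)) (cst 1%:E x))%E).
  apply: ge0_le_integral => //.
    apply: measurableT_comp => //; apply/measurable_EFinP; apply: measurable_funX.
    exact: measurable_indic.
  move=> x _; rewrite gee0_abs ?lee_fin ?sqr_ge0// indicE.
by rewrite integral_cst// mul1e.
Qed.

Lemma sqint_integrable (h : mR3 -> R) : sqint mu3 (G : set mR3) h ->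
  mu3.-integrable (G : set mR3) (EFin \o h).
Proof.
move=> hh; have := sqint_mul mG (indic_sqint (@measurableT _ mR3)) hh.
by apply: eq_integrable => // x _ /=; rewrite indicT mul1r.
Qed.

Lemma ipi_indic (D : set mR3) (h : mR3 -> R) : measurable D -> D `<=` G ->
  ipi mu3 (G : set mR3) (\1_D) h = \int[mu3]_(x in D) h x.
Proof.
move=> mD DG; rewrite /ipi [RHS]Rintegral_mkcond [LHS]Rintegral_mkcond.
apply: eq_Rintegral => x _; rewrite !patchE indicE.
case: (boolP (x \in D)) => xD; last by rewrite mul0r if_same.
by rewrite mul1r ifT// inE; apply: DG; rewrite inE in xD.
Qed.

(** A Riemann sum: [D] is cut into cells by removing one ball after another, and [u] is frozen at
    the centre of each. The list [ps] is chosen before [h] and [u]. *)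
Lemma cell_approx (d : R) (cs : seq R3) (D : set mR3) : measurable D -> D `<=` G ->
  (forall x, D x -> exists2 c, c \in cs & ball c d x) ->
  exists ps : seq (L2type mu3 mG * R3), forall (h : mR3 -> R) (u : R3 -> R) w,
    sqint mu3 (G : set mR3) h -> sqint mu3 (G : set mR3) u ->
    (forall x y, ball x d y -> `|u x - u y| <= w) ->
    `|\int[mu3]_(x in D) (h x * u x) - \sum_(p <- ps) u p.2 * ipi mu3 (G : set mR3) p.1 h|
      <= w * \int[mu3]_(x in D) `|h x|.
Proof.
elim: cs D => [|c cs IH] D mD DG cov.
  exists [::] => h u w hh hu hw.
  have -> : D = set0 by apply/seteqP; split => // x /cov[].
  by rewrite big_nil !Rintegral_set0 subr0 normr0 mulr0.
pose B : set mR3 := ball c d.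
have mB : measurable B by exact: measurable_ball3.
have mD1 : measurable (D `&` B) by exact: measurableI.
have mD2 : measurable (D `\` B) by exact: measurableD.
have [||ps hps] := IH (D `\` B) mD2; first by move=> x [/DG].
  move=> x [Dx nB]; have [c' ] := cov _ Dx; rewrite in_cons => /orP[/eqP ->//|c'cs hb].
  by exists c'.
exists ((toL2 mG (indic_sqint mD1), c) :: ps) => h u w hh hu hw.
rewrite big_cons /= ipi_indic//; last by move=> x [/DG].
have sub (E : set mR3) (F : mR3 -> \bar R) : measurable E -> E `<=` G ->
    mu3.-integrable (G : set mR3) F -> mu3.-integrable E F.
  by move=> mE EG; exact: integrableS.
have ihu := sqint_mul mG hh hu; have ih := sqint_integrable hh.
have iah := integrable_norm ih.
have D1G : D `&` B `<=` G by move=> x [/DG].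
have D2G : D `\` B `<=` G by move=> x [/DG].
have ED : D = (D `&` B) `|` (D `\` B) by rewrite setUIDK.
have dis : [disjoint D `&` B & D `\` B].
  by apply/disj_setPS => x [[_ ?] [_]].
have split_int (F : mR3 -> R) : mu3.-integrable (G : set mR3) (EFin \o F) ->
    \int[mu3]_(x in D) F x = \int[mu3]_(x in D `&` B) F x + \int[mu3]_(x in D `\` B) F x.
  move=> iF; rewrite {1}ED; apply: Rintegral_setU => //.
  by rewrite -ED; exact: sub.
rewrite (split_int _ ihu) (split_int _ iah) mulrDr.
set S := \sum_(_ <- _) _; set I2 := \int[mu3]_(x in D `\` B) (h x * u x).
have -> : \int[mu3]_(x in D `&` B) (h x * u x) + I2 - (u c * \int[mu3]_(x in D `&` B) h x + S) =
   (\int[mu3]_(x in D `&` B) (h x * u x) - u c * \int[mu3]_(x in D `&` B) h x) + (I2 - S).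
  by ring.
apply: le_trans (ler_normD _ _) _; apply: lerD; last exact: hps.
have i1 := sub _ _ mD1 D1G ihu; have i2 := sub _ _ mD1 D1G ih.
have i3 := sub _ _ mD1 D1G iah.
have i4 := integrableZl mD1 (u c) i2.
rewrite -RintegralZl// -RintegralB//.
have /le_trans := le_normr_Rintegral mD1 (integrableB mD1 i1 i4); apply.
rewrite -RintegralZl//.
apply: le_Rintegral => //.
- exact: (integrable_norm (integrableB mD1 i1 i4)).
- exact: (integrableZl mD1 w i3).
move=> x [_ Bx]; rewrite (mulrC (h x)) -mulrBl normrM ler_wpM2r//.
by rewrite distrC; exact: hw.
Qed.

Lemma lipschitz_of_partial f (L : R) : smooth f -> (forall i x, `|partial i f x| <= L) ->
  forall d x y, ball x d y -> `|f x - f y| <= L * (3 * d).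
Proof.
move=> sf hL d x y /ball3E[h1 h2 h3].
have L0 : 0 <= L by apply: le_trans (hL ord0 0).
rewrite distrC -{1}(subrK x y) (@decomp3 R (y - x) x).
set z := (y - x).2 *: _ + x; set v := _ *: _ + z; set w := _ *: _ + v.
have -> : f w - f x = (f w - f v) + (f v - f z) + (f z - f x) by ring.
have [a _ ->] := slice_mvt v ord0 (y - x).1.1 sf.
have [b _ ->] := slice_mvt z (inord 1) (y - x).1.2 sf.
have [c _ ->] := slice_mvt x (inord 2) (y - x).2 sf.
have aux (p q : R) i z' : `|p - q| < d -> `|(q - p) * partial i f z'| <= L * d.
  by move=> hq; rewrite normrM mulrC distrC; apply: ler_pM => //; exact: ltW.
have A := aux _ _ ord0 (a *: basis3 R ord0 + v) h1.
have B := aux _ _ (inord 1) (b *: basis3 R (inord 1) + z) h2.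
have C := aux _ _ (inord 2) (c *: basis3 R (inord 2) + x) h3.
apply: le_trans (ler_normD _ _) _; apply: le_trans (lerD (ler_normD _ _) (lexx _)) _.
by apply: le_trans (lerD (lerD A B) C) _; lra.
Qed.

Lemma ler_sqrt_norm (x y : R) : x ^+ 2 <= y -> `|x| <= Num.sqrt y.
Proof. by move=> h; rewrite -sqrtr_sqr ler_wsqrtr. Qed.

Lemma sqr_le_of_sub (a b c : R) : (a - b) ^+ 2 <= c -> a ^+ 2 <= 2 * c + 2 * b ^+ 2.
Proof. by have := sqr_ge0 (a - 2 * b); rewrite !sqrrB; lra. Qed.

(** Of the two averages, one bounds the first derivatives in norm and the other turns this into a
    uniform bound; the double average is then Lipschitz with a constant controlled by [nrm f], and
    Riemann sums apply. *)
Lemma avg3_finite_rank r e : 0 < r -> 0 < e -> (exists rho, G `<=` cube rho) ->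
  exists xs : seq (L2type mu3 mG), forall (h : mR3 -> R) f,
    sqint mu3 (G : set mR3) h -> tst setT f ->
    ipi mu3 (G : set mR3) h (avg3 r (avg3 r f)) ^+ 2 <=
    (e * ipi mu3 (G : set mR3) h h + \sum_(xi <- xs) ipi mu3 (G : set mR3) xi h ^+ 2) * nrm f.
Proof.
move=> r0 e0 [rho Grho].
have aux1 (a b c d : R) : 2 * a * b * c * d = 2 * (a * (b * d) * c) by ring.
have aux2 (a b c d : R) : 2 * (a * b * (3 ^+ 2 * c) * d) = (18 * a * c * b) * d by ring.
have aux3 (a b c d k : R) : 18 * a * b * c * (d * k) = (18 * a * d * b) * (k * c) by ring.
(* [L * nrm f] bounds the squared derivatives of the double average: [r^-1 ^+ 3] comes from
   [avg3_sup], the rest from [nrm_partial_avg3]. *)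
pose L := r^-1 ^+ 3 * (r^-1 ^+ 2 * 4); pose m := fine (mu3 G).
have L0 : 0 <= L by rewrite /L !mulr_ge0 ?exprn_ge0 ?invr_ge0// ltW.
have m0 : 0 <= m by exact: fine_ge0.
have q0 : 0 < 18 * L * m + 1.
  by rewrite ltr_wpDl//; apply: mulr_ge0 => //; exact: mulr_ge0.
(* Here [18 = 2 * 3 ^+ 2]: three coordinates give an oscillation of [3 d] times the derivative
   bound, and splitting a square costs 2. The minimum with 1 gives [d ^+ 2 <= d]. *)
pose d := Num.min 1 (e / (18 * L * m + 1)).
have d0 : 0 < d by rewrite lt_min ltr01 divr_gt0.
have d1 : d <= 1 by rewrite ge_min lexx.
have dsmall : 18 * L * m * d ^+ 2 <= e.
  have : d <= e / (18 * L * m + 1) by rewrite ge_min lexx orbT.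
  rewrite ler_pdivlMr// => hd.
  have : d ^+ 2 <= d by rewrite expr2 ger_pMr.
  by move=> hdd; have := mulr_ge0 (mulr_ge0 (mulr_ge0 (ler0n R 18) L0) m0) (ltW d0); nra.
have cC : compact (@cube R rho).
  rewrite cubeE; apply: compact_setX; last exact: segment_compact.
  by apply: compact_setX; exact: segment_compact.
have [|cs hcs] := compact_seq_cover (U := fun c => ball c d) cC.
  by move=> x _; split; [exact: ball_open|exact: ballxx].
have [||ps hps] := @cell_approx d cs G mG; first by [].
  by move=> x /Grho/hcs[c ccs [_ hb]]; exists c.
(* The scale [s] absorbs the splitting of the square, the factor from [sqr_sum_le] and the bound on
   the values of the average at the centres. *)
pose s : R := Num.sqrt (2 * 2 ^+ size ps * r^-1 ^+ 3).
have s2 : s ^+ 2 = 2 * 2 ^+ size ps * r^-1 ^+ 3.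
  by rewrite sqr_sqrtr// !mulr_ge0 ?exprn_ge0 ?invr_ge0// ltW.
exists [seq s *: p.1 | p <- ps] => h f hh hf.
set u := avg3 r (avg3 r f).
have TT : tst setT f -> tst setT (avg3 r f) by move=> k; apply: tst_avg3; rewrite ?core3T.
have hA := TT hf; have hu : tst setT u by apply: tst_avg3; rewrite ?core3T.
have n0 := nrm_ge0 f; have nA := nrm_avg3 r0 hf.
pose w := Num.sqrt (L * nrm f).
have dbound i x : `|partial i u x| <= w.
  apply: ler_sqrt_norm; rewrite /u (partial_avg3 r0 _ hA).
  apply: le_trans (avg3_sup r0 _ (tst_partial i hA)) _.
  have -> : L * nrm f = r^-1 ^+ 3 * (r^-1 ^+ 2 * (4 * nrm f)) by rewrite /L; ring.
  apply: ler_wpM2l; first by rewrite exprn_ge0 ?invr_ge0 ?ltW.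
  exact: (nrm_partial_avg3 r0 i hf).
have su := tst_sqint mG hu.
have := hps h u _ hh su (fun x y => lipschitz_of_partial hu.1 dbound (d := d) (x := x) (y := y)).
rewrite -/(ipi mu3 (G : set mR3) h u).
set I := ipi _ _ h u; set S := \sum_(_ <- ps) _; set H := \int[mu3]_(x in G) _ => hI.
have hH : H ^+ 2 <= m * ipi mu3 (G : set mR3) h h.
  have sa : sqint mu3 (G : set mR3) (fun x => `|h x|).
    split; first by apply: measurableT_comp => //; exact: hh.1.
    by apply: eq_integrable hh.2 => // x _; rewrite real_normK ?num_real.
  have := ipi_cauchy_schwarz mG (indic_sqint (@measurableT _ mR3)) sa.
  have -> : ipi mu3 (G : set mR3) \1_(setT : set mR3) (fun x => `|h x|) = H.
    by apply: eq_Rintegral => x _; rewrite indicT mul1r.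
  have -> : ipi mu3 (G : set mR3) \1_(setT : set mR3) \1_(setT : set mR3) = m.
    rewrite /ipi; under eq_Rintegral do rewrite indicT mul1r.
    by rewrite (Rintegral_cst _ mG) mul1r.
  have -> // : ipi mu3 (G : set mR3) (fun x => `|h x|) (fun x => `|h x|) = ipi mu3 (G : set mR3) h h.
  by apply: eq_Rintegral => x _; rewrite -!expr2 real_normK ?num_real.
have hS : S ^+ 2 <= 2 ^+ size ps * (r^-1 ^+ 3 * nrm f) * \sum_(p <- ps) ipi mu3 (G : set mR3) p.1 h ^+ 2.
  apply: le_trans (sqr_sum_le _ _) _; rewrite -mulrA ler_wpM2l ?exprn_ge0//.
  rewrite mulr_sumr; apply: ler_sum => p _; rewrite exprMn ler_wpM2r ?sqr_ge0//.
  apply: le_trans (avg3_sup r0 _ hA) _.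
  by rewrite ler_wpM2l// exprn_ge0// invr_ge0 ltW.
have w2 : w ^+ 2 = L * nrm f by rewrite sqr_sqrtr// mulr_ge0.
have hIS : I ^+ 2 <= 2 * ((w * (3 * d)) * H) ^+ 2 + 2 * S ^+ 2.
  have h1 : (I - S) ^+ 2 <= ((w * (3 * d)) * H) ^+ 2.
    rewrite -(real_normK (num_real (I - S))); apply: lerXn2r => //.
    by rewrite nnegrE; apply: le_trans hI.
  exact: sqr_le_of_sub h1.
apply: le_trans hIS _.
rewrite big_map [leRHS]mulrDl.
have -> : \sum_(p <- ps) ipi mu3 (G : set mR3) (s *: p.1) h ^+ 2 = s ^+ 2 * \sum_(p <- ps) ipi mu3 (G : set mR3) p.1 h ^+ 2.
  rewrite mulr_sumr; apply: eq_bigr => p _.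
  have E := ipZl (L2_hilbert mu3 mG) s p.1 (toL2 mG hh).
  by rewrite [ipi _ _ _ h]E exprMn.
set Q := \sum_(p <- ps) _ in hS *; rewrite s2.
rewrite [X in _ <= _ + X]aux1.
apply: lerD; last by rewrite ler_pM2l.
rewrite !exprMn w2.
rewrite aux2.
have c0 : 0 <= 18 * L * d ^+ 2 * nrm f.
  by apply: mulr_ge0 => //; apply: mulr_ge0; [exact: mulr_ge0|exact: sqr_ge0].
apply: le_trans (ler_wpM2l c0 hH) _.
have hh0 := ipi_ge0 mu3 (G : set mR3) h.
rewrite aux3.
by rewrite -(mulrA e); apply: ler_wpM2r => //; exact: mulr_ge0.
Qed.

End Domain.
End FiniteRank.

(** * Density of test functions *)

Section Bump.
Variable R : realType.
Notation R3 := (R * R * R)%type.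
Implicit Types (t : R).

(* [t ^- n * exp (- 1 / t)] for [t > 0], extended by zero: this family is stable
   under differentiation. *)
Definition flat (n : nat) t : R := if 0 < t then t^-1 ^+ n * expR (- t^-1) else 0.

Lemma flat_ge0 n t : 0 <= flat n t.
Proof.
rewrite /flat; case: ifP => // t0.
by rewrite mulr_ge0 ?expR_ge0// exprn_ge0// invr_ge0 ltW.
Qed.

(** From the term of order [n.+2] of the exponential series at [t^-1]. Quadratic decay makes the
    derivative at the origin zero. *)
Lemma flat_le n t : flat n t <= (n.+2)`!%:R * t ^+ 2.
Proof.
rewrite /flat; case: ifP => [t0|_]; last by rewrite mulr_ge0// sqr_ge0.
have it0 : 0 < t^-1 by rewrite invr_gt0.
rewrite expRN ler_pdivrMr ?expR_gt0//.
have f0 : 0 < (n.+2)`!%:R :> R by rewrite ltr0n fact_gt0.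
have h : t^-1 ^+ n.+2 / (n.+2)`!%:R <= expR t^-1.
  by apply: le_trans (expR_ge1Dxn n.+1 (ltW it0)); rewrite lerDr.
have c0 : 0 <= (n.+2)`!%:R * t ^+ 2 by rewrite mulr_ge0 ?sqr_ge0// ltW.
apply: le_trans (ler_wpM2l c0 h).
have -> : t^-1 ^+ n.+2 = t^-1 ^+ n * t^-1 ^+ 2 by rewrite -exprD addn2.
have -> : (n.+2)`!%:R * t ^+ 2 * (t^-1 ^+ n * t^-1 ^+ 2 / (n.+2)`!%:R) =
  t^-1 ^+ n * (t * t^-1) ^+ 2 * ((n.+2)`!%:R / (n.+2)`!%:R) by rewrite exprMn; ring.
by rewrite !mulfV ?gt_eqF// expr1n !mulr1.
Qed.

Lemma is_derive_flat n t :
  is_derive t 1 (flat n) (flat n.+2 t - n%:R * flat n.+1 t).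
Proof.
have [t0|t0] := ltP 0 t.
  have d1 : is_derive t 1 (fun s : R => s^-1) (- t ^- 2 *: 1).
    by apply: is_deriveV; rewrite gt_eqF.
  have d2 := is_deriveX n d1.
  have d3 : is_derive t 1 (fun s : R => - s^-1) (- (- t ^- 2 *: 1)) by exact: is_deriveN.
  have d4 := @is_derive1_comp R expR (fun s => - s^-1) t _ _ (is_derive_expR (- t^-1)) d3.
  have d5 := is_deriveM d2 d4.
  apply: (@near_eq_is_derive _ _ _ ((fun s : R => s^-1) ^+ n * (expR \o (fun s : R => - s^-1)))).
    by apply: filterS (lt_nbhsr t0) => s s0; rewrite /flat s0 exprfctE.
  apply: (@is_derive_eq _ _ _ _ _ _ _ _ d5).
  rewrite /flat t0 /GRing.scale /= -exprVn.
  rewrite exprfctE.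
  case: n {d2 d5} => [|n]; first by rewrite !expr0; ring.
  by rewrite -pred_Sn !exprS; ring.
have E : flat n.+2 t - n%:R * flat n.+1 t = 0.
  by rewrite /flat ltNge t0 /= mulr0 subr0.
rewrite E; move: t0; rewrite le_eqVlt => /orP[/eqP -> {t E}|t0]; last first.
  apply: (@near_eq_is_derive _ _ _ (cst (0 : R))).
  apply: filterS (lt_nbhsl t0) => s s0; rewrite /flat ifF//.
  by apply/negbTE; rewrite -leNgt ltW.
have cv : (fun h : R => h^-1 *: ((flat n \o shift 0) (h *: (1 : R)) - flat n 0)) @ 0^' --> (0 : R).
  apply/cvgrPdist_le => e e0.
  have c0 : 0 < (n.+2)`!%:R :> R by rewrite ltr0n fact_gt0.
  near=> h.
  have h0 : h != 0 by near: h; exact: nbhs_dnbhs_neq.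
  rewrite sub0r normrN /= addr0 [h *: 1]mulr1 {2}/flat ltxx subr0 -[_ *: _]/(h^-1 * _).
  rewrite normrM normfV ler_pdivrMl ?normr_gt0// ger0_norm ?flat_ge0//.
  apply: le_trans (flat_le n h) _; rewrite -(real_normK (num_real h)) expr2 mulrCA.
  rewrite ler_wpM2l// -ler_pdivlMl//; near: h; apply: dnbhs0_le.
  by rewrite mulr_gt0// invr_gt0.
by split; [apply/cvg_ex; exists 0|exact/cvg_lim].
Unshelve. all: by end_near. Qed.

Lemma flat_continuous n : continuous (flat n).
Proof.
move=> t; have [d _] := is_derive_flat n t.
by apply: differentiable_continuous; exact/derivable1_diffP.
Qed.

Definition coord (j : 'I_3) (x : R3) : R :=
  if j == 0%N :> nat then x.1.1 else if j == 1%N :> nat then x.1.2 else x.2.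

Lemma coord_line i j (h : R) x :
  coord j (h *: basis3 R i + x) = h * (i == j)%:R + coord j x.
Proof.
rewrite /coord /basis3 -val_eqE /=.
case: j => [[|[|[|m]]] lt] //=; case: i => [[|[|[|k]]] lt'] //=;
  by rewrite ?eqxx.
Qed.

Lemma coord_continuous j : continuous (coord j).
Proof.
rewrite /coord => x; case: (_ == _); [|case: (_ == _)].
- exact: (cvg_comp _ _ cvg_fst (@cvg_fst _ _ _ _ _)).
- exact: (cvg_comp _ _ cvg_fst (@cvg_snd _ _ _ _ _)).
- exact: cvg_snd.
Qed.

Lemma is_derive_of_slice (f : R3 -> R) x (v : R3) df :
  is_derive (0 : R) 1 (fun s : R => f (s *: v + x)) df -> is_derive x v f df.
Proof.
have E : (fun h : R => h^-1 *: (((fun s : R => f (s *: v + x)) \o shift 0) (h *: 1) -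
     (fun s : R => f (s *: v + x)) 0)) =
   (fun h : R => h^-1 *: ((f \o shift x) (h *: v) - f x)).
  by apply/funext => h /=; rewrite addr0 scale0r add0r [h *: 1]mulr1.
by move=> [d1 d2]; split; [move: d1|move: d2]; rewrite /derivable /derive E.
Qed.

Lemma is_derive_flat_coord n (c b : R) j i x :
  is_derive x (basis3 R i) (fun x => flat n (c * coord j x + b))
    (c * (i == j)%:R * (flat n.+2 (c * coord j x + b) - n%:R * flat n.+1 (c * coord j x + b))).
Proof.
apply: is_derive_of_slice.
pose a := c * (i == j)%:R; pose b' := c * coord j x + b.
have -> : (fun s : R => flat n (c * coord j (s *: basis3 R i + x) + b)) =
    flat n \o (fun s : R => a * s + b').
  by apply/funext => s /=; rewrite coord_line /a /b'; congr flat; ring.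
have d : is_derive (0 : R) 1 (fun s : R => a * s + b') a.
  have := is_deriveD (is_deriveZ a (is_derive_id (0 : R) 1)) (is_derive_cst b' (0 : R) 1).
  by rewrite addr0 [a%:A]mulr1.
have := @is_derive1_comp R (flat n) (fun s => a * s + b') 0 _ _ (is_derive_flat n (a * 0 + b')) d.
by rewrite mulr0 add0r mulrC.
Qed.

Lemma smooth_flat_coord n (c b : R) j : smooth (fun x : R3 => flat n (c * coord j x + b)).
Proof.
move=> k; elim: k n => [|k IH] n.
  split => // x; apply: (@continuous_comp _ _ _ (fun x => c * coord j x + b) (flat n)).
    by apply: cvgD; [apply: cvgM; [exact: cvg_cst|exact: coord_continuous]|exact: cvg_cst].
  exact: flat_continuous.
split; first exact: classC_continuous (IH n).
move=> i; split; first by move=> x; have [] := is_derive_flat_coord n c b j i x.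
have -> : partial i (fun x => flat n (c * coord j x + b)) = (fun x =>
    c * (i == j)%:R * (flat n.+2 (c * coord j x + b) + - n%:R * flat n.+1 (c * coord j x + b))).
  by apply/funext => x; have [_] := is_derive_flat_coord n c b j i x; rewrite mulNr.
apply: classCM; first exact: classC_cst.
by apply: classCD => //; apply: classCM => //; exact: classC_cst.
Qed.

(** There is no plateau: inside the box each factor is [expR (- (m%:R * s)^-1)], with [s] the
    distance to a face, and tends to 1 as [m] grows, while the support stays in the closed box. *)
Definition bump (a b : R3) (m : nat) (x : R3) : R :=
  \prod_(j < 3) (flat 0 (m%:R * coord j x + - (m%:R * coord j a)) *
                 flat 0 (- m%:R * coord j x + m%:R * coord j b)).

Definition obox (a b : R3) : set R3 := [set x | forall j, coord j a < coord j x < coord j b].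
Definition cbox (a b : R3) : set R3 := [set x | forall j, coord j a <= coord j x <= coord j b].

Lemma flat0_le1 t : flat 0 t <= 1.
Proof.
rewrite /flat; case: ifP => // t0; rewrite expr0 mul1r -[leRHS]expR0 ler_expR oppr_le0.
by rewrite invr_ge0 ltW.
Qed.

Lemma bump_range a b m x : 0 <= bump a b m x <= 1.
Proof.
rewrite /bump; apply: (big_ind (fun z => 0 <= z <= 1)); first by rewrite ler01 lexx.
  by move=> u v /andP[? ?] /andP[? ?]; rewrite mulr_ge0//= mulr_ile1.
by move=> j _; rewrite mulr_ge0 ?flat_ge0//= mulr_ile1 ?flat_ge0 ?flat0_le1.
Qed.

Lemma bump_out a b m x : ~ obox a b x -> bump a b m x = 0.
Proof.
move=> /existsNP[j hj]; rewrite /bump (bigD1 j)//=.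
have -> : flat 0 (m%:R * coord j x + - (m%:R * coord j a)) *
    flat 0 (- m%:R * coord j x + m%:R * coord j b) = 0; last by rewrite mul0r.
have m0 : 0 <= m%:R :> R by [].
move/negP: hj; rewrite negb_and -!leNgt => /orP[h|h].
  rewrite {1}/flat ifF ?mul0r//; apply/negbTE; rewrite -leNgt -mulrBr.
  by rewrite mulr_ge0_le0// subr_le0.
rewrite [X in _ * X]/flat ifF ?mulr0//; apply/negbTE; rewrite -leNgt mulNr addrC -mulrBr.
by rewrite mulr_ge0_le0// subr_le0.
Qed.

Lemma flat0_cvg t : 0 < t -> flat 0 (m%:R * t) @[m --> \oo] --> (1 : R).
Proof.
move=> t0; apply: (@squeeze_cvgr _ _ _ _ (fun m => 1 - (m%:R * t)^-1) (fun=> 1)).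
- near=> m; rewrite flat0_le1 andbT.
  have m0 : 0 < m%:R * t by rewrite mulr_gt0// ltr0n; near: m; exact: nbhs_infty_gt.
  rewrite /flat m0 expr0 mul1r; exact: expR_ge1Dx.
- rewrite -[X in _ --> X]subr0; apply: cvgB; first exact: cvg_cst.
  rewrite -(mul0r t^-1); under eq_fun do rewrite invfM.
  apply: cvgMr_tmp; apply/gtr0_cvgV0; last exact: cvgr_idn.
  near=> m; rewrite ltr0n; near: m; exact: nbhs_infty_gt.
- exact: cvg_cst.
Unshelve. all: by end_near. Qed.

Lemma bump_cvg a b x : bump a b m x @[m --> \oo] --> (\1_(obox a b) x : R).
Proof.
rewrite indicE; have [hx|nx] := pselect (obox a b x); last first.
  rewrite memNset//; under eq_fun do rewrite bump_out//; exact: cvg_cst.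
have H j : flat 0 (m%:R * coord j x + - (m%:R * coord j a)) *
    flat 0 (- m%:R * coord j x + m%:R * coord j b) @[m --> \oo] --> (1 * 1 : R).
  have /andP[h1 h2] := hx j; apply: cvgM.
    under eq_fun do rewrite -mulrBr; apply: flat0_cvg; lra.
  under eq_fun do rewrite mulNr addrC -mulrBr; apply: flat0_cvg; lra.
rewrite mem_set//= /bump.
under eq_fun do rewrite !big_ord_recl big_ord0.
have := cvgM (H ord0) (cvgM (H (lift ord0 ord0)) (cvgM (H (lift ord0 (lift ord0 ord0)))
  (@cvg_cst R^o (1 : R) nat \oo _))).
rewrite !mulr1 => h.
exact: h.
Qed.

Lemma cbox_compact a b : compact (cbox a b).
Proof.
have -> : cbox a b = (`[a.1.1, b.1.1] `*` `[a.1.2, b.1.2]) `*` `[a.2, b.2].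
  apply/seteqP; split => [x h|x [[/= h1 h2] h3] j].
    have c1 (y : R3) : coord (inord 1) y = y.1.2 by rewrite /coord /= inordK.
    have c2 (y : R3) : coord (inord 2) y = y.2 by rewrite /coord /= inordK.
    have h0 := h ord0; have h1 := h (inord 1); have h2 := h (inord 2).
    by rewrite !c1 in h1; rewrite !c2 in h2; split; [split|]; rewrite /= in_itv.
  by rewrite /coord; case: j => [[|[|[|m]]] lt] //=; rewrite in_itv in h1 h2 h3.
by apply: compact_setX; [apply: compact_setX|]; exact: segment_compact.
Qed.

Lemma bump_tst (G : set R3) a b m : cbox a b `<=` G -> tst G (bump a b m).
Proof.
move=> sub; split.
  rewrite /bump; under [X in smooth X]eq_fun do rewrite !big_ord_recl big_ord0.
  by do 3 (apply: smoothM; first by apply: smoothM; exact: smooth_flat_coord);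
    exact: smooth_cst.
exists (cbox a b) => //; split; first exact: cbox_compact.
move=> x nx; apply: bump_out => ox; apply: nx => j.
by have /andP[? ?] := ox j; rewrite !ltW.
Qed.

End Bump.

(** * Vanishing of integrals over a generated sigma-algebra *)

Section Dynkin.
Context d (S : measurableType d) (R : realType) (mu : {measure set S -> \bar R}).
Variable f : S -> R.
Hypothesis intf : mu.-integrable setT (EFin \o f).

Let N (X : set S) : R := \int[mu]_(x in X) f x.

Let sub X : measurable X -> mu.-integrable X (EFin \o f).
Proof. by move=> mX; apply: integrableS intf. Qed.

Let Nind X : measurable X -> N X = \int[mu]_x (\1_X x * f x).
Proof.
move=> mX; rewrite /N Rintegral_mkcond; apply: eq_Rintegral => x _.
by rewrite patch_indic mulrC.
Qed.

Let mf : measurable_fun setT f.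
Proof. by apply/measurable_EFinP; exact: (measurable_int _ intf). Qed.

Let intind X : measurable X -> mu.-integrable setT (EFin \o (fun x => \1_X x * f x)).
Proof.
move=> mX; apply: le_integrable intf => //.
  by apply/measurable_EFinP; apply: measurable_funM => //; exact: measurable_indic.
move=> x _ /=; rewrite lee_fin normrM indicE; case: (x \in X); rewrite ?normr1 ?mul1r//.
by rewrite normr0 mul0r.
Qed.

Let ND X Y : measurable X -> measurable Y -> Y `<=` X -> N (X `\` Y) = N X - N Y.
Proof.
move=> mX mY YX; rewrite !Nind//; last exact: measurableD.
rewrite -RintegralB//; [|exact: intind|exact: intind].
apply: eq_Rintegral => x _; rewrite -mulrBl !indicE in_setD.
case: (boolP (x \in Y)) => xY; last by rewrite andbT subr0.
have -> : x \in X by rewrite inE; apply: YX; rewrite inE in xY.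
by rewrite subrr.
Qed.

(** The signed set function is continuous along increasing unions by dominated convergence. Working
    with one projection [p] lets a product sigma-algebra be reached one coordinate at a time. *)
Lemma dynkin_integral0 d' (T : measurableType d') (p : S -> T) (E : set S)
    (G : set (set T)) : measurable_fun setT p -> measurable E -> setI_closed G ->
  measurable = <<s G >> -> N E = 0 -> (forall Y, G Y -> N (E `&` p @^-1` Y) = 0) ->
  forall Y, measurable Y -> N (E `&` p @^-1` Y) = 0.
Proof.
move=> mp mE GI Gm E0 G0.
have mpre Y : measurable Y -> measurable (E `&` p @^-1` Y).
  by move=> mY; apply: measurableI => //; rewrite -[X in measurable X]setTI; exact: mp.
pose H : set (set T) := [set Y | measurable Y /\ N (E `&` p @^-1` Y) = 0].
suff : <<s G >> `<=` H by move=> GH Y; rewrite Gm => /GH[].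
apply: lambda_system_subset => //; last first.
  by move=> Y GY; split; [rewrite Gm; exact: sub_sigma_algebra|exact: G0].
split => //.
- by split; [exact: measurableT|rewrite preimage_setT setIT].
- move=> A B BA [mA A0] [mB B0]; split; first exact: measurableD.
  have -> : E `&` p @^-1` (A `\` B) = (E `&` p @^-1` A) `\` (E `&` p @^-1` B).
    apply/seteqP; split => x /=; [move=> [Ex [Ax nB]]|move=> [[Ex Ax] nB]].
      by split => // -[_ ?].
    by split => //; split => // Bx; apply: nB.
  rewrite ND ?A0 ?B0 ?subrr//; try exact: mpre.
  by apply: setIS; exact: preimage_subset.
move=> F ndF hF.
have mU : measurable (\bigcup_i F i) by apply: bigcup_measurable => i _; have [] := hF i.
split => //.
pose X i := E `&` p @^-1` F i; pose U := E `&` p @^-1` (\bigcup_i F i).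
have mX i : measurable (X i) by apply: mpre; have [] := hF i.
have mU' : measurable U by exact: mpre.
have cv : {ae mu, forall x, setT x -> (\1_(X i) x * f x)%:E @[i --> \oo] --> (\1_U x * f x)%:E}.
  apply: aeW => x _; apply: cvg_near_cst.
  have [[Ex [i _ Fi]]|nU] := pselect (U x).
    near=> j; congr (_ * _)%:E; rewrite !indicE !mem_set//.
      by split => //; exists i.
    split => //=; have /ndF/subsetPset : (i <= j)%N by near: j; exact: nbhs_infty_ge.
    exact.
  near=> j; congr (_ * _)%:E; rewrite !indicE !memNset//.
  by move=> [Ex Fj]; apply: nU; split => //; exists j.
have [|||_ _ lim] := dominated_convergence (@measurableT _ S) _ _ cv (integrable_norm intf) _.
- by move=> i; exact: (measurable_int _ (intind (mX i))).
- exact: (measurable_int _ (intind mU')).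
- apply: aeW => x i _; rewrite lee_fin normrM indicE; case: (x \in X i); rewrite ?normr1 ?mul1r//.
  by rewrite normr0 mul0r normr_ge0.
have E1 i : (\int[mu]_x (\1_(X i) x * f x)%:E = 0)%E.
  have [_] := hF i; rewrite Nind//; last exact: mX.
  rewrite /Rintegral => h; rewrite -(fineK (integrable_fin_num (@measurableT _ S) (intind (mX i)))).
  by rewrite h.
rewrite Nind// /Rintegral.
have -> : (\int[mu]_x (\1_U x * f x)%:E = 0)%E; last by [].
apply: (cvg_unique _ lim) => //.
by apply: cvg_near_cst; apply: nearW => i; exact: E1.
Unshelve. all: by end_near. Qed.

End Dynkin.

(** * Functions orthogonal to all test functions *)

Section DensityOfTests.
Variable R : realType.
Notation R3 := (R * R * R)%type.
Notation mR := (measurableTypeR R).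
Notation mR3 := (mR * mR * mR)%type.
Notation mu3 := (@leb3 R).
Variable G : set R3.
Hypothesis oG : open G.
Hypothesis Gfin : (mu3 G < +oo)%E.
Let mG : measurable (G : set mR3) := open_measurable3 oG.
Variable h : mR3 -> R.
Hypothesis hh : sqint mu3 (G : set mR3) h.
Hypothesis h0 : forall f, tst G f -> ipi mu3 (G : set mR3) h f = 0.

Lemma obox_measurable (a b : R3) : measurable (obox a b : set mR3).
Proof.
have -> : obox a b = ([set` `]a.1.1, b.1.1[] `*` [set` `]a.1.2, b.1.2[]) `*` [set` `]a.2, b.2[].
  apply/seteqP; split => [x H|x [[/= h1 h2] h3] j].
    have c1 (y : R3) : coord (inord 1) y = y.1.2 by rewrite /coord /= inordK.
    have c2 (y : R3) : coord (inord 2) y = y.2 by rewrite /coord /= inordK.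
    have h0' := H ord0; have h1 := H (inord 1); have h2 := H (inord 2).
    by rewrite !c1 in h1; rewrite !c2 in h2; split; [split|]; rewrite /= in_itv.
  by rewrite /coord; case: j => [[|[|[|m]]] lt] //=; rewrite in_itv in h1 h2 h3.
by apply: measurableX; [apply: measurableX|]; exact: measurable_itv.
Qed.

Lemma integral_obox0 a b : cbox a b `<=` G -> \int[mu3]_(x in (obox a b : set mR3)) h x = 0.
Proof.
move=> abG; have mO := obox_measurable a b.
have OG : obox a b `<=` G.
  by move=> x ox; apply: abG => j; have /andP[? ?] := ox j; rewrite !ltW.
rewrite -(ipi_indic h mO OG) ipiC.
have ih := sqint_integrable mG Gfin hh.
have cv : {ae mu3, forall x, G x -> (h x * bump a b m x)%:E @[m --> \oo] --> (h x * \1_(obox a b) x)%:E}.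
  apply: aeW => x _; apply: cvg_EFin; first by near=> m.
  by apply: cvgMl_tmp; exact: bump_cvg.
have sb m := tst_sqint mG (bump_tst m abG).
have [|||_ _ lim] := dominated_convergence mG _ _ cv (integrable_norm ih) _.
- by move=> m; exact: (measurable_int _ (sqint_mul mG hh (sb m))).
- exact: (measurable_int _ (sqint_mul mG hh (indic_sqint mG Gfin mO))).
- apply: aeW => x m _; rewrite lee_fin normrM ler_piMr// ger0_norm.
    by have /andP[] := bump_range a b m x.
  by have /andP[] := bump_range a b m x.
rewrite /ipi /Rintegral.
have -> : (\int[mu3]_(x in (G : set mR3)) (h x * \1_(obox a b) x)%:E = 0)%E; last by [].
apply: (cvg_unique _ lim) => //.
have E m : (\int[mu3]_(x in (G : set mR3)) (h x * bump a b m x)%:E = 0)%E.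
  have := h0 (bump_tst m abG); rewrite /ipi /Rintegral => e.
  by rewrite -(fineK (integrable_fin_num mG (sqint_mul mG hh (sb m)))) e.
by apply: cvg_near_cst; apply: nearW => m; exact: E.
Unshelve. all: by end_near. Qed.

Let lo (y : R3) r : R3 := (y.1.1 - r, y.1.2 - r, y.2 - r).
Let up (y : R3) r : R3 := (y.1.1 + r, y.1.2 + r, y.2 + r).

Lemma coord1 (y : R3) : coord (inord 1) y = y.1.2. Proof. by rewrite /coord /= inordK. Qed.
Lemma coord2 (y : R3) : coord (inord 2) y = y.2. Proof. by rewrite /coord /= inordK. Qed.

Lemma oboxE (a b x : R3) : obox a b x <->
  [/\ a.1.1 < x.1.1 < b.1.1, a.1.2 < x.1.2 < b.1.2 & a.2 < x.2 < b.2].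
Proof.
split => [H|[h1 h2 h3] j].
  have h1 := H ord0; have h2 := H (inord 1); have h3 := H (inord 2).
  by rewrite !coord1 in h2; rewrite !coord2 in h3.
by rewrite /coord; case: j => [[|[|[|m]]] lt].
Qed.

(** Products of three rays meet the ball in open boxes. Rays are exchanged for arbitrary measurable
    sets axis by axis, and products of sets then generate the measurable sets of the plane and of
    space. *)
Lemma ball_integral0 (y : R3) r : 0 < r -> ball y (r + r) `<=` G ->
  forall X : set mR3, measurable X -> \int[mu3]_(x in (ball y r : set mR3) `&` X) h x = 0.
Proof.
move=> r0 BG X mX.
pose B : set mR3 := ball y r.
have mB : measurable B by exact: measurable_ball3.
have BsG : B `<=` G by move=> x xB; apply: BG; apply: le_ball xB; rewrite lerDl ltW.
pose f := (h \_ B) : mR3 -> R.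
have ih := sqint_integrable mG Gfin hh.
have if_ : mu3.-integrable setT (EFin \o f).
  have := integrableS mG mB BsG ih; move/(integrable_mkcond _ mB).1.
  by congr (integrable _ _ _); apply/funext => x; rewrite /f /= !patchE; case: ifP.
have NE (Y : set mR3) : measurable Y -> \int[mu3]_(x in Y) f x = \int[mu3]_(x in B `&` Y) h x.
  move=> mY; rewrite setIC Rintegral_mkcond [RHS]Rintegral_mkcond; congr (Rintegral _ _ _).
  by rewrite patch_setI.
pose N (Y : set mR3) := \int[mu3]_(x in Y) f x.
have Ncong Y Z : measurable Y -> measurable Z -> B `&` Y = B `&` Z -> N Z = 0 -> N Y = 0.
  by move=> mY mZ YZ; rewrite /N !NE// YZ.
have hB (x : R3) : B x <-> [/\ (lo y r).1.1 < x.1.1 < (up y r).1.1, (lo y r).1.2 < x.1.2 < (up y r).1.2 & (lo y r).2 < x.2 < (up y r).2].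
  by rewrite /B /lo /up ball3E /= !ltr_distlC.
pose ray (c : R) : set mR := [set` `]c, +oo[].
have mray c : measurable (ray c) by exact: measurable_itv.
pose box (X Y Z : set mR) : set mR3 := (X `*` Y) `*` Z.
have mbox X0 Y Z : measurable X0 -> measurable Y -> measurable Z -> measurable (box X0 Y Z).
  by move=> ? ? ?; apply: measurableX => //; exact: measurableX.
have base c1 c2 c3 : N (box (ray c1) (ray c2) (ray c3)) = 0.
  pose a : R3 := (Num.max c1 (lo y r).1.1, Num.max c2 (lo y r).1.2, Num.max c3 (lo y r).2).
  rewrite /N NE; last exact: mbox.
  have -> : B `&` box (ray c1) (ray c2) (ray c3) = obox a (up y r).
    apply/seteqP; split => x; rewrite /setI /= oboxE /box /ray /= !in_itv /= !andbT.
      by move=> [/hB[/andP[h1 ->] /andP[h2 ->] /andP[h3 ->]]] [[e1 e2] e3]; rewrite !gt_max h1 h2 h3 e1 e2 e3.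
    rewrite !gt_max => -[/andP[/andP[? ?] ?] /andP[/andP[? ?] ?] /andP[/andP[? ?] ?]].
    by split => //; apply/hB; split; apply/andP.
  apply: integral_obox0 => x bx; apply: BG.
  have ltD (u : R) : u - (r + r) < u - r by lra.
  have ltD' (u : R) : u + r < u + (r + r) by lra.
  have le3 (c u v : R) : Num.max c (u - r) <= v <= u + r -> `|u - v| < r + r.
    rewrite ge_max ltr_distlC => /andP[/andP[_ h1] h2].
    by rewrite (lt_le_trans (ltD u) h1) (le_lt_trans h2 (ltD' u)).
  have h1 := bx ord0; have h2 := bx (inord 1); have h3 := bx (inord 2).
  rewrite !coord1 in h2; rewrite !coord2 in h3.
  by apply/ball3E; split; [exact: le3 h1|exact: le3 h2|exact: le3 h3].
have rI : setI_closed (@RGenOInfty.G R).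
  move=> _ _ [c ->] [d ->]; exists (Num.max c d); apply/seteqP; split => x; rewrite /= !in_itv /= !andbT gt_max.
    by move=> [-> ->].
  by move=> /andP.
have rM : (measurable : set (set mR)) = <<s @RGenOInfty.G R >> by exact: RGenOInfty.measurableE.
have m11 : measurable_fun setT (fun x : mR3 => x.1.1 : mR) by exact: measurableT_comp.
have m12 : measurable_fun setT (fun x : mR3 => x.1.2 : mR) by exact: measurableT_comp.
have m2 : measurable_fun setT (fun x : mR3 => x.2 : mR) by exact: measurable_snd.
have step1 Y1 c2 c3 : measurable Y1 -> N (box Y1 (ray c2) (ray c3)) = 0.
  move=> m1.
  (* On the ball, the whole line and the ray starting at the lower face cannot be told apart. *)
  have E0 : N (box setT (ray c2) (ray c3)) = 0.
    apply: Ncong (base (lo y r).1.1 c2 c3); [exact: mbox|exact: mbox|].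
    apply/seteqP; split => x [xB [[e1 e2] e3]]; split => //; split => //; split => //.
    by have [/andP[? _] _ _] := (hB x).1 xB; rewrite /ray /= in_itv /= andbT.
  have := @dynkin_integral0 _ _ _ _ _ if_ _ _ _ _ _ m11 (mbox _ _ _ measurableT (mray c2) (mray c3)) rI rM E0.
  have BE Z : box setT (ray c2) (ray c3) `&` (fun x : mR3 => x.1.1) @^-1` Z = box Z (ray c2) (ray c3).
    by apply/seteqP; split => x /=; [move=> [[[_ e2] e3] e1]|move=> [[e1 e2] e3]].
  move=> D; rewrite -BE; apply: D => // Z [c ->]; rewrite BE; exact: base.
have step2 Y1 Y2 c3 : measurable Y1 -> measurable Y2 -> N (box Y1 Y2 (ray c3)) = 0.
  move=> m1 m2'.
  have E0 : N (box Y1 setT (ray c3)) = 0.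
    apply: Ncong (step1 Y1 (lo y r).1.2 c3 m1); [exact: mbox|exact: mbox|].
    apply/seteqP; split => x [xB [[e1 e2] e3]]; split => //; split => //; split => //.
    by have [_ /andP[? _] _] := (hB x).1 xB; rewrite /ray /= in_itv /= andbT.
  have := @dynkin_integral0 _ _ _ _ _ if_ _ _ _ _ _ m12 (mbox _ _ _ m1 measurableT (mray c3)) rI rM E0.
  have BE Z : box Y1 setT (ray c3) `&` (fun x : mR3 => x.1.2) @^-1` Z = box Y1 Z (ray c3).
    by apply/seteqP; split => x /=; [move=> [[[e2 _] e3] e1]|move=> [[e1 e2] e3]].
  by move=> D; rewrite -BE; apply: D => // Z [c ->]; rewrite BE; exact: step1.
have step3 Y1 Y2 Y3 : measurable Y1 -> measurable Y2 -> measurable Y3 -> N (box Y1 Y2 Y3) = 0.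
  move=> m1 m2' m3.
  have E0 : N (box Y1 Y2 setT) = 0.
    apply: Ncong (step2 Y1 Y2 (lo y r).2 m1 m2'); [exact: mbox|exact: mbox|].
    apply/seteqP; split => x [xB [[e1 e2] e3]]; split => //; split => //.
    by have [_ _ /andP[? _]] := (hB x).1 xB; rewrite /ray /= in_itv /= andbT.
  have := @dynkin_integral0 _ _ _ _ _ if_ _ _ _ _ _ m2 (mbox _ _ _ m1 m2' measurableT) rI rM E0.
  have BE Z : box Y1 Y2 setT `&` (fun x : mR3 => x.2) @^-1` Z = box Y1 Y2 Z.
    by apply/seteqP; split => x /=; [move=> [[[e2 e3] _] e1]|move=> [[e1 e2] e3]].
  by move=> D; rewrite -BE; apply: D => // Z [c ->]; rewrite BE; exact: step2.
have step4 (W : set (mR * mR)%type) Y3 : measurable W -> measurable Y3 -> N (W `*` Y3) = 0.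
  move=> mW m3.
  have E0 : N (setT `*` Y3) = 0.
    by have := step3 setT setT Y3 measurableT measurableT m3; rewrite /box setXTT.
  have := @dynkin_integral0 _ _ _ _ _ if_ _ _ (fst : mR3 -> (mR * mR)%type) _ _ measurable_fst (measurableX measurableT m3) _ (measurable_prod_measurableType _ _) E0.
  have BE Z : (setT `*` Y3) `&` (fst : mR3 -> (mR * mR)%type) @^-1` Z = Z `*` Y3.
    by apply/seteqP; split => x /=; [move=> [[_ e2] e3]|move=> [e1 e2]].
  move=> D; rewrite -BE; apply: D => //.
    move=> _ _ [A mA [A' mA' <-]] [C mC [C' mC' <-]].
    by exists (A `&` C); [exact: measurableI|exists (A' `&` C'); [exact: measurableI|rewrite setXI]].
  by move=> Z [A mA [A' mA' <-]]; rewrite BE; exact: step3.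
have E0 : N setT = 0.
  by have := step4 setT setT measurableT measurableT; rewrite setXTT.
have := @dynkin_integral0 _ _ _ _ _ if_ _ _ (id : mR3 -> mR3) _ _ (@measurable_id _ mR3 setT) measurableT _ (measurable_prod_measurableType _ _) E0.
rewrite -/B -NE// => D; rewrite -[X]setTI; apply: (D _ _ X mX).
  move=> _ _ [A mA [A' mA' <-]] [C mC [C' mC' <-]].
  by exists (A `&` C); [exact: measurableI|exists (A' `&` C'); [exact: measurableI|rewrite setXI]].
by move=> Z [A mA [A' mA' <-]]; rewrite setTI preimage_id; exact: step4.
Qed.

(** Countably many rational balls whose doubles lie in [G] cover [G], and [h] vanishes almost
    everywhere on each. *)
Lemma orth_tests_ae0 : {ae mu3, forall x, G x -> h x = 0}.
Proof.
have ih := sqint_integrable mG Gfin hh.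
pose P n := exists2 y, (exists2 r, 0 < r & @qball R n = ball y r /\ ball y (r + r) `<=` G) & True.
pose Bad n : set mR3 := [set x | [/\ P n, @qball R n x & h x <> 0]].
have negB n : mu3.-negligible (Bad n).
  have [[y [r r0 [qE BG]] _]|nP] := pselect (P n); last first.
    by apply: negligibleS (negligible_set0 mu3) => x [].
  pose B : set mR3 := ball y r.
  have mB : measurable B by exact: measurable_ball3.
  have BsG : B `<=` G by move=> x xB; apply: BG; apply: le_ball xB; rewrite lerDl ltW.
  have iB : mu3.-integrable B (EFin \o h) by exact: integrableS ih.
  have : ae_eq mu3 B (EFin \o h) (cst 0%E).
    apply: integral_ae_eq => //.
    move=> E EB mE; rewrite integral0.
    have := ball_integral0 r0 BG mE; rewrite setIidr// /Rintegral => e.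
    by rewrite -(fineK (integrable_fin_num mE (integrableS mB mE EB iB))) e.
  apply: negligibleS => x [_ qx hx] /=.
  by move=> H; apply: hx; move: H; rewrite /B -qE => /(_ qx)[].
have : mu3.-negligible (\bigcup_n Bad n) by exact: negligible_bigcup.
apply: negligibleS => x /= /not_implyP[Gx hx].
have [n qx [y [r [r0 qE BU]]]] := qball_basis oG Gx.
by exists n => //; split => //; exists y => //; exists r.
Qed.

Lemma orth_tests_eq0 : ipi mu3 (G : set mR3) h h = 0.
Proof.
rewrite /ipi /Rintegral.
have -> : (\int[mu3]_(x in (G : set mR3)) (h x * h x)%:E = \int[mu3]_(x in (G : set mR3)) (cst 0%E) x)%E.
  apply: ae_eq_integral => //.
  - exact: (measurable_int _ (sqint_mul mG hh hh)).
  - by case: orth_tests_ae0 => A [mA A0 AG]; exists A; split => // x /= H; apply: AG => /= H'; apply: H => Gx; rewrite (H' Gx) mul0r.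
by rewrite integral0.
Qed.

End DensityOfTests.

(** * Closures, orthogonality and duality *)

Section Closure.
Variables (R : realType) (V : lmodType R) (ip : V -> V -> R).
Hypothesis hip : hilbert ip.

Definition ipcl (S : V -> Prop) (x : V) : Prop :=
  forall e, 0 < e -> exists2 y, S y & ip (x - y) (x - y) < e.

Lemma sub_ipcl (S : V -> Prop) x : S x -> ipcl S x.
Proof. by move=> Sx e e0; exists x => //; rewrite subrr (ip0l hip). Qed.

Lemma ipcl_subspace S : subspace S -> subspace (ipcl S).
Proof.
move=> sS; split; first by apply: sub_ipcl; case: sS.
move=> a x y hx hy e e0.
have c0 : 0 < 2 * a ^+ 2 + 2 by have := sqr_ge0 a; lra.
have [x' Sx' hx'] := hx (e / (2 * a ^+ 2 + 2)) (divr_gt0 e0 c0).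
have [y' Sy' hy'] := hy (e / (2 * a ^+ 2 + 2)) (divr_gt0 e0 c0).
exists (a *: x' + y'); first exact: sS.2.
have -> : a *: x + y - (a *: x' + y') = a *: (x - x') + (y - y').
  by rewrite scalerBr opprD addrACA.
apply: (le_lt_trans (nsD_le hip _ _)); rewrite (nsZ hip).
set u := ip _ _ in hx' *; set v := ip _ _ in hy' *.
apply: (@le_lt_trans _ _ (2 * a ^+ 2 * (e / (2 * a ^+ 2 + 2)) + 2 * v)).
  by rewrite lerD2r mulrA; apply: ler_wpM2l (ltW hx'); rewrite mulr_ge0// sqr_ge0.
apply: (@lt_le_trans _ _ (2 * a ^+ 2 * (e / (2 * a ^+ 2 + 2)) + 2 * (e / (2 * a ^+ 2 + 2)))).
  by rewrite ltrD2l ltr_pM2l.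
by rewrite -mulrDl mulrCA divff ?mulr1// gt_eqF.
Qed.

Lemma ipcl_closed S : ip_closed ip (ipcl S).
Proof.
move=> x h e e0; have e4 : 0 < e / 4 by rewrite divr_gt0.
have [y hy yx] := h _ e4; have [z Sz zy] := hy _ e4; exists z => //.
apply: (le_lt_trans (nsB_le hip y _ _)); lra.
Qed.

Lemma ipcl_min S W : ip_closed ip W -> (forall x, S x -> W x) -> forall x, ipcl S x -> W x.
Proof. by move=> cW SW x h; apply: cW => e e0; have [y /SW Wy yx] := h e e0; exists y. Qed.

Lemma orth_closed (P : V -> Prop) : ip_closed ip (fun x => forall y, P y -> ip x y = 0).
Proof.
move=> x h y Py; apply: (@sqr_small _ (ip y y)) => e e0.
have [z hz zx] := h e e0.
have -> : ip x y = ip (x - z) y by rewrite (ipBl hip) hz// subr0.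
by apply: (le_trans (cauchy_schwarz hip _ _)); rewrite mulrC ler_wpM2l ?(ip_ge0 hip)// ltW.
Qed.

(** If [s] is within [e] of [x] in squared distance, the squared norm of [x] is below
    [e + 2 * ip x s - ip s s], and [2 * ip x s <= C + ip s s] by the arithmetic-geometric mean
    inequality. *)
Lemma ipcl_dual_bound (S : V -> Prop) x C : 0 <= C -> ipcl S x ->
  (forall s, S s -> ip x s ^+ 2 <= C * ip s s) -> ip x x <= C.
Proof.
move=> C0 clx h; rewrite -subr_le0; apply: (@le_small _ 1) => e e0; rewrite mul1r.
have [s Ss xs] := clx e e0; rewrite (nsB hip) in xs.
have hs := h s Ss; have s0 := ip_ge0 hip s.
have : 2 * ip x s <= C + ip s s.
  rewrite leNgt; apply/negP => lt; have p0 : 0 < C + ip s s + 2 * ip x s by lra.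
  have : 0 < (2 * ip x s - (C + ip s s)) * (C + ip s s + 2 * ip x s) by rewrite mulr_gt0// subr_gt0.
  have : 0 <= (C - ip s s) ^+ 2 by exact: sqr_ge0.
  by move: hs; clear; nra.
lra.
Qed.

Lemma dense_ipcl S x : subspace S ->
  (forall y, (forall s, S s -> ip y s = 0) -> ip y y = 0) -> ipcl S x.
Proof.
move=> sS dS e e0.
have [y hy xy] := projection hip (ipcl_subspace sS) (@ipcl_closed S) x.
have d0 : ip (x - y) (x - y) = 0 by apply: dS => s Ss; apply: xy; exact: sub_ipcl.
have [s Ss sy] := hy (e / 2) (divr_gt0 e0 (ltr0Sn _ _)); exists s => //.
by apply: (le_lt_trans (nsB_le hip y _ _)); rewrite d0; lra.
Qed.

End Closure.

Section DualBound.
Variable R : realType.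
Notation R3 := (R * R * R)%type.
Notation mR := (measurableTypeR R).
Notation mR3 := (mR * mR * mR)%type.
Notation mu3 := (@leb3 R).

Lemma ipi_tstl (G : set R3) f (g : mR3 -> R) : tst G f ->
  ipi mu3 (G : set mR3) f g = ipi mu3 (setT : set mR3) f g.
Proof.
by move=> [_ [K hK KG]]; exact: (Rintegral_csupp (csuppMr g hK) KG).
Qed.

(** Any decomposition may thus be performed on the smooth function [f] rather than on [h]. *)
Lemma tests_dual_bound (G : set R3) (h : mR3 -> R) C : open G -> (mu3 G < +oo)%E ->
  sqint mu3 (G : set mR3) h -> 0 <= C ->
  (forall f, tst G f -> ipi mu3 (G : set mR3) h f ^+ 2 <= C * nrm f) ->
  ipi mu3 (G : set mR3) h h <= C.
Proof.
move=> oG Gfin hh C0 H.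
have mG : measurable (G : set mR3) := open_measurable3 oG.
pose S (s : L2type mu3 mG) := exists2 f, tst G f & s = f :> (mR3 -> R).
have hip := L2_hilbert mu3 mG.
apply: (@ipcl_dual_bound _ _ _ hip S (toL2 mG hh)) => //; first apply: dense_ipcl => //.
- split; first by exists (fun=> 0) => //; exact: tst0.
  move=> a x y [f tf xf] [g tg yg]; exists (fun z => a * f z + g z).
    by apply: tstD => //; exact: tstZ.
  by apply/funext => z; rewrite -xf -yg.
- move=> y yS; apply: orth_tests_eq0 => //; first exact: L2typeP.
  by move=> f tf; exact: (yS (toL2 mG (tst_sqint mG tf)) (ex_intro2 _ _ f tf erefl)).
move=> s [f tf sf] /=; rewrite sf; apply: (le_trans (H f tf)).
by rewrite (ipi_tstl _ tf).
Qed.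

End DualBound.

(** * Rellich's theorem and gradients *)

Section Geometry.
Variable R : realType.
Notation R3 := (R * R * R)%type.
Implicit Types (G U : set R3) (x y : R3).

(* Moving [U `&` G] by [r A] along the axis [i] stays inside [G], and leaves
   room for two averages over boxes of side [r]. *)
Definition admissible G U (i : 'I_3) (A r : R) := forall y, U y -> G y ->
  (forall s, 0 <= s <= 1 -> G (y + (s * (r * A)) *: basis3 R i)) /\
  core3 r (core3 r G) (y + (r * A) *: basis3 R i).

Lemma norm_step (x q : R3) (i : 'I_3) (t r : R) : `|t| <= r ->
  `|x - (q + t *: basis3 R i)| <= `|x - q| + r.
Proof.
move=> tr; rewrite opprD addrA; apply: (le_trans (ler_normB _ _)); rewrite lerD2l normrZ.
apply: (le_trans _ tr); rewrite ler_piMr//; exact: norm_basis3.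
Qed.

(** The displacement lowers [phi] by at least [6 r L]. Two box averages amount to six further
    displacements of length at most [r], each raising [phi] by at most [r L]. *)
Lemma admissible_sublevel G (phi : R3 -> R) x (rho L A : R) i : 0 < rho -> 0 <= L ->
  smooth phi -> (forall y, `|x - y| < rho -> (G y <-> phi y < 0)) ->
  (forall y j, `|x - y| < rho -> `|partial j phi y| <= L) ->
  (forall y, `|x - y| < rho -> A * partial i phi y <= - (6 * L)) ->
  exists2 r0, 0 < r0 & forall r, 0 < r <= r0 -> admissible G (ball x (rho / 2)) i A r.
Proof.
move=> rho0 L0 sphi hG hL hA.
have M0 : 0 < `|A| + 6 by have := normr_ge0 A; lra.
(* The displacement and the six steps together then cover at most [rho / 2], the distance left from
   the smaller ball. *)
exists (rho / (2 * (`|A| + 6))); first by rewrite divr_gt0// mulr_gt0.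
move=> r /andP[r0]; rewrite ler_pdivlMr ?mulr_gt0// => rM y; rewrite -ball_normE /= => xy Gy.
have phiy : phi y < 0 by apply/hG => //; lra.
have rA : r * `|A| + r * 6 <= rho / 2 by lra.
have line s : 0 <= s <= 1 -> `|x - (y + (s * (r * A)) *: basis3 R i)| <= `|x - y| + r * `|A| /\
    phi (y + (s * (r * A)) *: basis3 R i) <= phi y - 6 * (s * r * L).
  move=> /andP[s0 s1].
  have nA : `|s * (r * A)| <= r * `|A|.
    by rewrite !normrM (ger0_norm s0) (gtr0_norm r0) ler_piMl// mulr_ge0// ltW.
  split; first exact: norm_step.
  have [c hc] := slice_mvt y i (s * (r * A)) sphi.
  set z := c *: basis3 R i + y; rewrite [_ *: basis3 R i + y]addrC => e.
  have hz : `|x - z| < rho.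
    rewrite /z [_ *: _ + _]addrC; apply: (le_lt_trans (norm_step _ _ _ (le_trans hc nA))).
    have := mulr_gt0 r0 (ltr0Sn R 5); lra.
  have := ler_wpM2l (mulr_ge0 s0 (ltW r0)) (hA z hz).
  set p := partial i phi z in e *; set u := phi (_ + _) in e *.
  have -> : u = phi y + s * (r * A) * p by rewrite -e; ring.
  by move: (phi y) => w; clear; lra.
(* Room for [m] more steps of length [r], both in the ball and below the zero level. *)
pose Good m q := `|x - q| + m%:R * r < rho /\ phi q + m%:R * r * L < 0.
have stp m q t j : Good m.+1 q -> 0 <= t <= r -> Good m (q - t *: basis3 R j).
  move=> [h1 h2] /andP[t0 tr]; rewrite -scaleNr.
  have nt : `|- t| <= r by rewrite normrN ger0_norm.
  have hs := norm_step x q j nt; rewrite -natr1 in h1 h2.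
  have mr : 0 <= m%:R * r by rewrite mulr_ge0// ltW.
  split; first by lra.
  have [c hc] := slice_mvt q j (- t) sphi.
  set z := c *: basis3 R j + q; rewrite [_ *: basis3 R j + q]addrC => e.
  have hz : `|x - z| < rho.
    by rewrite /z [_ *: _ + _]addrC; apply: (le_lt_trans (norm_step _ _ _ (le_trans hc nt))); lra.
  have : `|- t * partial j phi z| <= r * L.
    by rewrite normrM ler_pM//; exact: hL.
  rewrite -e => /(le_trans (ler_norm _)).
  set u := phi (_ + _); move: h2; rewrite mulrDl mul1r mulrDl.
  by move: (phi q) (m%:R * r * L) (r * L); clear => *; lra.
have fin q : Good 0 q -> G q by move=> []; rewrite !mul0r !addr0 => h1 h2; apply/hG.
split.
  move=> s hs; have [l1 l2] := line s hs; apply/hG; first by lra.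
  have /andP[s0 _] := hs; have := mulr_ge0 (mulr_ge0 s0 (ltW r0)) L0; lra.
have [l1 l2] := line 1 (introT andP (conj ler01 (lexx 1))).
rewrite !mul1r in l1 l2.
have g6 : Good 6%N (y + (r * A) *: basis3 R i) by split; lra.
move=> t0 h0 t1 h1 t2 h2 t3 h3 t4 h4 t5 h5.
exact: (fin _ (stp _ _ _ _ (stp _ _ _ _ (stp _ _ _ _ (stp _ _ _ _ (stp _ _ _ _ (stp _ _ _ _ g6 h0) h1) h2) h3) h4) h5)).
Qed.

Lemma admissible_domain G : smooth_bounded_domain G -> forall x, closure G x ->
  exists U i A r0, [/\ open U, U x, 0 < r0 & forall r, 0 < r <= r0 -> admissible G U i A r].
Proof.
move=> [_ oG _ _ bd] x clx.
suff [phi [rho [L [A [i [rho0 L0 sphi [hG hL hA]]]]]]] : exists phi rho L A i, [/\ 0 < rho, 0 <= L,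
    smooth phi & [/\ forall y, `|x - y| < rho -> (G y <-> phi y < 0),
    forall y j, `|x - y| < rho -> `|partial j phi y| <= L &
    forall y, `|x - y| < rho -> A * partial i phi y <= - (6 * L)]].
  have [r0 r00 h] := admissible_sublevel rho0 L0 sphi hG hL hA.
  exists (ball x (rho / 2)), i, A, r0; split => //; first exact: ball_open.
  by apply: ballxx; rewrite divr_gt0.
have [Gx|nGx] := pselect (G x).
  have /nbhs_ballP[rho /= rho0 hrho] : nbhs x G by exact: open_nbhs_nbhs.
  exists (fun=> -1), rho, 0, 0, ord0; split => //; first exact: smooth_cst.
  split => y.
  - by move=> h; split => // _; apply: hrho; rewrite -ball_normE.
  - by move=> j _; rewrite partial_cst normr0.
  - by move=> _; rewrite mul0r mulr0 oppr0.
have [|phi [sphi [i hi] hG]] := bd x.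
  by split => //; move/interior_subset.
pose d := partial i phi x.
pose L := 1 + `|partial ord0 phi x| + `|partial (inord 1) phi x| + `|partial (inord 2) phi x|.
have L0 : 0 < L by rewrite /L -!addrA ltr_pwDl// !addr_ge0.
have d0 : 0 < `|d| by rewrite normr_gt0.
(* Near [x] the derivative keeps the sign of [d] and has modulus at least half of [|d|], so 12
   yields the required 6; the sign makes [phi] decrease. *)
pose N := 12 * L / `|d|; pose sg := - Num.sg d.
have cp j : continuous (partial j phi) by exact: smooth_continuous (smooth_partial _ sphi).
have hLn : \forall y \near x, forall j, `|partial j phi y| <= L.
  have near1 j : \forall y \near x, `|partial j phi x - partial j phi y| < 1.
    by have /cvgr_dist_lt := cp j x; apply.
  have dom j : `|partial j phi x| <= L - 1.
    have aux (l a b c : R) : l = 1 + a + b + c -> 0 <= a -> 0 <= b -> 0 <= c ->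
        [/\ a <= l - 1, b <= l - 1 & c <= l - 1].
      by move=> -> *; split; lra.
    have [a1 a2 a3] := aux L _ _ _ erefl (normr_ge0 (partial ord0 phi x))
      (normr_ge0 (partial (inord 1) phi x)) (normr_ge0 (partial (inord 2) phi x)).
    move: a1 a2 a3; move: (L - 1) => l a1 a2 a3.
    by case: (ord3P j) => ->; [exact: a1|exact: a2|exact: a3].
  apply: filterS3 (near1 ord0) (near1 (inord 1)) (near1 (inord 2)) => y n0 n1 n2 j.
  have {n0 n1 n2} : `|partial j phi x - partial j phi y| < 1 by have [->|->|->] := ord3P j.
  move: (dom j); move: (partial j phi x) (partial j phi y) => u v h1 h2.
  by have := ler_distD u 0 v; rewrite !sub0r !normrN; lra.
have hAn : \forall y \near x, sg * N * partial i phi y <= - (6 * L).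
  have d20 : 0 < `|d| / 2 by rewrite divr_gt0.
  have /cvgr_dist_lt/(_ _ d20) := cp i x; apply: filterS => y; rewrite -/d.
  move: (partial i phi y) => v; rewrite /N.
  have dN : (12 * L / `|d|) * (`|d| / 2) = 6 * L by field; rewrite gt_eqF.
  rewrite -dN; have N0 : 0 <= 12 * L / `|d| by rewrite divr_ge0// mulr_ge0// ltW.
  move=> dv; rewrite -subr_ge0.
  have -> : - (12 * L / `|d| * (`|d| / 2)) - sg * (12 * L / `|d|) * v =
     12 * L / `|d| * (- (`|d| / 2) - sg * v) by ring.
  apply: mulr_ge0 => //; move: dv hi; rewrite -/d /sg.
  case: (ltrgt0P d) => // hd dv _.
    by rewrite gtr0_sg//; move: dv; rewrite ltr_norml => /andP[_ h]; lra.
  by rewrite ltr0_sg//; move: dv; rewrite ltr_norml => /andP[h _]; lra.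
have /nbhs_ballP[rho /= rho0 hrho] : nbhs x (fun y => [/\ (G y <-> phi y < 0),
   forall j, `|partial j phi y| <= L & sg * N * partial i phi y <= - (6 * L)]).
  by near=> y; split; near: y.
exists phi, rho, L, (sg * N), i; split => //; first exact: ltW.
by split => y; [|move=> j|] => h; have := hrho y; rewrite -ball_normE /= => /(_ h)[].
Unshelve. all: by end_near. Qed.

End Geometry.

(** * Local form of Rellich's theorem *)

Section LocalRellich.
Variable R : realType.
Notation R3 := (R * R * R)%type.
Notation mR := (measurableTypeR R).
Notation mR3 := (mR * mR * mR)%type.
Notation mu3 := (@leb3 R).

(** Squaring a sum of four terms costs 4; [A ^+ 2] comes from the translation and [16 = 8 + 8] from
    the two box decompositions. *)
Let rellich_arith (r A e S H N Gam u1 u2 u3 u4 : R) : 4 * (A ^+ 2 + 16) * r ^+ 2 <= e ->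
  0 <= Gam -> 0 <= H -> 0 <= N -> u1 ^+ 2 <= Gam * ((r * A) ^+ 2 * N) ->
  u2 ^+ 2 <= 8 * (r ^+ 2 * N * Gam) -> u3 ^+ 2 <= 8 * (r ^+ 2 * N * Gam) ->
  u4 ^+ 2 <= (e / 4 * H + S) * N ->
  (- u1 + u2 + u3 + u4) ^+ 2 <= (e * (H + Gam) + 4 * S) * N.
Proof.
move=> rM G0 H0 N0 b1 b2 b3 b4.
have sq4 (a b c d : R) : (- a + b + c + d) ^+ 2 <= 4 * (a ^+ 2 + b ^+ 2 + c ^+ 2 + d ^+ 2).
  have := sqr_ge0 (a + b); have := sqr_ge0 (a + c); have := sqr_ge0 (a + d).
  have := sqr_ge0 (b - c); have := sqr_ge0 (b - d); have := sqr_ge0 (c - d).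
  lra.
apply: (le_trans (sq4 _ _ _ _)).
have := ler_wpM2r (mulr_ge0 G0 N0) rM; rewrite exprMn in b1; lra.
Qed.

Definition wgrad (G : set R3) (h : mR3 -> R) (g : 'I_3 -> mR3 -> R) : Prop :=
  forall f, tst G f -> forall i,
    ipi mu3 (G : set mR3) h (partial i f) = - ipi mu3 (G : set mR3) (g i) f.

(** [f] minus its translate is the derivative of the integral of [f] over the segment travelled. The
    sign of the displacement decides the orientation of the segment and the sign of [P]. *)
Lemma translate_decomposition (G U : set R3) i (A r : R) f : admissible G U i A r ->
  tst (U `&` G) f -> exists P f0 : R3 -> R,
  [/\ tst G P, tst (core3 r (core3 r G)) f0, forall x, f x = f0 x + partial i P x,
      nrm P <= (r * A) ^+ 2 * nrm f & nrm f0 = nrm f].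
Proof.
move=> adm [sf [K hK KUG]]; set a := r * A.
have tf : tst setT f by split => //; exists K.
pose v := - (a *: basis3 R i); pose f0 (x : R3) := f (v + x).
have t0 : tst (core3 r (core3 r G)) f0.
  split; first exact: smooth_shift3.
  exists ((fun x : R3 => x - v) @` K); first exact: csupp_shift.
  by move=> _ [x /KUG[Ux Gx] <-]; rewrite /v opprK; exact: (adm x Ux Gx).2.
have n0 : nrm f0 = nrm f by apply: nrm_shift hK; exact: smooth_continuous.
have inG (x : R3) s : K x -> 0 <= s <= 1 -> G (x + (s * a) *: basis3 R i).
  by move=> /KUG[Ux Gx]; exact: (adm x Ux Gx).1.
have w1 (b c : R) : forall t : R, b <= t <= c -> `|0 * t + 1| <= 1.
  by move=> t _; rewrite mul0r add0r normr1.
have [a0|a0|a0] := ltrgt0P a.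
- exists (lineavg i (- a) 0 0 1 f), f0; split => //.
  + have aa : - a <= 0 by lra.
    apply: (tst_lineavg 0 1 aa sf hK) => x t Kx /andP[t1 t2].
    have := inG x (- t / a) Kx; rewrite divfK ?gt_eqF// scaleNr; apply.
    by rewrite divr_ge0 ?(ltW a0)// ?oppr_ge0//= ler_pdivrMr// mul1r; lra.
  + move=> x; rewrite (partial_lineavg _ _ _ _ _ tf); last lra.
    rewrite lineavg_ftc//; last lra.
    by rewrite !mul0r subr0 !add0r !mul1r scale0r add0r /f0 /v scaleNr addrCA subrr addr0.
  + have aa : - a <= 0 by lra.
    have := nrm_lineavg i aa tf (w1 _ _); by rewrite mul1r opprK add0r.
- exists (fun x => -1 * lineavg i 0 (- a) 0 1 f x), f0.
  have a00 : 0 <= - a by lra.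
  have tl : tst G (lineavg i 0 (- a) 0 1 f).
    apply: (tst_lineavg 0 1 a00 sf hK) => x t Kx /andP[t1 t2].
    have := inG x (- t / a) Kx; rewrite divfK ?lt_eqF// scaleNr; apply.
    by rewrite -mulrNN opprK -invrN divr_ge0//= ler_pdivrMr ?mul1r// oppr_gt0.
  split => //; first exact: tstZ.
  + move=> x; rewrite partialZ; last by move=> y; apply: smooth_derivable; have [] := tl.
    rewrite (partial_lineavg _ _ _ _ _ tf)// lineavg_ftc//; last lra.
    by rewrite !mul0r subr0 !add0r !mul1r scale0r add0r /f0 /v scaleNr mulN1r opprB addrC subrK.
  + have := nrm_lineavg i a00 tf (w1 _ _); rewrite mul1r subr0 sqrrN.
    suff -> : nrm (fun x => -1 * lineavg i 0 (- a) 0 1 f x) = nrm (lineavg i 0 (- a) 0 1 f) by [].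
    by apply: eq_Rintegral => x _; rewrite !mulN1r mulrNN.
- exists (fun=> 0), f0; split => //; first exact: tst0.
  + by move=> x; rewrite partial_cst addr0 /f0 /v a0 scale0r oppr0 add0r.
  + rewrite a0 expr0n mul0r /nrm /ipi; under eq_Rintegral do rewrite mulr0.
    by rewrite Rintegral_cst// mul0r.
Qed.

Section Fixed.
Variables (G : set R3).
Hypothesis mG : measurable (G : set mR3).
Hypothesis Gfin : (mu3 G < +oo)%E.
Hypothesis Gb : exists rho, G `<=` cube rho.
Notation ipG := (ipi mu3 (G : set mR3)).

Lemma ipi_nrm_le (h : mR3 -> R) f : sqint mu3 (G : set mR3) h -> tst G f ->
  ipG h f ^+ 2 <= ipG h h * nrm f.
Proof.
move=> hh tf; have sf := tst_sqint mG tf.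
apply: (le_trans (ipi_cauchy_schwarz mG hh sf)); rewrite ler_wpM2l//; first exact: ipi_ge0.
by rewrite (ipi_tstl _ tf).
Qed.

Lemma wgrad_bound h g (P : 'I_3 -> R3 -> R) c : wgrad G h g ->
  (forall i, sqint mu3 (G : set mR3) (g i)) ->
  (forall i, tst G (P i)) -> (forall i, nrm (P i) <= c) ->
  (\sum_i ipG h (partial i (P i))) ^+ 2 <= 8 * (c * \sum_i ipG (g i) (g i)).
Proof.
move=> hg sg tP nP; apply: (le_trans (sqr_sum_le _ _)).
rewrite /index_enum -enumT size_enum_ord -[2 ^+ 3]natrX /= ler_pM2l// mulr_sumr.
apply: ler_sum => i _; rewrite hg// sqrrN mulrC.
apply: (le_trans (ipi_nrm_le (sg i) (tP i))); rewrite ler_wpM2l//; exact: ipi_ge0.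
Qed.

Lemma ipiDr (h f f' : mR3 -> R) : sqint mu3 (G : set mR3) h -> sqint mu3 (G : set mR3) f ->
  sqint mu3 (G : set mR3) f' -> ipG h (fun x => f x + f' x) = ipG h f + ipG h f'.
Proof.
move=> hh hf hf'; rewrite ipiC -(@eq_ipi _ _ _ _ _ (fun x => 1 * f x + f' x) _ h)//.
  by rewrite (ipiZDl mG 1 hf hf' hh) mul1r !(ipiC _ _ h).
by move=> x _ /=; rewrite mul1r.
Qed.

Lemma ipi_sumr (h : mR3 -> R) (F : 'I_3 -> mR3 -> R) : sqint mu3 (G : set mR3) h ->
  (forall i, sqint mu3 (G : set mR3) (F i)) ->
  ipG h (fun x => \sum_i F i x) = \sum_i ipG h (F i).
Proof.
move=> hh hF; under [X in ipG _ X]eq_fun do rewrite !big_ord_recl big_ord0 addr0.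
by rewrite !big_ord_recl big_ord0 addr0 !ipiDr//; apply: sqintD.
Qed.

Lemma ipi_box r h f : 0 < r -> sqint mu3 (G : set mR3) h -> tst setT f ->
  ipG h f = \sum_i ipG h (partial i (boxpot r i f)) + ipG h (avg3 r f).
Proof.
move=> r0 hh tf; have tf' : tst (core3 r setT) f by rewrite core3T.
have tb i := tst_boxpot r0 i tf'; have ta := tst_avg3 r0 tf'.
rewrite -ipi_sumr//; last by move=> i; exact: tst_sqint (tst_partial i (tb i)).
rewrite -ipiDr//; last 2 first.
- exact: tst_sqint (tst_sum _ (fun i => tst_partial i (tb i))).
- exact: tst_sqint ta.
by apply: eq_ipi => // x _; rewrite /= (box_decomposition r0 x tf).
Qed.

(** The box decomposition is applied twice because only the double average is of finite rank up to a
    small error. Every other term is a derivative, which moves to [g] with a factor of order [r]. *)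
Lemma rellich_local (U : set R3) i A r0 : 0 < r0 ->
  (forall r, 0 < r <= r0 -> admissible G U i A r) -> forall e, 0 < e ->
  exists xs : seq (L2type mu3 mG), forall h g, sqint mu3 (G : set mR3) h ->
    (forall i, sqint mu3 (G : set mR3) (g i)) -> wgrad G h g ->
    forall f, tst (U `&` G) f ->
    ipG h f ^+ 2 <= (e * (ipG h h + \sum_i ipG (g i) (g i)) + \sum_(xi <- xs) ipG xi h ^+ 2) * nrm f.
Proof.
move=> r00 adm e e0.
pose M := 4 * (A ^+ 2 + 16); have M0 : 0 < M by rewrite /M; have := sqr_ge0 A; lra.
pose r := Num.min r0 (Num.min 1 (e / M)).
have r_gt0 : 0 < r by rewrite !lt_min r00 ltr01 divr_gt0.
have rr0 : 0 < r <= r0 by rewrite r_gt0 ge_min lexx.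
have r1 : r <= 1 by rewrite !ge_min lexx orbT.
have rM : M * r ^+ 2 <= e.
  have : r <= e / M by rewrite !ge_min lexx !orbT.
  rewrite ler_pdivlMr// mulrC; apply: le_trans; rewrite ler_wpM2l ?(ltW M0)//.
  by rewrite expr2 ler_piMl// ltW.
have e40 : 0 < e / 4 by rewrite divr_gt0.
have [xs hxs] := avg3_finite_rank mG Gfin r_gt0 e40 Gb.
(* The scalar 2 produces the factor 4 lost in squaring a sum of four terms. *)
exists (map (fun xi => 2 *: xi) xs) => h g hh hg wg f tf.
have [P [f0 [tP t0 fE nP n0]]] := translate_decomposition (adm r rr0) tf.
have tT (H : set R3) u : tst H u -> tst setT u by apply: tst_sub.
have t1 := tst_avg3 r_gt0 t0; have tb0 j := tst_boxpot r_gt0 j t0.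
have tb1 j := tst_boxpot r_gt0 j t1.
have c3 := core3_sub (ltW r_gt0).
have nb0 j : nrm (boxpot r j f0) <= r ^+ 2 * nrm f by rewrite -n0; exact: nrm_boxpot t0.
have n1 : nrm (avg3 r f0) <= nrm f by rewrite -n0; exact: nrm_avg3 t0.
have nb1 j : nrm (boxpot r j (avg3 r f0)) <= r ^+ 2 * nrm f.
  apply: (le_trans (nrm_boxpot r_gt0 _ t1)); rewrite ler_wpM2l//; exact: sqr_ge0.
have E : ipG h f = - ipG (g i) P + \sum_j ipG h (partial j (boxpot r j f0))
    + \sum_j ipG h (partial j (boxpot r j (avg3 r f0))) + ipG h (avg3 r (avg3 r f0)).
  rewrite -wg// -addrA -(ipi_box r_gt0 hh (tT _ _ t1)) -addrA -(ipi_box r_gt0 hh (tT _ _ t0)).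
  rewrite -ipiDr//; last 2 first.
  - exact: tst_sqint (tst_partial i tP).
  - exact: tst_sqint t0.
  by apply: eq_ipi => // x _; rewrite fE addrC.
have b1 := ipi_nrm_le (hg i) tP.
have b2 := wgrad_bound wg hg (fun j => tst_sub (c3 _) (tb0 j)) nb0.
have b3 := wgrad_bound wg hg tb1 nb1.
have b4 := hxs h f0 hh (tT _ _ t0).
have gi : ipG (g i) (g i) <= \sum_j ipG (g j) (g j).
  by rewrite (bigD1 i)//= lerDl sumr_ge0// => j _; exact: ipi_ge0.
have g0 : 0 <= ipG (g i) (g i) by exact: ipi_ge0.
have b1' : ipG (g i) P ^+ 2 <= (\sum_j ipG (g j) (g j)) * ((r * A) ^+ 2 * nrm f).
  apply: (le_trans b1); apply: ler_pM => //; exact: nrm_ge0.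
have -> : \sum_(xi <- map (fun xi => 2 *: xi) xs) ipG xi h ^+ 2 = 4 * \sum_(xi <- xs) ipG xi h ^+ 2.
  rewrite big_map mulr_sumr; apply: eq_bigr => xi _.
  by rewrite (ipZl (L2_hilbert mu3 mG) 2 xi (toL2 mG hh)) exprMn -natrX.
rewrite n0 in b4.
have hge := ipi_ge0 mu3 (G : set mR3) h; have ng := nrm_ge0 f.
rewrite E; exact: (rellich_arith rM (le_trans g0 gi) hge ng b1' b2 b3 b4).
Qed.

End Fixed.
End LocalRellich.

(** * Global form of Rellich's theorem and its spectral consequence *)

Section Rellich.
Variable R : realType.
Notation R3 := (R * R * R)%type.
Notation mR := (measurableTypeR R).
Notation mR3 := (mR * mR * mR)%type.
Notation mu3 := (@leb3 R).

Lemma bounded_cube (G : set R3) : bounded_set G -> exists rho, G `<=` cube rho.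
Proof.
move=> [M [_ hM]]; exists (`|M| + 1) => x Gx.
have /(_ _ Gx) : forall x, G x -> `|x| <= `|M| + 1.
  by apply: hM; have := ler_norm M; lra.
by rewrite /cube /= [`|x|]/(Num.max (Num.max `|x.1.1| `|x.1.2|) `|x.2|) !ge_max => /andP[/andP[]].
Qed.

Lemma cube_compact (r : R) : compact (cube r).
Proof. by rewrite cubeE; do 2 (apply: compact_setX; last exact: segment_compact); exact: segment_compact. Qed.

Lemma cube_fin (G : set R3) rho : measurable (G : set mR3) -> G `<=` cube rho -> (mu3 G < +oo)%E.
Proof.
move=> mG Gr; apply: le_lt_trans (leb3_cube rho).
by apply: le_measure => //; rewrite inE//; exact: measurable_cube.
Qed.

Lemma compact_closure3 (G : set R3) rho : G `<=` cube rho -> compact (closure G).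
Proof.
move=> Gr; apply: (subclosed_compact _ (@cube_compact rho)); first exact: closed_closure.
rewrite [X in _ `<=` X](closure_id _).1; first exact: closure_subset.
by apply: compact_closed; [exact: hausdorff3|exact: cube_compact].
Qed.

Section Fixed.
Variable (G : set R3).
Hypothesis mG : measurable (G : set mR3).
Notation ipG := (ipi mu3 (G : set mR3)).

(** Overlaps are simply counted several times, so no partition of unity is required. *)
Lemma ipi_cover (U : R3 -> set R3) (h : mR3 -> R) (cs : seq R3) :
  (forall x, x \in cs -> open (U x)) -> sqint mu3 (G : set mR3) h ->
  forall D : set mR3, measurable D -> D `<=` G ->
  (forall x, D x -> exists2 c, c \in cs & U c x) ->
  ipi mu3 D h h <= \sum_(c <- cs) ipi mu3 (U c `&` G : set mR3) h h.
Proof.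
move=> oU hh.
have sub (D : set mR3) : measurable D -> D `<=` G -> sqint mu3 D h.
  by move=> mD DG; split; [exact: measurable_funS hh.1|exact: integrableS hh.2].
elim: cs oU => [|c cs IH] oU D mD DG cov.
  rewrite big_nil (_ : D = set0); first by rewrite /ipi Rintegral_set0.
  by apply/seteqP; split => // x /cov[].
have mU : measurable (U c : set mR3) by apply: open_measurable3; apply: oU; rewrite mem_head.
have mDU := measurableI _ _ mD mU; have mDD := measurableD mD mU.
have E : D = (D `&` U c) `|` (D `\` U c) by rewrite setUIDK.
have -> : ipi mu3 D h h = ipi mu3 (D `&` U c) h h + ipi mu3 (D `\` U c) h h.
  rewrite [in LHS]E /ipi Rintegral_setU// -?E; first exact: sqint_mul (sub _ mD DG) (sub _ mD DG).
  by rewrite disj_set2E; apply/eqP; apply/seteqP; split => x // [[_ h1] [_ h2]].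
rewrite big_cons; apply: lerD.
  rewrite -lee_fin -!integral_sqr//; last 3 first.
  - by apply: measurableI.
  - by apply: sub; [exact: measurableI|move=> x []].
  - by apply: sub => // x [/DG].
  apply: ge0_subset_integral => //; first exact: measurableI.
  - have [m _] := sub (U c `&` G) (measurableI _ _ mU mG) (fun x h => h.2).
    by apply/measurable_EFinP; exact: measurable_funX.
  - by move=> x _; rewrite lee_fin sqr_ge0.
  - by move=> x [Dx Ux]; split => //; exact: DG.
apply: IH => //.
- by move=> x xs; apply: oU; rewrite inE xs orbT.
- by move=> x [/DG].
move=> x [Dx nU]; have [d] := cov x Dx; rewrite inE => /orP[/eqP->//|dcs] Ud.
by exists d.
Qed.

Hypothesis domG : smooth_bounded_domain G.
Notation L2G := (L2type mu3 mG).

(** On each piece [U c] of a finite cover of the closure, duality converts the local estimate of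
    pairings into one of norms; [e] is shared among the pieces. *)
Lemma rellich e : 0 < e -> exists xs : seq L2G, forall h g,
  sqint mu3 (G : set mR3) h -> (forall i, sqint mu3 (G : set mR3) (g i)) -> wgrad G h g ->
  ipG h h <= e * (ipG h h + \sum_i ipG (g i) (g i)) + \sum_(xi <- xs) ipG xi h ^+ 2.
Proof.
have [_ oG _ bG _] := domG; have Gb := bounded_cube bG; have [rho Gr] := Gb.
have Gfin := cube_fin mG Gr.
move=> e0.
have ex x : exists U : set R3, closure G x -> [/\ open U, U x & forall e, 0 < e ->
   exists xs : seq L2G, forall h g, sqint mu3 (G : set mR3) h ->
    (forall i, sqint mu3 (G : set mR3) (g i)) -> wgrad G h g ->
    ipi mu3 (U `&` G : set mR3) h h <=
      e * (ipG h h + \sum_i ipG (g i) (g i)) + \sum_(xi <- xs) ipG xi h ^+ 2].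
  have [cx|ncx] := pselect (closure G x); last by exists setT.
  have [U [i [A [r0 [oU Ux r00 adm]]]]] := admissible_domain domG cx.
  exists U => _; split => // d d0.
  have [xs hxs] := rellich_local mG Gfin Gb r00 adm d0; exists xs => h g hh hg wg.
  have oUG : open (U `&` G) by exact: openI.
  have UGG : U `&` G `<=` G by move=> y [].
  have mUG := open_measurable3 oUG.
  apply: tests_dual_bound => //.
  - by apply: (le_lt_trans _ Gfin); apply: le_measure => //; rewrite inE.
  - by split; [exact: measurable_funS hh.1|exact: integrableS hh.2].
  - rewrite addr_ge0 ?sumr_ge0// => [|? _]; last exact: sqr_ge0.
    by rewrite mulr_ge0 ?(ltW d0)// addr_ge0 ?ipi_ge0// sumr_ge0// => j _; exact: ipi_ge0.
  move=> f tf; have := hxs h g hh hg wg f tf.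
  have -> // : ipi mu3 (U `&` G : set mR3) h f = ipG h f.
  by rewrite ipiC (ipi_tstl _ tf) -(ipi_tstl _ (tst_sub UGG tf)) ipiC.
have [U hU] := choice ex.
have [|cs hcs] := @compact_seq_cover _ (closure G) U (compact_closure3 Gr).
  by move=> x /hU[].
pose cs' := [seq c <- cs | `[< closure G c >]].
pose n := (size cs').+1%:R : R; have n0 : 0 < n by rewrite ltr0n.
have ex2 c : exists xs : seq L2G, closure G c -> forall h g, sqint mu3 (G : set mR3) h ->
    (forall i, sqint mu3 (G : set mR3) (g i)) -> wgrad G h g ->
    ipi mu3 (U c `&` G : set mR3) h h <=
      e / n * (ipG h h + \sum_i ipG (g i) (g i)) + \sum_(xi <- xs) ipG xi h ^+ 2.
  have [cc|ncc] := pselect (closure G c); last by exists [::].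
  by have [_ _ /(_ _ (divr_gt0 e0 n0))[xs hxs]] := hU c cc; exists xs.
have [X hX] := choice ex2.
exists (flatten [seq X c | c <- cs']) => h g hh hg wg.
have oU x : x \in cs' -> open (U x).
  by rewrite mem_filter => /andP[/asboolP cx _]; have [] := hU x cx.
apply: (le_trans (ipi_cover oU hh mG (@subset_refl _ _) _)).
  move=> x Gx; have [c cc [clc Uc]] := hcs x (subset_closure Gx).
  by exists c => //; rewrite mem_filter cc andbT; apply/asboolP.
have E0 : 0 <= ipG h h + \sum_i ipG (g i) (g i).
  by rewrite addr_ge0 ?ipi_ge0// sumr_ge0// => j _; exact: ipi_ge0.
apply: (@le_trans _ _ (\sum_(c <- cs') (e / n * (ipG h h + \sum_i ipG (g i) (g i)) +
    \sum_(xi <- X c) ipG xi h ^+ 2))).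
  rewrite big_seq [leRHS]big_seq; apply: ler_sum => c.
  by rewrite mem_filter => /andP[/asboolP cc _]; exact: hX.
rewrite big_split /= big_flatten /= big_map lerD2r big_const_seq count_predT iter_addr_0.
rewrite -mulr_natr mulrAC ler_wpM2r// -mulrA ler_piMr ?(ltW e0)// mulrC ler_pdivrMr// mul1r.
by rewrite ler_nat.
Qed.

Let V4 : lmodType R := 'I_4 -> L2G.
Let ip4 (x y : V4) : R := @ipsum R L2G (fun f g : L2G => ipG f g) 'I_4 x y.
Let hip := L2_hilbert mu3 mG.
Let hip4 : hilbert ip4 := ipsum_hilbert 'I_4 hip.
Let vec (h : L2G) (g : 'I_3 -> L2G) : V4 := fun o => if unlift ord0 o is Some i then g i else h.
Let W (x : V4) := wgrad G (x ord0) (fun i => x (lift ord0 i)).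

Let ip4E (x y : V4) : ip4 x y = ipG (x ord0) (y ord0) + \sum_i ipG (x (lift ord0 i)) (y (lift ord0 i)).
Proof. by rewrite /ip4 /ipsum big_ord_recl. Qed.

Let ip4_vec (x : V4) h g : ip4 x (vec h g) = ipG (x ord0) h + \sum_i ipG (x (lift ord0 i)) (g i).
Proof.
rewrite ip4E /vec unlift_none; congr (_ + _); apply: eq_bigr => i _; by rewrite liftK.
Qed.

(** Orthogonality to these vectors is the weak gradient equation, so the graph [W] is an orthogonal
    complement and hence closed. *)
Let tvec f (tf : tst G f) (i : 'I_3) : V4 :=
  vec (toL2 mG (tst_sqint mG (tst_partial i tf)))
      (fun j => if j == i then toL2 mG (tst_sqint mG tf) else 0).

Let ip4_tvec x f (tf : tst G f) i :
  ip4 x (tvec tf i) = ipG (x ord0) (partial i f) + ipG (x (lift ord0 i)) f.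
Proof.
rewrite ip4_vec (bigD1 i)//= eqxx big1 ?addr0// => j /negPf ->.
by rewrite ipiC; exact: (ip0l hip).
Qed.

Let WE x : W x <-> forall f (tf : tst G f) i, ip4 x (tvec tf i) = 0.
Proof.
split=> [wx f tf i|wx f tf i]; first by rewrite ip4_tvec (wx f tf i) addNr.
by apply/eqP; rewrite -addr_eq0; apply/eqP; rewrite -(ip4_tvec x tf).
Qed.

(* The spectral theorem for [b((h, g), (h', g')) = (h, h')] on the graph of the
   gradient: an eigenvector for [k] satisfies [(g, g') = a (h, h')] with
   [a = 1 / k - 1], and [a = 0] forces [g = 0]. *)
Lemma gradients_spanned (r : 'I_3 -> L2G) :
  (forall (h : L2G) (g : 'I_3 -> L2G) a, a != 0 -> wgrad G h g -> 
     (forall (h' : L2G) (g' : 'I_3 -> L2G), wgrad G h' g' ->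
        \sum_i ipG (g i) (g' i) = a * ipG h h') -> \sum_i ipG (r i) (g i) = 0) ->
  forall (h : L2G) (g : 'I_3 -> L2G), wgrad G h g -> \sum_i ipG (r i) (g i) = 0.
Proof.
move=> hr.
have sW : subspace W.
  split; first by apply/WE => f tf i; exact: (ip0l hip4).
  move=> a x y /WE wx /WE wy; apply/WE => f tf i.
  by rewrite (ipDl hip4) (ipZl hip4) wx wy mulr0 addr0.
have cW : ip_closed ip4 W.
  move=> x hx; apply/WE => f tf i.
  apply: (@orth_closed _ _ _ hip4 (fun y => exists f (tf : tst G f) i, y = tvec tf i) x).
    move=> e e0; have [y /WE wy xy] := hx e e0; exists y => // _ [f' [tf' [i' ->]]]; exact: wy.
  by exists f, tf, i.
pose b (x y : V4) := ipG (x ord0) (y ord0).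
have bC x y : W x -> W y -> b x y = b y x by move=> _ _; exact: ipiC.
have bl a x y z : W x -> W y -> W z -> b (a *: x + y) z = a * b x z + b y z.
  by move=> _ _ _; rewrite /b (ipDl hip) (ipZl hip).
have b4 (x : V4) : ipG (x ord0) (x ord0) <= ip4 x x.
  by rewrite ip4E lerDl sumr_ge0// => i _; exact: ipi_ge0.
have bcpt e : 0 < e -> exists xs : seq V4, forall x y, W x -> W y ->
    b x y ^+ 2 <= (e * ip4 x x + \sum_(z <- xs) ip4 z x ^+ 2) * ip4 y y.
  move=> e0; have [xs hxs] := rellich e0.
  exists (map (fun xi => vec xi (fun=> 0)) xs) => x y wx wy.
  apply: (le_trans (cauchy_schwarz hip _ _)).
  apply: ler_pM => //; [exact: ipi_ge0|exact: ipi_ge0|].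
  have := hxs (x ord0) (fun i => x (lift ord0 i)) (L2typeP _) (fun i => L2typeP _) wx.
  rewrite -ip4E big_map; set u := (X in _ + X); set v := (X in _ -> _ <= _ + X).
  suff -> : u = v by [].
  apply: eq_bigr => xi _; rewrite (ipC hip4) ip4_vec big1 ?addr0 ?(ipiC _ _ xi)// => i _.
  by rewrite ipiC; exact: (ip0l hip).
pose x0 := vec 0 r.
have x0v y : ip4 x0 y = \sum_i ipG (r i) (y (lift ord0 i)).
  rewrite (ipC hip4) ip4_vec ipiC (ip0l hip) add0r; apply: eq_bigr => i _; exact: ipiC.
have [|y [wy yr by0]] := @spectral_orth _ _ _ hip4 W b sW cW bC bl bcpt x0.
  move=> x [wx [k k0 hk]]; rewrite x0v.
  pose a := k^-1 - 1.
  have ga (h' : L2G) (g' : 'I_3 -> L2G) : wgrad G h' g' ->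
     \sum_i ipG (x (lift ord0 i)) (g' i) = a * ipG (x ord0) h'.
    move=> wg; have wv : W (vec h' g').
      by move=> f tf i; rewrite /vec unlift_none liftK; exact: wg.
    have := hk _ wv; rewrite ip4_vec /b {1}/vec unlift_none /a.
    move: (\sum_i _) (ipG _ _) => S H e; apply: (mulfI k0).
    by rewrite mulrA mulrBr divff// mulr1 mulrBl mul1r {1}e; ring.
  have [a0|a0] := eqVneq a 0; last exact: (hr _ (fun i => x (lift ord0 i)) a a0 wx ga).
  apply: big1 => i _.
  have g0 : \sum_i ipG (x (lift ord0 i)) (x (lift ord0 i)) = 0.
    by rewrite (ga (x ord0) (fun i => x (lift ord0 i)))// a0 mul0r.
  rewrite ipiC; apply: (ns0_ip hip); apply/eqP.
  move/eqP: g0; rewrite psumr_eq0; last by move=> ? _; exact: ipi_ge0.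
  by move=> /allP/(_ i); rewrite mem_index_enum => /(_ isT).
(* The projection of [x0] on the graph has first component zero; so has its gradient, and [r] is
   orthogonal to every gradient. *)
have y00 : ipG (y ord0) (y ord0) = 0 by exact: by0 wy.
have [_ oG _ bG _] := domG; have [rho Gr] := bounded_cube bG.
have Gfin := cube_fin mG Gr.
have yi0 i : ipG (y (lift ord0 i)) (y (lift ord0 i)) = 0.
  apply: orth_tests_eq0 => //; first exact: L2typeP.
  move=> f tf; have := wy f tf i.
  rewrite (ns0_ip hip (toL2 mG (tst_sqint mG (tst_partial i tf))) y00) => /esym/eqP.
  by rewrite oppr_eq0 => /eqP.
move=> h g wg.
have wv : W (vec h g) by move=> f tf i; rewrite /vec unlift_none liftK; exact: wg.
have := yr _ wv; rewrite (ipBl hip4) (ipC hip4 y) => /eqP; rewrite subr_eq0 => /eqP.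
rewrite x0v; under eq_bigr do rewrite /vec liftK; move=> ->.
rewrite (ipC hip4) ip4_vec (ns0_ip hip _ y00) add0r big1// => i _; exact: (ns0_ip hip).
Qed.

End Fixed.
End Rellich.

(** * The curl *)

Section CurlBound.
Variable R : realType.
Notation R3 := (R * R * R)%type.
Notation mR := (measurableTypeR R).
Notation mR3 := (mR * mR * mR)%type.
Notation mu3 := (@leb3 R).
Implicit Types Phi : 'I_3 -> R3 -> R.

Definition rotf Phi (i : 'I_3) (x : R3) : R :=
  partial (i + 1) (Phi (i + 2%:R)) x - partial (i + 2%:R) (Phi (i + 1)) x.

Definition antis Phi (c i : 'I_3) (x : R3) : R := partial c (Phi i) x - partial i (Phi c) x.

Lemma ord3_cases (c i : 'I_3) : [\/ i = c, i = c + 1 | i = c + 2%:R].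
Proof.
case: c i => [[|[|[|m]]] hc] [[|[|[|n]]] hi] //;
  by [apply: Or31; apply: val_inj|apply: Or32; apply: val_inj|apply: Or33; apply: val_inj].
Qed.

Lemma ord3_add21 (c : 'I_3) : c + 2%:R + 1 = c.
Proof. by case: c => [[|[|[|m]]] hc] //; apply: val_inj. Qed.
Lemma ord3_add22 (c : 'I_3) : c + 2%:R + 2%:R = c + 1.
Proof. by case: c => [[|[|[|m]]] hc] //; apply: val_inj. Qed.
Lemma ord3_add11 (c : 'I_3) : c + 1 + 1 = c + 2%:R.
Proof. by case: c => [[|[|[|m]]] hc] //; apply: val_inj. Qed.
Lemma ord3_add12 (c : 'I_3) : c + 1 + 2%:R = c.
Proof. by case: c => [[|[|[|m]]] hc] //; apply: val_inj. Qed.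

Lemma nrmN (f : R3 -> R) : nrm (fun x => - f x) = nrm f.
Proof. by apply: eq_Rintegral => x _; rewrite mulrNN. Qed.

Lemma nrm_antis Phi c i : nrm (antis Phi c i) <= \sum_j nrm (rotf Phi j).
Proof.
have le1 j : nrm (rotf Phi j) <= \sum_j nrm (rotf Phi j).
  by rewrite (bigD1 j)//= lerDl sumr_ge0// => k _; exact: nrm_ge0.
have [->|->|->] := ord3_cases c i.
- apply: (@le_trans _ _ 0); last by apply: sumr_ge0 => j _; exact: nrm_ge0.
  rewrite /nrm /ipi /antis; under eq_Rintegral do rewrite subrr mulr0.
  by rewrite Rintegral_cst// mul0r.
- by apply: le_trans (le1 (c + 2%:R)); rewrite /rotf ord3_add21 ord3_add22.
apply: le_trans (le1 (c + 1)); rewrite /rotf ord3_add11 ord3_add12 -nrmN.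
by under [X in nrm X <= _]eq_fun do rewrite /antis opprB.
Qed.

Lemma tst_antis G Phi c i : (forall j, tst G (Phi j)) -> tst G (antis Phi c i).
Proof. by move=> h; apply: tstB; exact: tst_partial. Qed.

Lemma tst_rotf G Phi i : (forall j, tst G (Phi j)) -> tst G (rotf Phi i).
Proof. by move=> h; apply: tstB; exact: tst_partial. Qed.

Lemma partial_sum (F : 'I_3 -> R3 -> R) c : (forall j, smooth (F j)) ->
  partial c (fun x => \sum_i F i x) = (fun x => \sum_i partial c (F i) x).
Proof.
move=> sF; have d j x : derivable (F j) x (basis3 R c) by exact: smooth_derivable.
have E (H : 'I_3 -> R3 -> R) : (fun x => \sum_i H i x) =
    (fun x => H ord0 x + (H (lift ord0 ord0) x + H (lift ord0 (lift ord0 ord0)) x)).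
  by apply/funext => x; rewrite !big_ord_recl big_ord0 addr0.
rewrite !E partialD//; last by move=> x; exact: derivableD.
by rewrite partialD.
Qed.

Let sum3B (a b c : 'I_3 -> R) : (forall i, a i = b i - c i) ->
  \sum_i a i = \sum_i b i - \sum_i c i.
Proof. by move=> h; rewrite -sumrB; exact: eq_bigr. Qed.

(* The box decomposition of [Phi c], with [d_i Phi_c] rewritten as
   [d_c Phi_i - antis Phi c i]: up to a gradient and an average, [Phi] is
   controlled by its curl, with a factor [r]. *)
Lemma curl_decomposition r Phi c x : 0 < r -> (forall j, tst setT (Phi j)) ->
  Phi c x = partial c (fun x => \sum_i boxpot r i (Phi i) x) x
    - \sum_i boxpot r i (antis Phi c i) x + avg3 r (Phi c) x.
Proof.
move=> r0 tP.
have tb i : tst setT (boxpot r i (Phi i)).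
  by apply: tst_boxpot => //; rewrite core3T; exact: tP.
rewrite partial_sum; last by move=> j; have [] := tb j.
transitivity (\sum_i partial i (boxpot r i (Phi c)) x + avg3 r (Phi c) x).
  exact: box_decomposition.
congr (_ + _); apply: sum3B => i.
rewrite (partial_boxpot r0 i i (tP c)) (partial_boxpot r0 i c (tP i)).
have := boxpotB r0 i (tst_partial c (tP i)) (tst_partial i (tP c)).
by rewrite /antis => ->; rewrite subKr.
Qed.

Section Fixed.
Variables (G : set R3) (rho : R).
Hypothesis oG : open G.
Hypothesis Grho : G `<=` cube rho.
Let mG : measurable (G : set mR3) := open_measurable3 oG.
Notation ipG := (ipi mu3 (G : set mR3)).
Notation L2G := (L2type mu3 mG).
Let Gfin : (mu3 G < +oo)%E := cube_fin mG Grho.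

(** The functions [f] need not vanish at the boundary of [G], so this includes a vanishing normal
    component. *)
Definition solenoidal (w : 'I_3 -> mR3 -> R) : Prop :=
  forall f, tst setT f -> \sum_c ipG (w c) (partial c f) = 0.

Lemma ipiBr3 (h f f' : mR3 -> R) : sqint mu3 (G : set mR3) h -> sqint mu3 (G : set mR3) f ->
  sqint mu3 (G : set mR3) f' -> ipG h (fun x => f x - f' x) = ipG h f - ipG h f'.
Proof.
by move=> hh hf hf'; exact: (ipBr (L2_hilbert mu3 mG) (toL2 mG hh) (toL2 mG hf) (toL2 mG hf')).
Qed.

(** The gradient in [curl_decomposition] is that of a test function of the whole space, and [w] is
    orthogonal to it even if its support leaves [G]. *)
Lemma solenoidal_decomposition r (w : 'I_3 -> mR3 -> R) Phi : 0 < r ->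
  (forall i, sqint mu3 (G : set mR3) (w i)) -> solenoidal w -> (forall j, tst setT (Phi j)) ->
  \sum_c ipG (w c) (Phi c) = \sum_c ipG (w c) (avg3 r (Phi c))
    - \sum_c \sum_i ipG (w c) (boxpot r i (antis Phi c i)).
Proof.
move=> r0 hw sw tP.
have tT H u : tst H u -> tst setT u by apply: tst_sub.
have tb i f : tst setT f -> tst setT (boxpot r i f).
  by move=> tf; apply: tst_boxpot => //; rewrite core3T.
have ta f : tst setT f -> tst setT (avg3 r f).
  by move=> tf; apply: tst_avg3 => //; rewrite core3T.
have tpsi : tst setT (fun x => \sum_i boxpot r i (Phi i) x).
  by apply: tst_sum => i; exact: tb.
have tan c i : tst setT (antis Phi c i) by exact: tst_antis.
have sq f : tst setT f -> sqint mu3 (G : set mR3) f by exact: tst_sqint.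
transitivity (\sum_c ipG (w c) (Phi c) -
    \sum_c ipG (w c) (partial c (fun x => \sum_i boxpot r i (Phi i) x))).
  by rewrite (sw _ tpsi) subr0.
rewrite -!sumrB; apply: eq_bigr => c _.
rewrite -ipi_sumr//; last by move=> i; apply: sq; exact: tb.
have sS : sqint mu3 (G : set mR3) (fun x => \sum_i boxpot r i (antis Phi c i) x).
  by apply: sq; apply: tst_sum => i; exact: tb.
rewrite -(ipiBr3 (hw c) (sq _ (tP c)) (sq _ (tst_partial c tpsi))).
rewrite -(ipiBr3 (hw c) (sq _ (ta _ (tP c))) sS).
apply: eq_ipi => // x _ /=; rewrite (curl_decomposition c x r0 tP).
have aux (a b d : R) : a - b + d - a = d - b by ring.
exact: aux.
Qed.

Let tT (H : set R3) (f : R3 -> R) : tst H f -> tst setT f. Proof. exact: tst_sub. Qed.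

Let ta r (f : R3 -> R) : 0 < r -> tst setT f -> tst setT (avg3 r f).
Proof. by move=> r0 tf; apply: tst_avg3 => //; rewrite core3T. Qed.

Let tb r i (f : R3 -> R) : 0 < r -> tst setT f -> tst setT (boxpot r i f).
Proof. by move=> r0 tf; apply: tst_boxpot => //; rewrite core3T. Qed.

Let sq f : tst setT f -> sqint mu3 (G : set mR3) f.
Proof. exact: tst_sqint. Qed.

Lemma avg3B r (f g : R3 -> R) : 0 < r -> tst setT f -> tst setT g ->
  avg3 r (fun x => f x - g x) = (fun x => avg3 r f x - avg3 r g x).
Proof.
move=> r0 tf tg.
have c (H : set R3) (u : R3 -> R) : tst H u -> continuous u by move=> [+ _]; exact: smooth_continuous.
have t1 i (u : R3 -> R) : tst setT u -> tst setT (avg1 i r u) by exact: tstT_avg1.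
rewrite /avg3 {3}/avg1 lineavgB; [|exact: c tf|exact: c tg].
rewrite {2}/avg1 lineavgB; [|exact: c (t1 _ _ tf)|exact: c (t1 _ _ tg)].
by rewrite {1}/avg1 lineavgB; [|exact: c (t1 _ _ (t1 _ _ tf))|exact: c (t1 _ _ (t1 _ _ tg))].
Qed.

Lemma avg3_avg3B r (f g : R3 -> R) x : 0 < r -> tst setT f -> tst setT g ->
  avg3 r (avg3 r (fun x => f x - g x)) x = avg3 r (avg3 r f) x - avg3 r (avg3 r g) x.
Proof. by move=> r0 tf tg; rewrite avg3B// avg3B//; exact: ta. Qed.

Lemma antis_avg3 r Phi c i : 0 < r -> (forall j, tst setT (Phi j)) ->
  antis (fun j => avg3 r (Phi j)) c i = avg3 r (antis Phi c i).
Proof.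
move=> r0 tP; rewrite /antis avg3B//; try exact: tst_partial.
by rewrite (partial_avg3 r0 c (tP i)) (partial_avg3 r0 i (tP c)).
Qed.

Lemma ipi_nrmT_le (h : mR3 -> R) f : sqint mu3 (G : set mR3) h -> tst setT f ->
  ipG h f ^+ 2 <= ipG h h * nrm f.
Proof.
move=> hh tf; apply: (le_trans (ipi_cauchy_schwarz mG hh (sq tf))).
rewrite ler_wpM2l//; first exact: ipi_ge0.
have [sf [K hK _]] := tf; exact: ipi_le_nrm (smooth_continuous sf) hK.
Qed.

Let sum3_sq (F : 'I_3 -> R) : (\sum_i F i) ^+ 2 <= 8 * \sum_i F i ^+ 2.
Proof.
apply: (le_trans (sqr_sum_le _ _)).
by rewrite /index_enum -enumT size_enum_ord -[2 ^+ 3]natrX.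
Qed.

(** The constant is [192 = 8 * 8 * 3]: squaring each sum of three terms costs 8, and the inner bound
    is repeated three times. *)
Lemma double_sum_bound (w : 'I_3 -> mR3 -> R) (F : 'I_3 -> 'I_3 -> R3 -> R) k :
  (forall i, sqint mu3 (G : set mR3) (w i)) -> (forall c i, tst setT (F c i)) ->
  (forall c i, nrm (F c i) <= k) ->
  (\sum_c \sum_i ipG (w c) (F c i)) ^+ 2 <= 192 * (k * \sum_c ipG (w c) (w c)).
Proof.
move=> hw tF nF; apply: (le_trans (sum3_sq _)).
have -> : 192 * (k * \sum_c ipG (w c) (w c)) = 8 * \sum_c (24 * (k * ipG (w c) (w c))).
  by rewrite -!mulr_sumr [RHS]mulrA -natrM.
rewrite ler_pM2l//; apply: ler_sum => c _; apply: (le_trans (sum3_sq _)).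
have -> : 24 * (k * ipG (w c) (w c)) = 8 * \sum_(i < 3) (k * ipG (w c) (w c)).
  by rewrite sumr_const card_ord -[X in 8 * X]mulr_natl [RHS]mulrA -natrM.
rewrite ler_pM2l//; apply: ler_sum => i _.
apply: (le_trans (ipi_nrmT_le (hw c) (tF c i))); rewrite mulrC ler_wpM2r//; exact: ipi_ge0.
Qed.

(** Squaring a sum of three terms costs 3. Thus [24 * 48 = 3 * 2 * 192] accounts for [A] and [B],
    and [3 * 8 = 24] for [C], rounded up to the square 25. *)
Let curl_arith (r2 l2 e N S Xi A B C : R) : 0 < l2 -> 0 <= N -> 0 <= S -> 0 <= Xi ->
  24 * 48 * r2 <= e / 2 -> A ^+ 2 <= 192 * (r2 * N * S) -> B ^+ 2 <= 192 * (r2 * N * S) ->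
  C ^+ 2 <= 8 * (l2 * N * (e / (48 * l2) * S + Xi)) ->
  (C - B - A) ^+ 2 <= (e * S + 25 * l2 * Xi) * N.
Proof.
move=> l0 N0 S0 X0 hr hA hB.
have -> : l2 * N * (e / (48 * l2) * S + Xi) = N * S * e / 48 + l2 * (N * Xi).
  by field; rewrite gt_eqF.
move=> hC.
have := ler_wpM2r (mulr_ge0 N0 S0) hr.
have h1 := mulr_ge0 (ltW l0) (mulr_ge0 N0 X0).
have := sqr_ge0 (C + B); have := sqr_ge0 (C + A); have := sqr_ge0 (B - A).
lra.
Qed.

Let L : R := 2 * `|rho| + 1.
Let L0 : 0 < L. Proof. by rewrite /L; have := normr_ge0 rho; lra. Qed.

(* Integrating [d_0 Phi_c = d_c Phi_0 - antis Phi c 0] along a segment of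
   length [L] that leaves [G], so that its far end contributes nothing on [G]. *)
Lemma avg3_line_gradient r Phi : 0 < r -> (forall j, tst G (Phi j)) ->
  exists2 f, tst setT f & forall c x, G x ->
    avg3 r (avg3 r (Phi c)) x =
    avg3 r (avg3 r (lineavg ord0 0 L 0 1 (antis Phi c ord0))) x - partial c f x.
Proof.
move=> r0 tP; have tPT j := tT (tP j).
pose lam := lineavg ord0 0 L 0 1 (Phi ord0).
have tl f : tst setT f -> tst setT (lineavg ord0 0 L 0 1 f).
  by move=> [sf [K hK _]]; exact: (tst_lineavg 0 1 (ltW L0) sf hK).
have tlam : tst setT lam by exact: tl.
exists (avg3 r (avg3 r lam)); first exact: ta (ta _ _).
move=> c x Gx.
pose sh (y : R3) := Phi c (L *: basis3 R ord0 + y).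
pose H : set R3 := [set y | y.1.1 < - `|rho|].
have tsh : tst (core3 r (core3 r H)) sh.
  have [sP [K hK KG]] := tP c; split; first exact: smooth_shift3.
  exists ((fun x : R3 => x - L *: basis3 R ord0) @` K); first exact: csupp_shift.
  move=> _ [y /KG/Grho[y1 _ _] <-] t0 h0 t1 h1 t2 h2 t3 h3 t4 h4 t5 h5.
  rewrite /H /basis3 /= !inordK//= /GRing.scale /= !mulr0 !mulr1 !subr0 /L.
  have yr : y.1.1 <= `|rho| by rewrite (le_trans (ler_norm _))// (le_trans y1)// ler_norm.
  by have /andP[? _] := h0; have /andP[? _] := h3; lra.
have tshT := tT tsh.
have z0 : avg3 r (avg3 r sh) x = 0.
  have [_ [K [_ hK] KH]] := tst_avg3 r0 (tst_avg3 r0 tsh).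
  apply: hK => /KH; rewrite /H /=; have [x1 _ _] := Grho Gx.
  apply/negP; rewrite -leNgt; move: x1; rewrite ler_norml => /andP[x1 _].
  by apply: le_trans x1; rewrite lerN2 ler_norm.
have E : (fun y => lineavg ord0 0 L 0 1 (antis Phi c ord0) y - partial c lam y) =
         (fun y => Phi c y - sh y).
  apply/funext => y; rewrite /lam (partial_lineavg _ _ _ _ (ltW L0) (tP ord0)).
  have c1 : continuous (partial c (Phi ord0)).
    by apply: smooth_continuous; have [] := tst_partial c (tP ord0).
  have c2 : continuous (partial ord0 (Phi c)).
    by apply: smooth_continuous; have [] := tst_partial ord0 (tP c).
  have e1 := congr1 (fun f => f y) (@lineavgB R ord0 0 L 0 1 _ _ c1 c2).
  have e2 := @lineavg_ftc R ord0 0 L 0 1 (Phi c) y L0 (tP c).1.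
  have aux (a b d u v w : R) : u = a - b -> b = d - v - w -> w = 0 -> u - a = v - d.
    by move=> -> -> ->; ring.
  apply: (aux _ _ _ _ _ _ e1); first rewrite e2; first by rewrite scale0r add0r !mul0r !add0r !mul1r.
  by [].
have tlc : tst setT (lineavg ord0 0 L 0 1 (antis Phi c ord0)) by apply: tl; exact: tst_antis.
have e1 := avg3_avg3B x r0 tlc (tst_partial c tlam).
have e2 := avg3_avg3B x r0 (tPT c) tshT.
have e3 : avg3 r (avg3 r (partial c lam)) x = partial c (avg3 r (avg3 r lam)) x.
  by rewrite (partial_avg3 r0 c (ta r0 tlam)) (partial_avg3 r0 c tlam).
have e4 := congr1 (fun f => avg3 r (avg3 r f) x) E.
have aux (a b d u v w z : R) : u = a - b -> v = d - z -> u = v -> z = 0 -> b = w -> d = a - w.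
  by move=> -> -> h z00 <-; rewrite h z00 subr0.
exact: aux e1 e2 e4 z0 e3.
Qed.

(** [A] and [B] carry small factors, but [C] still contains [Phi] itself, which the right side does
    not control. Modulo a gradient it is replaced by line integrals of curl components, whose double
    averages are of finite rank up to a small error. *)
Lemma curl_bound e : 0 < e -> exists xs : seq ('I_3 -> L2G), forall (w : 'I_3 -> mR3 -> R) Phi,
  (forall i, sqint mu3 (G : set mR3) (w i)) -> solenoidal w -> (forall j, tst G (Phi j)) ->
  (\sum_c ipG (w c) (Phi c)) ^+ 2 <=
  (e * \sum_c ipG (w c) (w c) + \sum_(X <- xs) (\sum_c ipG (X c) (w c)) ^+ 2)
  * \sum_j nrm (rotf Phi j).
Proof.
move=> e0.
pose r := Num.min 1 (e / (48 * 48)).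
have r0 : 0 < r by rewrite lt_min ltr01 divr_gt0// mulr_gt0.
have r1 : 24 * 48 * r ^+ 2 <= e / 2.
  have h1 : r <= 1 by rewrite ge_min lexx.
  have h2 : r <= e / (48 * 48) by rewrite ge_min lexx orbT.
  have h3 : r ^+ 2 <= r by rewrite expr2 ler_piMl// ltW.
  lra.
have L2 : 0 < L ^+ 2 by rewrite exprn_gt0.
have e'0 : 0 < e / (48 * L ^+ 2) by rewrite divr_gt0// mulr_gt0.
have [xs hxs] := avg3_finite_rank mG Gfin r0 e'0 (ex_intro _ rho Grho).
(* The scale [5 * L] squares to the coefficient [25 * L ^+ 2] of [curl_arith]. *)
pose vec (xi : L2G) (c : 'I_3) : 'I_3 -> L2G := fun j => if j == c then (5 * L) *: xi else 0.
have hip := L2_hilbert mu3 mG.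
exists [seq vec xi c | xi <- xs, c <- enum 'I_3] => w Phi hw sw tP.
have tPT j := tT (tP j).
set N := \sum_j nrm _; set S := \sum_c ipG (w c) (w c).
have N0 : 0 <= N by apply: sumr_ge0 => j _; exact: nrm_ge0.
have S0 : 0 <= S by apply: sumr_ge0 => j _; exact: ipi_ge0.
rewrite big_allpairs_dep /=.
have -> : \sum_(xi <- xs) \sum_(c <- enum 'I_3) (\sum_j ipG (vec xi c j) (w j)) ^+ 2 =
    25 * L ^+ 2 * \sum_(xi <- xs) \sum_c ipG xi (w c) ^+ 2.
  rewrite mulr_sumr; apply: eq_bigr => xi _; rewrite mulr_sumr big_enum /=.
  apply: eq_bigr => c _; rewrite (bigD1 c)//= big1 ?addr0.
    rewrite /vec eqxx (ipZl hip (5 * L) xi (toL2 mG (hw c))) !exprMn -natrX //.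
  by move=> j /negPf jc; rewrite /vec jc; exact: (ip0l hip (toL2 mG (hw j))).
set Xi := \sum_(xi <- xs) _.
have Xi0 : 0 <= Xi by apply: sumr_ge0 => xi _; apply: sumr_ge0 => c _; exact: sqr_ge0.
pose C := \sum_c ipG (w c) (avg3 r (avg3 r (Phi c))).
pose A := \sum_c \sum_i ipG (w c) (boxpot r i (antis Phi c i)).
pose B := \sum_c \sum_i ipG (w c) (boxpot r i (antis (fun j => avg3 r (Phi j)) c i)).
have E : \sum_c ipG (w c) (Phi c) = C - B - A.
  rewrite (solenoidal_decomposition r0 hw sw tPT) -/A.
  by rewrite (solenoidal_decomposition r0 hw sw (fun j => ta r0 (tPT j))) -/B -/C.
have hA : A ^+ 2 <= 192 * (r ^+ 2 * N * S).
  apply: double_sum_bound => // c i; first exact: tb r0 (tst_antis _ _ tPT).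
  apply: (le_trans (nrm_boxpot r0 i (tst_antis c i tPT))); rewrite ler_wpM2l ?sqr_ge0//.
  exact: nrm_antis.
have hB : B ^+ 2 <= 192 * (r ^+ 2 * N * S).
  apply: double_sum_bound => // c i.
    by apply: tb => //; apply: tst_antis => j; exact: ta r0 (tPT j).
  rewrite antis_avg3//; apply: (le_trans (nrm_boxpot r0 i (ta r0 (tst_antis c i tPT)))).
  rewrite ler_wpM2l ?sqr_ge0//; apply: (le_trans (nrm_avg3 r0 (tst_antis c i tPT))).
  exact: nrm_antis.
have hC : C ^+ 2 <= 8 * (L ^+ 2 * N * (e / (48 * L ^+ 2) * S + Xi)).
  have [f tf hf] := avg3_line_gradient r0 tP.
  have tl c : tst setT (lineavg ord0 0 L 0 1 (antis Phi c ord0)).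
    have [sf [K hK _]] := tst_antis c ord0 tPT.
    exact: (tst_lineavg 0 1 (ltW L0) sf hK).
  have -> : C = \sum_c ipG (w c) (avg3 r (avg3 r (lineavg ord0 0 L 0 1 (antis Phi c ord0)))).
    transitivity (\sum_c ipG (w c) (avg3 r (avg3 r (lineavg ord0 0 L 0 1 (antis Phi c ord0)))) -
        \sum_c ipG (w c) (partial c f)); last by rewrite (sw f tf) subr0.
    rewrite -sumrB; apply: eq_bigr => c _.
    rewrite -(ipiBr3 (hw c) (sq (ta r0 (ta r0 (tl c)))) (sq (tst_partial c tf))).
    by apply: eq_ipi => // x /set_mem Gx; exact: hf.
  apply: (le_trans (sum3_sq _)); rewrite ler_pM2l//.
  have -> : L ^+ 2 * N * (e / (48 * L ^+ 2) * S + Xi) = \sum_c ((e / (48 * L ^+ 2) * ipG (w c) (w c) +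
      \sum_(xi <- xs) ipG xi (w c) ^+ 2) * (L ^+ 2 * N)).
    by rewrite -mulr_suml big_split /= -mulr_sumr mulrC /Xi exchange_big.
  apply: ler_sum => c _; apply: (le_trans (hxs _ _ (hw c) (tl c))).
  rewrite ler_wpM2l//.
    rewrite addr_ge0 ?sumr_ge0// => [|? _]; last exact: sqr_ge0.
    by rewrite mulr_ge0 ?ipi_ge0// ltW.
  have w1 (t : R) : 0 <= t <= L -> `|0 * t + 1| <= 1 by rewrite mul0r add0r normr1.
  apply: (le_trans (nrm_lineavg ord0 (ltW L0) (tst_antis c ord0 tPT) w1)).
  rewrite mul1r subr0 ler_wpM2l ?sqr_ge0//; exact: nrm_antis.
by rewrite E; exact: (curl_arith L2 N0 S0 Xi0 r1 hA hB hC).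
Qed.

End Fixed.
End CurlBound.

(** * The curl on the closure of the curls of test fields *)

Section CurlSpectral.
Variable R : realType.
Notation R3 := (R * R * R)%type.
Notation mR := (measurableTypeR R).
Notation mR3 := (mR * mR * mR)%type.
Notation mu3 := (@leb3 R).
Variables (G : set R3) (rho : R).
Hypothesis oG : open G.
Hypothesis Grho : G `<=` cube rho.
Let mG : measurable (G : set mR3) := open_measurable3 oG.
Notation ipG := (ipi mu3 (G : set mR3)).
Notation L2G := (L2type mu3 (open_measurable3 oG)).
Let Gfin : (mu3 G < +oo)%E := cube_fin mG Grho.
Let hip := L2_hilbert mu3 mG.

Let V3 : lmodType R := 'I_3 -> L2G.
Definition ip3 (x y : 'I_3 -> L2G) : R := @ipsum R L2G (fun f g : L2G => ipG f g) 'I_3 x y.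

Lemma hip3 : hilbert ip3. Proof. exact: (ipsum_hilbert 'I_3 hip). Qed.

Definition testv (Phi : 'I_3 -> R3 -> R) := forall j, tst G (Phi j).

(** Tested with whole fields, the curl is formally symmetric and moves to [Phi] without a change of
    sign. *)
Definition wrot (u w : 'I_3 -> mR3 -> R) : Prop := forall Phi, testv Phi ->
  \sum_i ipG (u i) (rotf Phi i) = \sum_i ipG (w i) (Phi i).

Definition rotS (x : 'I_3 -> L2G) : Prop :=
  exists2 Phi, testv Phi & forall i, x i = rotf Phi i :> (mR3 -> R).

(** The real form of [spaceV0], as shown by [curlcl_spaceV0] and [spaceV0_curlcl]. *)
Definition curlcl : ('I_3 -> L2G) -> Prop := @ipcl R V3 ip3 rotS.

Let tv Phi (t : testv Phi) : V3 := fun i => toL2 mG (tst_sqint mG (t i)).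
Let rv Phi (t : testv Phi) : V3 := fun i => toL2 mG (tst_sqint mG (tst_rotf i t)).

Let rotS_rv Phi (t : testv Phi) : rotS (rv t).
Proof. by exists Phi. Qed.

Let rotS_ip (x : V3) : rotS x -> exists Phi (t : testv Phi), forall y : V3, ip3 y x = ip3 y (rv t).
Proof.
move=> [Phi t e]; exists Phi, t => y; apply: eq_bigr => i _; apply: eq_ipi => // z _.
by rewrite e.
Qed.

Lemma rotS_subspace : @subspace R V3 rotS.
Proof.
split.
  exists (fun _ _ => 0); first by move=> j; exact: tst0.
  by move=> i; apply/funext => x; rewrite /rotf !partial_cst subr0.
move=> a x y [Phi t ex] [Psi t' ey].
exists (fun j z => a * Phi j z + Psi j z); first by move=> j; apply: tstD => //; exact: tstZ.
move=> i; apply/funext => z.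
transitivity (a * rotf Phi i z + rotf Psi i z); first by rewrite -ex -ey.
rewrite /rotf; have dP j c u : derivable (Phi j) u (basis3 R c) by apply: smooth_derivable; have [] := t j.
have dQ j c u : derivable (Psi j) u (basis3 R c) by apply: smooth_derivable; have [] := t' j.
have dZ j c u : derivable (fun z => a * Phi j z) u (basis3 R c) by apply: smooth_derivable; have [] := tstZ a (t j).
have E j c : partial c (fun z => a * Phi j z + Psi j z) z = a * partial c (Phi j) z + partial c (Psi j) z.
  by rewrite (partialD (dZ j c) (dQ j c)) (partialZ a (dP j c)).
rewrite !E; move: (partial _ _ _) (partial _ _ _) (partial _ _ _) (partial _ _ _) => a1 a2 a3 a4; ring.
Qed.

Lemma curlcl_subspace : @subspace R V3 curlcl.
Proof. exact: ipcl_subspace hip3 _ rotS_subspace. Qed.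

Lemma curlcl_closed : @ip_closed R V3 ip3 curlcl.
Proof. exact: ipcl_closed hip3 _. Qed.

Lemma curlcl_orth (y : V3) : (forall Phi (t : testv Phi), ip3 y (rv t) = 0) ->
  forall x, curlcl x -> ip3 y x = 0.
Proof.
move=> h x cx; rewrite (ipC hip3).
apply: (@ipcl_min _ V3 ip3 rotS (fun x => forall z, z = y -> ip3 x z = 0)) cx _ _ => //.
  exact: orth_closed hip3 _.
by move=> z /rotS_ip[Phi [t e]] _ ->; rewrite (ipC hip3) e.
Qed.

Lemma sum3_reindex (c d : 'I_3) (a b : 'I_3 -> R) : (forall j, a (j + c) = b (j + d)) ->
  \sum_i a i = \sum_i b i.
Proof.
move=> h; rewrite (reindex_inj (@addIr _ c)) [RHS](reindex_inj (@addIr _ d)) /=.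
by apply: eq_bigr => j _; exact: h.
Qed.

(** This is div rot = 0 for test fields: second derivatives commute and a cyclic shift of the
    indices cancels the terms. *)
Lemma rot_orth_grad h g Phi : wgrad G h g -> 
  sqint mu3 (G : set mR3) h -> (forall i, sqint mu3 (G : set mR3) (g i)) -> testv Phi ->
  \sum_i ipG (g i) (rotf Phi i) = 0.
Proof.
move=> wg hh hg t.
have E i : ipG (g i) (rotf Phi i) = ipG h (partial i (partial (i + 2%:R) (Phi (i + 1)))) -
    ipG h (partial i (partial (i + 1) (Phi (i + 2%:R)))).
  rewrite (ipiBr3 oG (hg i) (tst_sqint mG (tst_partial _ (t _))) (tst_sqint mG (tst_partial _ (t _)))).
  have e1 := wg _ (tst_partial (i + 1) (t (i + 2%:R))) i.
  have e2 := wg _ (tst_partial (i + 2%:R) (t (i + 1))) i.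
  have aux (p1 p2 q1 q2 : R) : q1 = - p1 -> q2 = - p2 -> p1 - p2 = q2 - q1 by move=> -> ->; ring.
  exact: aux e1 e2.
under eq_bigr do rewrite E; rewrite sumrB.
apply/eqP; rewrite subr_eq0; apply/eqP; apply: (@sum3_reindex 2%:R 1) => j.
have D : partial (j + 2%:R) (partial (j + 2%:R + 2%:R) (Phi (j + 2%:R + 1))) =
    partial (j + 1) (partial (j + 1 + 1) (Phi (j + 1 + 2%:R))).
  rewrite ord3_add22 ord3_add21 ord3_add11 ord3_add12; exact: (partialC _ _ (t j).1).
exact: (congr1 (fun f => ipG h f) D).
Qed.

Lemma rot_symmetric Phi Psi : testv Phi -> testv Psi ->
  \sum_i ipG (Phi i) (rotf Psi i) = \sum_i ipG (rotf Phi i) (Psi i).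
Proof.
move=> t t'.
have sP j := tst_sqint mG (t j); have sQ j := tst_sqint mG (t' j).
have dP c j := tst_sqint mG (tst_partial c (t j)).
have dQ c j := tst_sqint mG (tst_partial c (t' j)).
have E i : ipG (Phi i) (rotf Psi i) = ipG (partial (i + 2%:R) (Phi i)) (Psi (i + 1)) -
    ipG (partial (i + 1) (Phi i)) (Psi (i + 2%:R)).
  rewrite (ipiBr3 oG (sP i) (dQ _ _) (dQ _ _)).
  have e1 := integral_by_parts (i + 1) mG (t i).1 (t' (i + 2%:R)).
  have e2 := integral_by_parts (i + 2%:R) mG (t i).1 (t' (i + 1)).
  have aux (p1 p2 q1 q2 : R) : q1 = - p1 -> q2 = - p2 -> p1 - p2 = q2 - q1 by move=> -> ->; ring.
  exact: aux e1 e2.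
have E' i : ipG (rotf Phi i) (Psi i) = ipG (partial (i + 1) (Phi (i + 2%:R))) (Psi i) -
    ipG (partial (i + 2%:R) (Phi (i + 1))) (Psi i).
  rewrite [LHS]ipiC [X in _ = X - _]ipiC [X in _ = _ - X]ipiC.
  exact: (ipiBr3 oG (sQ i) (dP _ _) (dP _ _)).
under eq_bigr do rewrite E; under [RHS]eq_bigr do rewrite E'; rewrite !sumrB.
have e1 : \sum_i ipG (partial (i + 2%:R) (Phi i)) (Psi (i + 1)) =
    \sum_i ipG (partial (i + 1) (Phi (i + 2%:R))) (Psi i).
  by apply: (@sum3_reindex 2%:R 0) => j; rewrite ord3_add22 ord3_add21 addr0.
have e2 : \sum_i ipG (partial (i + 1) (Phi i)) (Psi (i + 2%:R)) =
    \sum_i ipG (partial (i + 2%:R) (Phi (i + 1))) (Psi i).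
  by apply: (@sum3_reindex 1 0) => j; rewrite ord3_add11 ord3_add12 addr0.
have aux (a b c d : R) : a = b -> c = d -> a - c = b - d by move=> -> ->.
exact: aux e1 e2.
Qed.

Lemma curlcl_orth_grad (x : V3) (h : L2G) (g : V3) : curlcl x -> wgrad G h g -> ip3 g x = 0.
Proof.
move=> cx wg; apply: curlcl_orth cx => Phi t.
exact: (rot_orth_grad wg (L2typeP h) (fun i => L2typeP (g i)) t).
Qed.

Lemma wgrad_tst f : tst setT f -> wgrad G f (fun i => partial i f).
Proof.
move=> [sf _] g tg i; have := integral_by_parts i mG sf tg => ->; by rewrite opprK.
Qed.

(** A test function of the whole space restricts to a member of H^1 on [G], without any condition at
    the boundary. *)
Lemma curlcl_solenoidal (x : V3) : curlcl x -> solenoidal G x.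
Proof.
move=> cx f tf; have tp i := tst_partial i tf.
pose g : V3 := fun i => toL2 mG (tst_sqint mG (tp i)).
have := @curlcl_orth_grad x (toL2 mG (tst_sqint mG tf)) g cx (wgrad_tst tf).
by rewrite (ipC hip3).
Qed.

Let V6 : lmodType R := ('I_3 + 'I_3)%type -> L2G.
Let ip6 (x y : V6) : R := @ipsum R L2G (fun f g : L2G => ipG f g) ('I_3 + 'I_3)%type x y.
Let hip6 : hilbert ip6 := ipsum_hilbert _ hip.
Let fst6 (x : V6) : V3 := fun i => x (inl i).
Let snd6 (x : V6) : V3 := fun i => x (inr i).
Let pr6 (u w : V3) : V6 := fun o => match o with inl i => u i | inr i => w i end.

Let ip6E x y : ip6 x y = ip3 (fst6 x) (fst6 y) + ip3 (snd6 x) (snd6 y).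
Proof. exact: big_sumType. Qed.

(** The graph of the real form of S. *)
Let W (x : V6) := [/\ curlcl (fst6 x), curlcl (snd6 x) & wrot (fst6 x) (snd6 x)].

Let wrotE (u w : V3) : wrot u w <-> forall Phi (t : testv Phi), ip3 u (rv t) = ip3 w (tv t).
Proof. by split => h Phi t; exact: h. Qed.

Let nrm_rv Phi (t : testv Phi) : ip3 (rv t) (rv t) = \sum_j nrm (rotf Phi j).
Proof. by apply: eq_bigr => j _; rewrite /= (ipi_tstl _ (tst_rotf j t)). Qed.

(** A test field need not lie in [curlcl], but projecting it there removes a field orthogonal to all
    curls, which leaves the weak curl unchanged. This supplies enough elements of the graph. *)
Let projW Phi (t : testv Phi) : exists2 y, W (pr6 y (rv t)) & forall z, curlcl z -> ip3 z y = ip3 z (tv t).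
Proof.
have [y cy hy] := projection hip3 curlcl_subspace curlcl_closed (tv t).
have yz z : curlcl z -> ip3 z y = ip3 z (tv t).
  move=> /hy; rewrite (ipBl hip3) => /eqP; rewrite subr_eq0 => /eqP e.
  by rewrite (ipC hip3) -e (ipC hip3).
exists y; last exact: yz.
apply: (And3 cy (sub_ipcl hip3 (rotS_rv t))); apply/wrotE => Psi t'; have cr : curlcl (rv t') by exact: (sub_ipcl hip3 (rotS_rv t')).
rewrite (ipC hip3) (yz _ cr) (ipC hip3); exact: (rot_symmetric t t').
Qed.

Let fst6D a x y : fst6 (a *: x + y) = a *: fst6 x + fst6 y. Proof. by []. Qed.
Let snd6D a x y : snd6 (a *: x + y) = a *: snd6 x + snd6 y. Proof. by []. Qed.

Let W_subspace : subspace W.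
Proof.
split.
  apply: (And3 curlcl_subspace.1 curlcl_subspace.1); apply/wrotE => Phi t.
  by rewrite !(ip0l hip3).
move=> a x y [x1 x2 /wrotE x3] [y1 y2 /wrotE y3].
rewrite /W fst6D snd6D.
apply: (And3 (curlcl_subspace.2 a _ _ x1 y1) (curlcl_subspace.2 a _ _ x2 y2)).
apply/wrotE => Phi t.
by rewrite !(ipDl hip3) !(ipZl hip3) x3 y3.
Qed.

Let W_closed : ip_closed ip6 W.
Proof.
move=> x hx.
have c6 (y : V6) : ip3 (fst6 y) (fst6 y) <= ip6 y y /\ ip3 (snd6 y) (snd6 y) <= ip6 y y.
  by rewrite ip6E lerDl lerDr !(ip_ge0 hip3).
split.
- apply: curlcl_closed => e e0; have [y [y1 _ _] xy] := hx e e0; exists (fst6 y) => //.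
  exact: le_lt_trans (c6 (x - y)).1 xy.
- apply: curlcl_closed => e e0; have [y [_ y1 _] xy] := hx e e0; exists (snd6 y) => //.
  exact: le_lt_trans (c6 (x - y)).2 xy.
apply/wrotE => Phi t.
have := @orth_closed _ _ _ hip6 (fun z => z = pr6 (rv t) (- tv t)) x _ _ erefl.
rewrite ip6E (ipNr hip3 (snd6 x) (tv t)) => h; apply/eqP; rewrite -subr_eq0; apply/eqP; apply: h.
move=> e e0; have [y [_ _ /wrotE yw] xy] := hx e e0; exists y => // z ->.
by rewrite ip6E (ipNr hip3 (snd6 y) (tv t)) /= -yw subrr.
Qed.

(** The norm of [u] is found by pairing with curls of test fields, and (u, rot Phi) = (w, Phi) is
    the pairing that [curl_bound] estimates. *)
Lemma curl_compact e : 0 < e -> exists xs : seq ('I_3 -> L2G), forall u w : 'I_3 -> L2G,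
  curlcl u -> curlcl w -> wrot u w ->
  ip3 u u <= e * ip3 w w + \sum_(X <- xs) ip3 X w ^+ 2.
Proof.
move=> e0; have [xs hxs] := curl_bound oG Grho e0; exists xs => u w cu cw wr.
apply: (ipcl_dual_bound hip3 _ cu).
  rewrite addr_ge0 ?mulr_ge0 ?(ltW e0) ?(ip_ge0 hip3)// sumr_ge0// => X _; exact: sqr_ge0.
move=> s [Phi t es].
have -> : ip3 u s = ip3 w (tv t).
  transitivity (ip3 u (rv t)); last exact: (wr Phi t).
  by apply: eq_bigr => i _; apply: eq_ipi => // z _; rewrite es.
have -> : ip3 s s = \sum_j nrm (rotf Phi j).
  rewrite -nrm_rv; apply: eq_bigr => i _; by apply: eq_ipi => z _; rewrite es.
exact: (hxs _ _ (fun i => L2typeP (w i)) (curlcl_solenoidal cw) t).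
Qed.

Let W_cpt e : 0 < e -> exists xs : seq V6, forall x y, W x -> W y ->
  ip3 (fst6 x) (fst6 y) ^+ 2 <= (e * ip6 x x + \sum_(z <- xs) ip6 z x ^+ 2) * ip6 y y.
Proof.
move=> e0; have [xs hxs] := curl_compact e0.
exists (map (fun X => pr6 0 X) xs) => x y [x1 x2 x3] [y1 y2 y3].
apply: (le_trans (cauchy_schwarz hip3 _ _)).
have u0 := ip_ge0 hip3 (fst6 x).
apply: ler_pM => //; [exact: (ip_ge0 hip3)| |by rewrite ip6E lerDl (ip_ge0 hip3)].
rewrite big_map.
have -> : \sum_(X <- xs) ip6 (pr6 0 X) x ^+ 2 = \sum_(X <- xs) ip3 X (snd6 x) ^+ 2.
  by apply: eq_bigr => X _; rewrite ip6E (ip0l hip3) add0r.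
apply: (le_trans (hxs _ _ x1 x2 x3)).
by rewrite lerD2r ip6E mulrDr lerDr mulr_ge0// ltW.
Qed.

Lemma curl_poincare : exists2 C, 0 <= C & forall u w : 'I_3 -> L2G,
  curlcl u -> curlcl w -> wrot u w -> ip3 u u <= C * ip3 w w.
Proof.
have [xs hxs] := curl_compact ltr01.
exists (1 + \sum_(X <- xs) ip3 X X).
  by rewrite addr_ge0// sumr_ge0// => X _; exact: (ip_ge0 hip3).
move=> u w cu cw wr; apply: (le_trans (hxs _ _ cu cw wr)).
rewrite mulrDl lerD2l mulr_suml; apply: ler_sum => X _; exact: (cauchy_schwarz hip3).
Qed.

(* Approximate [w'] by [rot Phi]; the Poincare inequality then makes the
   projection of [Phi] close to [u'], and pairing with a projected test field
   is the definition of the weak curl. *)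
Lemma curl_symmetric (u w u' w' : 'I_3 -> L2G) : curlcl u -> curlcl w -> wrot u w ->
  curlcl u' -> curlcl w' -> wrot u' w' -> ip3 w u' = ip3 u w'.
Proof.
have aux (a b k l e : R) : a ^+ 2 <= k * e -> b ^+ 2 <= l * e ->
    (a - b) ^+ 2 <= (2 * k + 2 * l) * e.
  by have := sqr_ge0 (a + b) => *; lra.
move=> cu cw /wrotE wr cu' cw' /wrotE wr'.
have [C C0 hC] := curl_poincare.
apply/eqP; rewrite -subr_eq0; apply/eqP.
apply: (@sqr_small _ (2 * (ip3 w w * C) + 2 * ip3 u u)) => e e0.
have [s [Phi t es] sw] := cw' e e0.
have {es}es : s = rv t by apply/funext => i; apply: val_inj; exact: es.
rewrite {}es in sw.
have [y [cy cr /wrotE wy] hy] := projW t.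
have wd : wrot (u' - y) (w' - rv t).
  by apply/wrotE => Psi t'; rewrite !(ipBl hip3) wr' wy.
have d := hC _ _ (subspaceB curlcl_subspace cu' cy) (subspaceB curlcl_subspace cw' cr) wd.
have -> : ip3 w u' - ip3 u w' = ip3 w (u' - y) - ip3 u (w' - rv t).
  rewrite !(ipBr hip3) (hy _ cw) wr; ring.
have h1 := cauchy_schwarz hip3 w (u' - y); have h2 := cauchy_schwarz hip3 u (w' - rv t).
have w0 := ip_ge0 hip3 w; have u0 := ip_ge0 hip3 u.
have {}h1 : ip3 w (u' - y) ^+ 2 <= ip3 w w * C * e.
  apply: (le_trans h1); rewrite -mulrA ler_wpM2l//; apply: (le_trans d).
  by rewrite ler_wpM2l// ltW.
have {}h2 : ip3 u (w' - rv t) ^+ 2 <= ip3 u u * e.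
  by apply: (le_trans h2); rewrite ler_wpM2l// ltW.
exact: aux h1 h2.
Qed.

(* The spectral theorem for [b((u, w), (u', w')) = (u, u')] on the graph of the
   curl: an eigenvector satisfies [rot w = a u], and [w] is then the half sum of
   the eigenfields [w + s u] and [w - s u] for the eigenvalues [s] and [- s],
   where [s ^ 2 = a]. *)
Lemma curl_spanned (r : 'I_3 -> L2G) :
  (forall (e : 'I_3 -> L2G) l, l != 0 -> curlcl e -> wrot e (fun i x => l * e i x) ->
     ip3 r e = 0) ->
  forall Phi, testv Phi -> \sum_i ipG (r i) (rotf Phi i) = 0.
Proof.
move=> hr.
have bC (x y : V6) : W x -> W y -> ip3 (fst6 x) (fst6 y) = ip3 (fst6 y) (fst6 x).
  by move=> _ _; exact: (ipC hip3).
have bl a (x y z : V6) : W x -> W y -> W z ->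
    ip3 (fst6 (a *: x + y)) (fst6 z) = a * ip3 (fst6 x) (fst6 z) + ip3 (fst6 y) (fst6 z).
  by move=> _ _ _; rewrite fst6D (ipDl hip3) (ipZl hip3).
have x0v y : ip6 (pr6 0 r) y = ip3 r (snd6 y) by rewrite ip6E (ip0l hip3) add0r.
have [|y [[y1 y2 /wrotE y3] yr by0]] :=
   @spectral_orth _ _ _ hip6 W _ W_subspace W_closed bC bl W_cpt (pr6 0 r).
  move=> x [wx [k k0 hk]]; have [x1 x2 /wrotE x3] := wx; rewrite x0v.
  pose a := k^-1 - 1; set u := fst6 x in x1 x3 *; set w := snd6 x in x2 x3 *.
  have ga y : W y -> ip3 w (snd6 y) = a * ip3 u (fst6 y).
    move=> wy; have := hk _ wy; rewrite ip6E -/u -/w /a.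
    move: (ip3 u _) (ip3 w _) => H S e; apply: (mulfI k0).
    by rewrite mulrA mulrBr divff// mulr1 mulrBl mul1r {1}e; ring.
  have wau Phi (t : testv Phi) : ip3 w (rv t) = a * ip3 u (tv t).
    have [z Wz hz] := projW t; have := ga _ Wz; rewrite [fst6 _](_ : _ = z)//.
    by rewrite hz.
  have nw : ip3 w w = a * ip3 u u by exact: ga.
  (* If [a] is not positive, the relation [nw] forces [w] to have norm zero. *)
  have [a0|a0] := lerP a 0.
    rewrite (ipC hip3); apply: (ns0_ip hip3); apply/eqP; rewrite eq_le (ip_ge0 hip3) andbT.
    by rewrite nw mulr_le0_ge0// (ip_ge0 hip3).
  have eig l : l != 0 -> l ^+ 2 = a -> ip3 r (w + l *: u) = 0.
    move=> l0 l2; apply: (hr _ l l0).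
      exact: (subspaceD curlcl_subspace x2 (subspaceZ l curlcl_subspace x1)).
    have : wrot (w + l *: u) (l *: (w + l *: u)).
      apply/wrotE => Phi t; rewrite !(ipDl hip3, ipZl hip3) wau x3 -l2; ring.
    by move=> H Phi t; rewrite H//; apply: eq_bigr => i _.
  have sa : Num.sqrt a != 0 by rewrite gt_eqF// sqrtr_gt0.
  have s2 : Num.sqrt a ^+ 2 = a by rewrite sqr_sqrtr// ltW.
  have e1 := eig _ sa s2.
  have e2 : ip3 r (w + (- Num.sqrt a) *: u) = 0 by apply: eig; rewrite ?oppr_eq0// sqrrN.
  move: e1 e2; rewrite !(ipDr hip3) !(ipZr hip3); lra.
(* The projection has first component zero, hence zero curl, and [r] is orthogonal to the second
   component of every graph element. *)
have u0 : ip3 (fst6 y) (fst6 y) = 0 by apply: by0; split => //; exact/wrotE.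
have w0 : ip3 (snd6 y) (snd6 y) = 0.
  apply: big1 => i _; apply: orth_tests_eq0 => //; first exact: L2typeP.
  move=> f tf.
  have t : testv (fun j => if j == i then f else fun=> 0).
    by move=> j; case: (j == i) => //; exact: tst0.
  have := y3 _ t; rewrite (ns0_ip hip3 _ u0) /ip3 /ipsum (bigD1 i)//= big1; last first.
    move=> j ji; rewrite /tv /= ifN// ipiC.
    by rewrite /ipi; under eq_Rintegral do rewrite mul0r; rewrite Rintegral_cst// mul0r.
  by rewrite addr0 eqxx.
move=> Phi t; have [z Wz _] := projW t.
have := yr _ Wz; rewrite (ipBl hip6) x0v => /eqP; rewrite subr_eq0 => /eqP.
rewrite ip6E (ns0_ip hip3 _ u0) (ns0_ip hip3 _ w0) addr0; exact.
Qed.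

End CurlSpectral.

(** * Complex fields *)

Section ComplexFields.
Variable R : realType.
Notation R3 := (R * R * R)%type.
Notation mR := (measurableTypeR R).
Notation mR3 := (mR * mR * mR)%type.
Notation mu3 := (@leb3 R).
Notation Re := (@complex.Re R).
Notation Im := (@complex.Im R).
Implicit Types z w : R[i].

Lemma ReD z w : Re (z + w) = Re z + Re w. Proof. by case: z; case: w. Qed.
Lemma ImD z w : Im (z + w) = Im z + Im w. Proof. by case: z; case: w. Qed.
Lemma ReN z : Re (- z) = - Re z. Proof. by case: z. Qed.
Lemma ImN z : Im (- z) = - Im z. Proof. by case: z. Qed.
Lemma ReM z w : Re (z * w) = Re z * Re w - Im z * Im w. Proof. by case: z; case: w. Qed.
Lemma ImM z w : Im (z * w) = Re z * Im w + Im z * Re w. Proof. by case: z; case: w. Qed.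
Lemma Re_conj z : Re (conjc z) = Re z. Proof. by case: z. Qed.
Lemma Im_conj z : Im (conjc z) = - Im z. Proof. by case: z. Qed.

Lemma Re_sum (I : Type) (s : seq I) (F : I -> R[i]) : Re (\sum_(i <- s) F i) = \sum_(i <- s) Re (F i).
Proof. by elim: s => [|i s IH]; rewrite ?big_nil// !big_cons ReD IH. Qed.
Lemma Im_sum (I : Type) (s : seq I) (F : I -> R[i]) : Im (\sum_(i <- s) F i) = \sum_(i <- s) Im (F i).
Proof. by elim: s => [|i s IH]; rewrite ?big_nil// !big_cons ImD IH. Qed.

Lemma complex_eq z w : Re z = Re w -> Im z = Im w -> z = w.
Proof. by case: z; case: w => /= a b c d -> ->. Qed.

Section Fixed.
Variable (G : set R3).
Hypothesis oG : open G.
Let mG : measurable (G : set mR3) := open_measurable3 oG.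
Notation ipG := (ipi mu3 (G : set mR3)).
Notation L2G := (L2type mu3 (open_measurable3 oG)).
Let hip := L2_hilbert mu3 mG.

(** The default 0 makes real and imaginary parts total functions of a field. *)
Definition L2mk (f : mR3 -> R) : L2G :=
  if pselect (sqint mu3 (G : set mR3) f) is left h then toL2 mG h else 0.

Lemma L2mkE (f : mR3 -> R) : sqint mu3 (G : set mR3) f -> L2mk f = f :> (mR3 -> R).
Proof. by rewrite /L2mk; case: pselect. Qed.

Definition cintg (f : sfield R) := mu3.-integrable (G : set mR3) (fun x => (Re (f x))%:E) /\
  mu3.-integrable (G : set mR3) (fun x => (Im (f x))%:E).

Let cintgD f g : cintg f -> cintg g -> cintg (fun x => f x + g x).
Proof.
move=> [f1 f2] [g1 g2]; split.
  by under eq_fun do rewrite ReD EFinD; exact: integrableD.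
by under eq_fun do rewrite ImD EFinD; exact: integrableD.
Qed.

Lemma cintD (f g : sfield R) : cintg f -> cintg g -> cint G (fun x => f x + g x) = cint G f + cint G g.
Proof.
move=> [f1 f2] [g1 g2]; apply: complex_eq; rewrite ?ReD ?ImD /= -RintegralD//;
  by apply: eq_Rintegral => x _; rewrite ?ReD ?ImD.
Qed.

Lemma cint_sum3 (F : 'I_3 -> sfield R) : (forall i, cintg (F i)) ->
  cint G (fun x => \sum_i F i x) = \sum_i cint G (F i).
Proof.
move=> hF; under [X in cint _ X]eq_fun do rewrite !big_ord_recl big_ord0 addr0.
by rewrite !big_ord_recl big_ord0 addr0 !cintD//; exact: cintgD.
Qed.

Let sq (f : mR3 -> R) := sqint mu3 (G : set mR3) f.

Let ig2 (a b c d : mR3 -> R) : sq a -> sq b -> sq c -> sq d ->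
  mu3.-integrable (G : set mR3) (fun x => (a x * b x + c x * d x)%:E).
Proof.
move=> ha hb hc hd; have := integrableD mG (sqint_mul mG ha hb) (sqint_mul mG hc hd).
by apply: eq_integrable.
Qed.

Let ig2B (a b c d : mR3 -> R) : sq a -> sq b -> sq c -> sq d ->
  mu3.-integrable (G : set mR3) (fun x => (a x * b x - c x * d x)%:E).
Proof.
move=> ha hb hc hd; have := integrableB mG (sqint_mul mG ha hb) (sqint_mul mG hc hd).
by apply: eq_integrable.
Qed.

Lemma cintgM f g : L2s G f -> L2s G g -> cintg (fun x => f x * g x).
Proof.
move=> [f1 f2] [g1 g2]; split.
  by under eq_fun do rewrite ReM; exact: ig2B.
by under eq_fun do rewrite ImM; exact: ig2.
Qed.

Lemma cintM f g : L2s G f -> L2s G g -> cint G (fun x => f x * g x) =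
  (ipG (Re \o f) (Re \o g) - ipG (Im \o f) (Im \o g)) +i*
  (ipG (Re \o f) (Im \o g) + ipG (Im \o f) (Re \o g)).
Proof.
move=> [f1 f2] [g1 g2]; rewrite /cint; congr (_ +i* _).
  rewrite /ipi -RintegralB//; try exact: sqint_mul.
  by apply: eq_Rintegral => x _; rewrite ReM.
rewrite /ipi -RintegralD//; try exact: sqint_mul.
by apply: eq_Rintegral => x _; rewrite ImM.
Qed.

Lemma L2s_conj f : L2s G f -> L2s G (fun x => conjc (f x)).
Proof.
move=> [f1 f2]; split; first by under eq_fun do rewrite Re_conj.
under eq_fun do rewrite Im_conj.
by have := sqintZ mG (-1) f2; congr square_integrable; apply/funext => x; rewrite mulN1r.
Qed.

Lemma L2s_real (f : mR3 -> R) : sq f -> L2s G (fun x => (f x)%:C).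
Proof. by move=> hf; split => //; exact: sqint0. Qed.

Definition reV (u : vfield R) : 'I_3 -> L2G := fun i => L2mk (fun x => Re (u x 0 i)).
Definition imV (u : vfield R) : 'I_3 -> L2G := fun i => L2mk (fun x => Im (u x 0 i)).
Definition reS (f : sfield R) : L2G := L2mk (Re \o f).
Definition imS (f : sfield R) : L2G := L2mk (Im \o f).

Lemma reVE u i : L2 G u -> reV u i = (fun x => Re (u x 0 i)) :> (mR3 -> R).
Proof. by move=> h; apply: L2mkE; have [] := h i. Qed.
Lemma imVE u i : L2 G u -> imV u i = (fun x => Im (u x 0 i)) :> (mR3 -> R).
Proof. by move=> h; apply: L2mkE; have [] := h i. Qed.
Lemma reSE f : L2s G f -> reS f = Re \o f :> (mR3 -> R).
Proof. by move=> [? _]; exact: L2mkE. Qed.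
Lemma imSE f : L2s G f -> imS f = Im \o f :> (mR3 -> R).
Proof. by move=> [_ ?]; exact: L2mkE. Qed.

Notation ip3 := (ip3 (oG := oG)).

Lemma inner_formula u v : L2 G u -> L2 G v -> inner G u v =
  (ip3 (reV u) (reV v) + ip3 (imV u) (imV v)) +i*
  (ip3 (imV u) (reV v) - ip3 (reV u) (imV v)).
Proof.
move=> hu hv; rewrite /inner cint_sum3; last by move=> i; apply: cintgM; [exact: hu|exact: L2s_conj].
have E i := cintM (hu i) (L2s_conj (hv i)).
have cj (f : mR3 -> R) i : sq f -> ipG f (Im \o (fun x => conjc (v x 0 i))) = - ipG f (imV v i).
  move=> hf; rewrite -(ipNr hip (toL2 mG hf) (imV v i)); apply: eq_ipi => // x _.
  by rewrite /= Im_conj (imVE i hv).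
have cr (f : mR3 -> R) i : ipG f (Re \o (fun x => conjc (v x 0 i))) = ipG f (reV v i).
  by apply: eq_ipi => // x _; rewrite /= Re_conj (reVE i hv).
apply: complex_eq; [rewrite Re_sum [RHS]/=|rewrite Im_sum [RHS]/=]; rewrite /ip3 /ipsum.
  rewrite -big_split; apply: eq_bigr => i _; rewrite E [LHS]/= cr cj; last by have [] := hu i.
  by rewrite (reVE i hu) (imVE i hu) opprK.
rewrite -sumrB; apply: eq_bigr => i _; rewrite E [LHS]/= cr cj; last by have [] := hu i.
by rewrite (reVE i hu) (imVE i hu) addrC.
Qed.

(** [normal_trace] is bilinear, in contrast with [inner]: hence the different signs. *)
Lemma trace_formula u d v g : L2 G u -> L2s G d -> L2s G v -> L2 G g ->
  normal_trace G u d v g =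
  ((ip3 (reV u) (reV g) + ipG (reS d) (reS v)) - (ip3 (imV u) (imV g) + ipG (imS d) (imS v))) +i*
  ((ip3 (reV u) (imV g) + ipG (reS d) (imS v)) + (ip3 (imV u) (reV g) + ipG (imS d) (reS v))).
Proof.
move=> hu hd hv hg; rewrite /normal_trace cintD; last 2 first.
- have i3 (F : 'I_3 -> sfield R) : (forall i, cintg (F i)) -> cintg (fun x => \sum_i F i x).
    by move=> hF; under eq_fun do rewrite !big_ord_recl big_ord0 addr0; do 2! apply: cintgD => //.
  by apply: i3 => i; exact: cintgM.
- exact: cintgM.
rewrite cint_sum3; last by move=> i; exact: cintgM.
rewrite (cintM hd hv).
have e1 (a b : sfield R) : Re \o a = Re \o a by [].
have E i := cintM (hu i) (hg i).
rewrite (reSE hd) (reSE hv) (imSE hd) (imSE hv).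
have eR : \sum_i Re (cint G (fun x => u x 0 i * g x 0 i)) =
    ip3 (reV u) (reV g) - ip3 (imV u) (imV g).
  rewrite /ip3 /ipsum -sumrB; apply: eq_bigr => i _; rewrite E [LHS]/=.
  by rewrite (reVE i hu) (imVE i hu) (reVE i hg) (imVE i hg).
have eI : \sum_i Im (cint G (fun x => u x 0 i * g x 0 i)) =
    ip3 (reV u) (imV g) + ip3 (imV u) (reV g).
  rewrite /ip3 /ipsum -big_split; apply: eq_bigr => i _; rewrite E [LHS]/=.
  by rewrite (reVE i hu) (imVE i hu) (reVE i hg) (imVE i hg).
have aux (p q r s : R) : p - q + (r - s) = (p + r) - (q + s) by ring.
apply: complex_eq; [rewrite ReD Re_sum eR|rewrite ImD Im_sum eI].
  exact: aux.
exact: addrACA.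
Qed.

End Fixed.
End ComplexFields.

(** * Weak derivatives of complex fields in real terms *)

Section Dictionary.
Variable R : realType.
Notation R3 := (R * R * R)%type.
Notation mR := (measurableTypeR R).
Notation mR3 := (mR * mR * mR)%type.
Notation mu3 := (@leb3 R).
Notation Re := (@complex.Re R).
Notation Im := (@complex.Im R).
Variables (G : set R3) (rho : R).
Hypothesis oG : open G.
Hypothesis Grho : G `<=` cube rho.
Let mG : measurable (G : set mR3) := open_measurable3 oG.
Let Gfin : (mu3 G < +oo)%E := cube_fin mG Grho.
Notation ipG := (ipi mu3 (G : set mR3)).
Notation L2G := (L2type mu3 (open_measurable3 oG)).
Let hip := L2_hilbert mu3 mG.
Notation ip3 := (ip3 (oG := oG)).
Notation V3 := ('I_3 -> L2G).
Let hip3 := hip3 oG.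
Notation reV := (reV oG).
Notation imV := (imV oG).
Notation reS := (reS oG).
Notation imS := (imS oG).
Notation curlcl := (curlcl (oG := oG)).

Definition cplxV (a b : V3) : vfield R := fun x => \row_i (a i x +i* b i x).
Definition cplxS (a b : L2G) : sfield R := fun x => a x +i* b x.

Lemma L2_cplxV a b : L2 G (cplxV a b).
Proof.
move=> i; split; [have := L2typeP (a i)|have := L2typeP (b i)];
  by congr square_integrable; apply/funext => x; rewrite /cplxV mxE.
Qed.

Lemma L2s_cplxS a b : L2s G (cplxS a b).
Proof. by split; exact: L2typeP. Qed.

Lemma reV_cplxV a b : reV (cplxV a b) = a.
Proof.
apply/funext => i; apply: val_inj; rewrite /= (reVE oG i (L2_cplxV a b)).
by apply/funext => x; rewrite /cplxV mxE.
Qed.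

Lemma imV_cplxV a b : imV (cplxV a b) = b.
Proof.
apply/funext => i; apply: val_inj; rewrite /= (imVE oG i (L2_cplxV a b)).
by apply/funext => x; rewrite /cplxV mxE.
Qed.

Lemma reS_cplxS a b : reS (cplxS a b) = a.
Proof. by apply: val_inj; rewrite /= (reSE oG (L2s_cplxS a b)). Qed.
Lemma imS_cplxS a b : imS (cplxS a b) = b.
Proof. by apply: val_inj; rewrite /= (imSE oG (L2s_cplxS a b)). Qed.

Lemma cplxV_re_im u : L2 G u -> cplxV (reV u) (imV u) = u.
Proof.
move=> hu; apply/funext => x; apply/rowP => i; rewrite /cplxV mxE.
by rewrite (reVE oG i hu) (imVE oG i hu); case: (u x 0 i).
Qed.

Lemma cint_real (a : sfield R) (f : R3 -> R) : cint G (fun x => a x * (f x)%:C) =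
  ipG (Re \o a) f +i* ipG (Im \o a) f.
Proof.
rewrite /cint; congr (_ +i* _); apply: eq_Rintegral => x _.
  by rewrite ReM /= mulr0 subr0.
by rewrite ImM /= mulr0 add0r.
Qed.

Lemma weak_gradE h g : L2s G h -> L2 G g -> weak_grad G h g <->
  wgrad G (reS h) (reV g) /\ wgrad G (imS h) (imV g).
Proof.
move=> hh hg.
have E f i : (cint G (fun x => h x * (partial i f x)%:C) = - cint G (fun x => g x 0 i * (f x)%:C)) <->
    ipG (reS h) (partial i f) = - ipG (reV g i) f /\ ipG (imS h) (partial i f) = - ipG (imV g i) f.
  rewrite !cint_real (reSE oG hh) (imSE oG hh) (reVE oG i hg) (imVE oG i hg).
  by split=> [[-> ->]|[-> ->]].
split=> [H|[H1 H2] f /tst_test tf i]; last by apply/E; split; [exact: H1|exact: H2].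
by split=> f /tst_test tf i; have [? ?] := (E f i).1 (H f tf i).
Qed.

Definition wdiv (u : V3) (d : L2G) : Prop :=
  forall f, tst G f -> \sum_i ipG (u i) (partial i f) = - ipG d f.

Lemma weak_divE u d : L2 G u -> L2s G d -> weak_div G u d <->
  wdiv (reV u) (reS d) /\ wdiv (imV u) (imS d).
Proof.
move=> hu hd.
have E f : tst G f ->
  (cint G (fun x => \sum_i u x 0 i * (partial i f x)%:C) = - cint G (fun x => d x * (f x)%:C)) <->
  \sum_i ipG (reV u i) (partial i f) = - ipG (reS d) f /\
  \sum_i ipG (imV u i) (partial i f) = - ipG (imS d) f.
  move=> tf; have sp i := tst_sqint mG (tst_partial i tf).
  rewrite (cint_sum3 oG); last first.
    by move=> i; apply: cintgM => //; apply: L2s_real => //; exact: oG.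
  have S : \sum_i cint G (fun x => u x 0 i * (partial i f x)%:C) =
      (\sum_i ipG (reV u i) (partial i f)) +i* (\sum_i ipG (imV u i) (partial i f)).
    apply: complex_eq; rewrite ?Re_sum ?Im_sum [RHS]/=; apply: eq_bigr => i _.
      by rewrite cint_real (reVE oG i hu).
    by rewrite cint_real (imVE oG i hu).
  rewrite S cint_real (reSE oG hd) (imSE oG hd); by split=> [[-> ->]|[-> ->]].
split=> [H|[H1 H2] f /tst_test tf]; last by apply/E => //; split; [exact: H1|exact: H2].
by split=> f tf; have [? ?] := (E f tf).1 (H f ((tst_test G f).1 tf)).
Qed.

(** A test field with a single nonzero component isolates one equation; a cyclic shift of the
    indices matches the two forms. *)
Let wrot_component (u w : V3) : wrot G u w <-> forall f, tst G f -> forall i : 'I_3,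
  ipG (u (i + 2%:R)) (partial (i + 1) f) - ipG (u (i + 1)) (partial (i + 2%:R) f) = - ipG (w i) f.
Proof.
have E Phi : testv G Phi -> \sum_i ipG (u i) (rotf Phi i) =
    \sum_j (ipG (u (j + 1)) (partial (j + 2%:R) (Phi j)) - ipG (u (j + 2%:R)) (partial (j + 1) (Phi j))).
  move=> t; rewrite sumrB.
  transitivity (\sum_i ipG (u i) (partial (i + 1) (Phi (i + 2%:R))) -
                \sum_i ipG (u i) (partial (i + 2%:R) (Phi (i + 1)))).
    rewrite -sumrB; apply: eq_bigr => i _.
    exact: (ipiBr3 oG (L2typeP (u i)) (tst_sqint mG (tst_partial _ (t _))) (tst_sqint mG (tst_partial _ (t _)))).
  have e1 : \sum_i ipG (u i) (partial (i + 1) (Phi (i + 2%:R))) =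
      \sum_j ipG (u (j + 1)) (partial (j + 2%:R) (Phi j)).
    by apply: (@sum3_reindex _ 1 0) => j; rewrite ord3_add11 ord3_add12 addr0.
  have e2 : \sum_i ipG (u i) (partial (i + 2%:R) (Phi (i + 1))) =
      \sum_j ipG (u (j + 2%:R)) (partial (j + 1) (Phi j)).
    by apply: (@sum3_reindex _ 2%:R 0) => j; rewrite ord3_add22 ord3_add21 addr0.
  have aux (a b c d : R) : a = b -> c = d -> a - c = b - d by move=> -> ->.
  exact: aux e1 e2.
split=> [H f tf i|H Phi t].
  have t : testv G (fun j => if j == i then f else fun=> 0).
    by move=> j; case: (j == i) => //; exact: tst0.
  have z (x : L2G) : ipG x (fun=> 0) = 0.
    by rewrite /ipi; under eq_Rintegral do rewrite mulr0; rewrite Rintegral_cst// mul0r.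
  have single (F : 'I_3 -> R) : (forall j, j != i -> F j = 0) -> \sum_j F j = F i.
    by move=> h; rewrite (bigD1 i)//= big1 ?addr0.
  have := H _ t; rewrite (E _ t) single; last by move=> j /negPf ->; exact: z.
  rewrite single; last by move=> j /negPf ->; rewrite !partial_cst !z subrr.
  rewrite eqxx; move: (ipG _ _) (ipG _ _) (ipG _ _) => a b c <-; by rewrite opprB.
rewrite (E _ t); apply: eq_bigr => j _; have := H _ (t j) j.
have aux (a b c : R) : a - b = - c -> b - a = c by move=> e; rewrite -opprB e opprK.
exact: aux.
Qed.

Let Re_real_comb (z w : R[i]) (r s : R) :
  Re (z * r%:C - w * s%:C) = Re z * r - Re w * s.
Proof. by rewrite ReD ReN !ReM /= !mulr0 !subr0. Qed.

Let Im_real_comb (z w : R[i]) (r s : R) :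
  Im (z * r%:C - w * s%:C) = Im z * r - Im w * s.
Proof. by rewrite ImD ImN !ImM /= !mulr0 !add0r. Qed.

Lemma weak_rotE u w : L2 G u -> L2 G w -> weak_rot G u w <->
  wrot G (reV u) (reV w) /\ wrot G (imV u) (imV w).
Proof.
move=> hu hw.
have E f i : tst G f -> (cint G (fun x => u x 0 (i + 2%:R) * (partial (i + 1) f x)%:C
                 - u x 0 (i + 1) * (partial (i + 2%:R) f x)%:C) =
    - cint G (fun x => w x 0 i * (f x)%:C)) <->
  ipG (reV u (i + 2%:R)) (partial (i + 1) f) - ipG (reV u (i + 1)) (partial (i + 2%:R) f) = - ipG (reV w i) f /\
  ipG (imV u (i + 2%:R)) (partial (i + 1) f) - ipG (imV u (i + 1)) (partial (i + 2%:R) f) = - ipG (imV w i) f.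
  move=> tf; have sp j := tst_sqint mG (tst_partial j tf).
  have -> : cint G (fun x => u x 0 (i + 2%:R) * (partial (i + 1) f x)%:C
                 - u x 0 (i + 1) * (partial (i + 2%:R) f x)%:C) =
    (ipG (reV u (i + 2%:R)) (partial (i + 1) f) - ipG (reV u (i + 1)) (partial (i + 2%:R) f)) +i*
    (ipG (imV u (i + 2%:R)) (partial (i + 1) f) - ipG (imV u (i + 1)) (partial (i + 2%:R) f)).
    rewrite /cint; congr (_ +i* _).
      rewrite -(RintegralB mG (sqint_mul mG (L2typeP _) (sp _)) (sqint_mul mG (L2typeP _) (sp _))).
      apply: eq_Rintegral => x _; rewrite !(reVE oG _ hu); exact: Re_real_comb.
    rewrite -(RintegralB mG (sqint_mul mG (L2typeP _) (sp _)) (sqint_mul mG (L2typeP _) (sp _))).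
    apply: eq_Rintegral => x _; rewrite !(imVE oG _ hu); exact: Im_real_comb.
  rewrite cint_real (reVE oG i hw) (imVE oG i hw); by split=> [[-> ->]|[-> ->]].
split=> [H|[/wrot_component H1 /wrot_component H2] f /tst_test tf i].
  by split; apply/wrot_component => f tf i; have [? ?] := (E f i tf).1 (H f ((tst_test G f).1 tf) i).
by apply/E => //; split; [exact: H1|exact: H2].
Qed.

End Dictionary.

(** * The spaces B, B_H and V^0 in real terms *)

Section Spaces.
Variable R : realType.
Notation R3 := (R * R * R)%type.
Notation mR := (measurableTypeR R).
Notation mR3 := (mR * mR * mR)%type.
Notation mu3 := (@leb3 R).
Variables (G : set R3) (rho : R).
Hypothesis oG : open G.
Hypothesis Grho : G `<=` cube rho.
Let mG : measurable (G : set mR3) := open_measurable3 oG.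
Let Gfin : (mu3 G < +oo)%E := cube_fin mG Grho.
Notation ipG := (ipi mu3 (G : set mR3)).
Notation L2G := (L2type mu3 (open_measurable3 oG)).
Let hip := L2_hilbert mu3 mG.
Notation ip3 := (ip3 (oG := oG)).
Notation V3 := ('I_3 -> L2G).
Let hip3 := hip3 oG.
Notation reV := (reV oG).
Notation imV := (imV oG).
Notation reS := (reS oG).
Notation imS := (imS oG).
Notation curlcl := (curlcl (oG := oG)).
Let z3 : V3 := fun=> 0.


Let ip3z (x : V3) : ip3 x z3 = 0.
Proof. by rewrite (ipC hip3); exact: (ip0l hip3). Qed.

Let zL (f : mR3 -> R) : ipG (0 : L2G) f = 0.
Proof.
rewrite /ipi; under eq_Rintegral => x _ do rewrite [L2val _ _](_ : _ = 0)// mul0r.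
by rewrite Rintegral_cst// mul0r.
Qed.

Lemma wgrad0 : wgrad G (0 : L2G) (fun i => z3 i).
Proof. by move=> f tf i; rewrite !zL oppr0. Qed.

Lemma H1_wgrad h g : H1 G h g -> wgrad G (reS h) (reV g) /\ wgrad G (imS h) (imV g).
Proof. by move=> [hh hg /(weak_gradE oG hh hg)]. Qed.

Lemma H1_cplx (h h' : L2G) (g g' : V3) : wgrad G h g -> wgrad G h' g' ->
  H1 G (cplxS h h') (cplxV g g').
Proof.
move=> w w'; split; [exact: L2s_cplxS|exact: L2_cplxV|].
apply/(weak_gradE oG (L2s_cplxS _ _) (L2_cplxV _ _)).
by rewrite reS_cplxS imS_cplxS reV_cplxV imV_cplxV.
Qed.

Lemma spaceBE u : L2 G u -> spaceB G u <-> forall (h : L2G) (g : V3), wgrad G h g ->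
  ip3 (reV u) g = 0 /\ ip3 (imV u) g = 0.
Proof.
move=> hu; split=> [[_ H] h g wg|H].
  have := H (cplxV g z3) (ex_intro (fun h => H1 G h _) _ (H1_cplx wg wgrad0)).
  rewrite (inner_formula oG hu (L2_cplxV _ _)) reV_cplxV imV_cplxV !ip3z addr0 subr0.
  by case.
split => // a [h Hh]; have [_ ha _] := Hh; have [w w'] := H1_wgrad Hh.
have [e1 e2] := H _ _ w; have [e3 e4] := H _ _ w'.
by rewrite (inner_formula oG hu ha) e1 e2 e3 e4 addr0 subr0.
Qed.

Lemma trace_zeroE u d : L2 G u -> L2s G d ->
  (forall v g, H1 G v g -> normal_trace G u d v g = 0) <->
  (forall (h : L2G) (g : V3), wgrad G h g ->
     ip3 (reV u) g + ipG (reS d) h = 0 /\ ip3 (imV u) g + ipG (imS d) h = 0).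
Proof.
move=> hu hd; split=> [H h g wg|H v g Hv].
  have := H _ _ (H1_cplx wg wgrad0).
  rewrite (trace_formula oG hu hd (L2s_cplxS _ _) (L2_cplxV _ _)).
  rewrite reV_cplxV imV_cplxV reS_cplxS imS_cplxS !ip3z !(ipiC _ _ _ (0 : L2G)) !zL.
  by rewrite !addr0 subr0 add0r; case.
have [hv hg _] := Hv; have [w w'] := H1_wgrad Hv.
have [e1 e2] := H _ _ w; have [e3 e4] := H _ _ w'.
by rewrite (trace_formula oG hu hd hv hg) e1 e2 e3 e4 subr0 addr0.
Qed.

Lemma wdiv_unique (u : V3) (d d' h : L2G) : wdiv u d -> wdiv u d' -> ipG d h = ipG d' h.
Proof.
move=> hd hd'.
have n0 : ipG (d - d') (d - d') = 0.
  apply: orth_tests_eq0 => //; first exact: L2typeP.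
  move=> f tf; have := ipBl hip d d' (toL2 mG (tst_sqint mG tf)) => /= ->.
  apply/eqP; rewrite subr_eq0 -eqr_opp -hd//; apply/eqP; exact: hd'.
by have := ns0_ip hip h n0; rewrite (ipBl hip) => /eqP; rewrite subr_eq0 => /eqP.
Qed.

(** Test functions are among the [h], so Green's formula already contains the weak divergence
    equation. *)
Lemma green_zero_trace u d : L2 G u -> L2s G d ->
  (forall (h : L2G) (g : V3), wgrad G h g ->
     ip3 (reV u) g + ipG (reS d) h = 0 /\ ip3 (imV u) g + ipG (imS d) h = 0) ->
  weak_div G u d /\ zero_normal_trace G u.
Proof.
move=> hu hd H.
have wd : weak_div G u d.
  apply/(weak_divE oG hu hd).
  have T f (tf : tst G f) := H (toL2 mG (tst_sqint mG tf))
    (fun i => toL2 mG (tst_sqint mG (tst_partial i tf))) (wgrad_tst oG (tst_sub (@subsetT _ _) tf)).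
  by split=> f tf; have [e1 e2] := T f tf; apply/eqP; rewrite -addr_eq0; apply/eqP.
by split => //; exists d; split => //; apply/trace_zeroE.
Qed.

(** The divergence hidden in [zero_normal_trace] has the same pairings as [d], because weak
    divergences are unique. *)
Lemma zero_trace_green u d : L2 G u -> L2s G d -> weak_div G u d -> zero_normal_trace G u ->
  forall (h : L2G) (g : V3), wgrad G h g ->
     ip3 (reV u) g + ipG (reS d) h = 0 /\ ip3 (imV u) g + ipG (imS d) h = 0.
Proof.
move=> hu hd wd [d' [hd' wd' H]] h g wg.
have /(trace_zeroE hu hd')/(_ h g wg) := H.
have [a1 a2] := (weak_divE oG hu hd).1 wd; have [b1 b2] := (weak_divE oG hu hd').1 wd'.
by rewrite (wdiv_unique h a1 b1) (wdiv_unique h a2 b2).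
Qed.

Let L20 : L2 G (0 : vfield R).
Proof. by move=> i; split; under eq_fun do rewrite mxE; exact: sqint0. Qed.

Let reV0 : reV 0 = z3.
Proof.
apply/funext => i; apply: val_inj; rewrite /= (reVE oG i L20).
by apply/funext => x; rewrite mxE.
Qed.

Let imV0 : imV 0 = z3.
Proof.
apply/funext => i; apply: val_inj; rewrite /= (imVE oG i L20).
by apply/funext => x; rewrite mxE.
Qed.

Lemma weak_rot0E u : L2 G u -> weak_rot G u 0 <-> forall Phi, testv G Phi ->
  \sum_i ipG (reV u i) (rotf Phi i) = 0 /\ \sum_i ipG (imV u i) (rotf Phi i) = 0.
Proof.
move=> hu; rewrite (weak_rotE oG hu L20) reV0 imV0.
have z Phi : \sum_i ipG (z3 i) (Phi i) = 0 by apply: big1 => i _; exact: zL.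
split=> [[H1 H2] Phi t|H]; first by rewrite H1// H2// z.
by split=> Phi t; have [e1 e2] := H Phi t; rewrite ?e1 ?e2 z.
Qed.

Lemma L2s_zero : L2s G (fun=> 0). Proof. by split; exact: sqint0. Qed.

Let reSz : reS (fun=> 0) = 0.
Proof. by apply: val_inj; rewrite /= (reSE oG L2s_zero). Qed.
Let imSz : imS (fun=> 0) = 0.
Proof. by apply: val_inj; rewrite /= (imSE oG L2s_zero). Qed.

(** With zero divergence, Green's formula with zero normal trace is orthogonality to gradients. *)
Lemma spaceBHE u : spaceBH G u <-> spaceB G u /\ weak_rot G u 0.
Proof.
split=> [[hu rot div tr]|[sB rot]].
  split => //; apply/(spaceBE hu) => h g wg.
  by have := zero_trace_green hu L2s_zero div tr wg; rewrite reSz imSz zL !addr0.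
have [hu _] := sB.
have [wd tr] : weak_div G u (fun=> 0) /\ zero_normal_trace G u.
  apply: green_zero_trace => // [|h g wg]; first exact: L2s_zero.
  by rewrite reSz imSz zL !addr0; exact: ((spaceBE hu).1 sB h g wg).
by split.
Qed.

Lemma curlcl_spaceB (a b : V3) : curlcl a -> curlcl b -> spaceB G (cplxV a b).
Proof.
move=> ca cb; apply/spaceBE; first exact: L2_cplxV.
move=> h g wg; rewrite reV_cplxV imV_cplxV !(ipC hip3 _ g).
by split; [exact: curlcl_orth_grad ca wg|exact: curlcl_orth_grad cb wg].
Qed.

Lemma curlcl_spaceV0 (a b : V3) : curlcl a -> curlcl b -> spaceV0 G (cplxV a b).
Proof.
move=> ca cb; split; first exact: curlcl_spaceB.
move=> v /spaceBHE[[hv _] /(weak_rot0E hv) rot].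
have o x : curlcl x -> ip3 (reV v) x = 0 /\ ip3 (imV v) x = 0.
  by move=> cx; split; apply: curlcl_orth cx => Phi t; have [] := rot Phi t.
rewrite (inner_formula oG (L2_cplxV _ _) hv) reV_cplxV imV_cplxV.
rewrite !(ipC hip3 a) !(ipC hip3 b).
by have [-> ->] := o a ca; have [-> ->] := o b cb; rewrite addr0 subr0.
Qed.

(** The part [x - y] orthogonal to [curlcl] has zero curl and is orthogonal to gradients, so it lies
    in B_H. It is then orthogonal to both [x] and [y], and vanishes. *)
Lemma spaceV0_curlcl u : spaceV0 G u -> curlcl (reV u) /\ curlcl (imV u).
Proof.
move=> [sB H]; have [hu _] := sB.
have main (x : V3) : (forall (h : L2G) (g : V3), wgrad G h g -> ip3 x g = 0) ->
    (forall y : V3, spaceBH G (cplxV y z3) -> ip3 x y = 0) -> curlcl x.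
  move=> xB xH; have [y cy hy] := projection hip3 (curlcl_subspace oG) (curlcl_closed (oG := oG)) x.
  suff n0 : ip3 (x - y) (x - y) = 0.
    by apply: curlcl_closed => e e0; exists y => //; rewrite n0.
  have o1 : ip3 x (x - y) = 0.
    apply: xH; apply/spaceBHE; split.
      apply/(spaceBE (L2_cplxV _ _)) => h g wg; rewrite reV_cplxV imV_cplxV.
      by rewrite (ip0l hip3 g) (ipBl hip3) (xB h g wg) (ipC hip3 y) (curlcl_orth_grad cy wg) subr0.
    apply/(weak_rot0E (L2_cplxV _ _)) => Phi t; rewrite reV_cplxV imV_cplxV.
    split; last by apply: big1 => i _; exact: zL.
    apply: (hy (fun i => toL2 mG (tst_sqint mG (tst_rotf i t)))).
    by apply: (sub_ipcl hip3); exists Phi.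
  by rewrite (ipBl hip3) o1 (ipC hip3 y) hy// subr0.
split; apply: main.
- by move=> h g wg; have [] := (spaceBE hu).1 sB h g wg.
- by move=> y hy; have := H _ hy; rewrite (inner_formula oG hu (L2_cplxV _ _)) reV_cplxV imV_cplxV !ip3z addr0 subr0; case.
- by move=> h g wg; have [] := (spaceBE hu).1 sB h g wg.
- by move=> y hy; have := H _ hy; rewrite (inner_formula oG hu (L2_cplxV _ _)) reV_cplxV imV_cplxV !ip3z addr0 subr0; case.
Qed.

End Spaces.

(** * Complex fields as a real Hilbert space, and best approximation *)

Section Realification.
Variable R : realType.
Notation R3 := (R * R * R)%type.
Notation mR := (measurableTypeR R).
Notation mR3 := (mR * mR * mR)%type.
Notation mu3 := (@leb3 R).
Notation Re := (@complex.Re R).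
Notation Im := (@complex.Im R).
Variables (G : set R3) (rho : R).
Hypothesis oG : open G.
Hypothesis Grho : G `<=` cube rho.
Let mG : measurable (G : set mR3) := open_measurable3 oG.
Notation ipG := (ipi mu3 (G : set mR3)).
Notation L2G := (L2type mu3 (open_measurable3 oG)).
Let hip := L2_hilbert mu3 mG.
Notation ip3 := (ip3 (oG := oG)).
Notation V3 := ('I_3 -> L2G).
Let hip3 := hip3 oG.
Notation reV := (reV oG).
Notation imV := (imV oG).
Notation reS := (reS oG).
Notation imS := (imS oG).
Notation curlcl := (curlcl (oG := oG)).

Notation V2 := (bool -> 'I_3 -> L2G).
Definition ip2 (x y : V2) : R := @ipsum R ('I_3 -> L2G) ip3 bool x y.

Lemma hip2 : hilbert ip2. Proof. exact: (ipsum_hilbert bool hip3). Qed.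

Definition vC (u : vfield R) : V2 := fun b => if b then imV u else reV u.

(** Multiplication by the imaginary unit; [inner_ip2] recovers the complex inner product from it. *)
Definition mulI (x : V2) : V2 := fun b => if b then x false else - x true.

Lemma ip2E (x y : V2) : ip2 x y = ip3 (x true) (y true) + ip3 (x false) (y false).
Proof. exact: big_bool. Qed.

Lemma inner_ip2 u v : L2 G u -> L2 G v ->
  inner G u v = ip2 (vC u) (vC v) +i* ip2 (vC u) (mulI (vC v)).
Proof.
move=> hu hv; rewrite (inner_formula oG hu hv) !ip2E /vC /mulI (ipNr hip3).
by rewrite (addrC (ip3 (reV u) (reV v))).
Qed.

Lemma ip2_mulI x y : ip2 (mulI x) (mulI y) = ip2 x y.
Proof. by rewrite !ip2E /mulI (ipNl hip3) (ipNr hip3) opprK addrC. Qed.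

Lemma ip2_mulIl x y : ip2 (mulI x) y = - ip2 x (mulI y).
Proof. by rewrite !ip2E /mulI (ipNl hip3) (ipNr hip3) opprD opprK addrC. Qed.

Lemma L2_lin (c : R[i]) u v : L2 G u -> L2 G v -> L2 G (c *: u + v).
Proof.
move=> hu hv i; have [u1 u2] := hu i; have [v1 v2] := hv i; split.
  have := sqintD mG (sqintZD mG (Re c) u1 (sqintZ mG (- Im c) u2)) v1.
  congr square_integrable; apply/funext => x; rewrite !mxE ReD ReM; ring.
have := sqintD mG (sqintZD mG (Re c) u2 (sqintZ mG (Im c) u1)) v2.
congr square_integrable; apply/funext => x; rewrite !mxE ImD ImM; ring.
Qed.

Lemma L2_0 : L2 G (0 : vfield R).
Proof. by move=> i; split; under eq_fun do rewrite mxE; exact: sqint0. Qed.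

Lemma vC_lin (c : R[i]) u v : L2 G u -> L2 G v ->
  vC (c *: u + v) = Re c *: vC u + (Im c *: mulI (vC u) + vC v).
Proof.
move=> hu hv; have hl := L2_lin c hu hv; apply/funext => -[]; apply/funext => i; apply: val_inj; apply/funext => x /=.
  transitivity (Im ((c *: u + v) x 0 i)); first by rewrite (imVE oG i hl).
  transitivity (Re c * imV u i x + (Im c * reV u i x + imV v i x)); last by [].
  rewrite (imVE oG i hu) (imVE oG i hv) (reVE oG i hu) !mxE ImD ImM; ring.
transitivity (Re ((c *: u + v) x 0 i)); first by rewrite (reVE oG i hl).
transitivity (Re c * reV u i x + (Im c * (- imV u i x) + reV v i x)); last by [].
rewrite (reVE oG i hu) (reVE oG i hv) (imVE oG i hu) !mxE ReD ReM; ring.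
Qed.

Lemma vC0 : vC 0 = 0.
Proof.
have := vC_lin (-1) L2_0 L2_0; rewrite scaler0 addr0 /= oppr0 scale0r add0r scaleN1r addNr.
exact.
Qed.

Lemma L2normE u : L2 G u -> L2norm G u = Num.sqrt (ip2 (vC u) (vC u)).
Proof. by move=> hu; rewrite /L2norm (inner_ip2 hu hu). Qed.

Lemma vC_cplxV (a b : V3) : vC (cplxV a b) = (fun t : bool => if t then b else a).
Proof. by apply/funext => -[]; rewrite /vC ?reV_cplxV ?imV_cplxV. Qed.

Lemma inner_conj u v : L2 G u -> L2 G v -> inner G u v = conjc (inner G v u).
Proof.
move=> hu hv; rewrite (inner_ip2 hu hv) (inner_ip2 hv hu) /=; congr (_ +i* _).
  exact: (ipC hip2).
by rewrite -ip2_mulIl (ipC hip2).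
Qed.

Section Systems.
Variables (I : eqType) (e : I -> vfield R).
Hypothesis L2e : forall i, L2 G (e i).

(** The family of the [e i] and their multiples by the imaginary unit, orthonormal over the reals
    when [e] is orthonormal over the complex numbers. *)
Definition realf (p : I * bool) : V2 := if p.2 then mulI (vC (e p.1)) else vC (e p.1).

Lemma L2_sum (s : seq I) (c : I -> R[i]) : L2 G (\sum_(i <- s) c i *: e i).
Proof.
elim: s => [|i s IH]; first by rewrite big_nil; exact: L2_0.
by rewrite big_cons; exact: L2_lin.
Qed.

Lemma vC_sum (s : seq I) (c : I -> R[i]) : vC (\sum_(i <- s) c i *: e i) =
  \sum_(i <- s) (Re (c i) *: realf (i, false) + Im (c i) *: realf (i, true)).
Proof.
elim: s => [|i s IH]; first by rewrite !big_nil vC0.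
by rewrite !big_cons vC_lin ?IH ?addrA//; exact: L2_sum.
Qed.

Lemma ip2_sum_eq0 (x : V2) (s : seq I) (c : I -> R[i]) :
  (forall p, p.1 \in s -> ip2 x (realf p) = 0) -> ip2 x (vC (\sum_(i <- s) c i *: e i)) = 0.
Proof.
rewrite vC_sum; elim: s => [|i s IH] h; first by rewrite big_nil (ipC hip2) (ip0l hip2).
rewrite big_cons !(ipDr hip2) !(ipZr hip2) !h ?mem_head// !mulr0 !add0r IH// => p ps.
by apply: h; rewrite inE ps orbT.
Qed.

Lemma basis_orth (V : vfield R -> Prop) (x : V2) : orthonormal_basis G V e ->
  (forall p, ip2 x (realf p) = 0) -> forall f, L2 G f -> V f -> ip2 x (vC f) = 0.
Proof.
move=> [_ _ dense] h f hf Vf; apply: (@sqr_small _ (ip2 x x)) => d d0.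
have sd : 0 < Num.sqrt d by rewrite sqrtr_gt0.
have [s [c]] := dense f Vf _ sd.
have hs := L2_sum s c; have sb : f - \sum_(i <- s) c i *: e i = (-1) *: (\sum_(i <- s) c i *: e i) + f.
  by rewrite scaleN1r addrC.
rewrite sb L2normE; last exact: L2_lin.
rewrite vC_lin//= oppr0 scaleN1r scale0r add0r => hd.
set y := vC (\sum_(i <- s) _) in hd.
have -> : ip2 x (vC f) = ip2 x (- y + vC f).
  by rewrite (ipDr hip2) (ipNr hip2) /y ip2_sum_eq0 ?oppr0 ?add0r.
apply: (le_trans (cauchy_schwarz hip2 _ _)); rewrite ler_wpM2l ?(ip_ge0 hip2)//.
by apply: ltW; rewrite -ltr_sqrt.
Qed.

Hypothesis ortho : forall i j, inner G (e i) (e j) = (i == j)%:R.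

Lemma realf_orthonormal p p' : ip2 (realf p) (realf p') = (p == p')%:R.
Proof.
case: p p' => i b [j b']; have := ortho i j; rewrite (inner_ip2 (L2e i) (L2e j)).
have -> : ((i == j)%:R : R[i]) = ((i == j)%:R : R) +i* 0 by case: (i == j).
move=> [e1 e2]; rewrite /realf xpair_eqE.
case: b; case: b' => /=; rewrite ?ip2_mulI ?ip2_mulIl ?e1 ?e2 ?oppr0 ?andbT ?andbF//.
Qed.

Definition proj_sum (f : vfield R) (s : seq I) : vfield R := \sum_(i <- s) inner G f (e i) *: e i.

(** Pythagoras: [f - proj_sum f s] is orthogonal to every [realf p] with index in [s], hence to the
    difference between the projection and any competitor. *)
Lemma best_approximation f s (t : seq (R * (I * bool))) : L2 G f -> uniq s ->
  (forall p, p \in t -> p.2.1 \in s) ->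
  ip2 (vC (f - proj_sum f s)) (vC (f - proj_sum f s)) <=
  ip2 (vC f - \sum_(p <- t) p.1 *: realf p.2) (vC f - \sum_(p <- t) p.1 *: realf p.2).
Proof.
move=> hf us ts.
have -> : f - proj_sum f s = (-1) *: proj_sum f s + f by rewrite scaleN1r addrC.
rewrite vC_lin//=; last exact: L2_sum.
rewrite oppr0 scaleN1r scale0r add0r addrC.
set x := vC f; set P := vC (proj_sum f s); set y := \sum_(p <- t) _.
have PE : P = \sum_(i <- s) (ip2 x (realf (i, false)) *: realf (i, false) + ip2 x (realf (i, true)) *: realf (i, true)).
  rewrite /P vC_sum; apply: eq_bigr => i _; by rewrite (inner_ip2 hf (L2e i)).
have oP p : p.1 \in s -> ip2 (x - P) (realf p) = 0.
  move=> ps; rewrite (ipBl hip2); apply/eqP; rewrite subr_eq0 eq_sym; apply/eqP.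
  have S (s' : seq I) : ip2 (\sum_(i <- s') (ip2 x (realf (i, false)) *: realf (i, false) + ip2 x (realf (i, true)) *: realf (i, true))) (realf p)
     = \sum_(i <- s') (if i == p.1 then ip2 x (realf p) else 0).
    elim: s' => [|i s' IH]; first by rewrite !big_nil (ip0l hip2).
    rewrite !big_cons !(ipDl hip2) !(ipZl hip2) IH !realf_orthonormal; congr (_ + _).
    case: p {ps IH} => j b; rewrite !xpair_eqE /=; case: eqP => [->|_]; last by rewrite !mulr0 addr0.
    by case: b; rewrite /= !(mulr0, mulr1) ?addr0 ?add0r.
  by rewrite PE S (bigD1_seq p.1)//= eqxx big1 ?addr0// => i /negPf ->.
have dP : ip2 (x - P) P = 0 by apply: ip2_sum_eq0.
have dy : ip2 (x - P) y = 0.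
  rewrite /y; elim: t ts {y} => [|p t IH] ts; first by rewrite big_nil (ipC hip2) (ip0l hip2).
  rewrite big_cons (ipDr hip2) (ipZr hip2) oP ?mulr0 ?add0r ?IH//; last by apply: ts; rewrite mem_head.
  by move=> p' pt; apply: ts; rewrite inE pt orbT.
have xy : x - y = (x - P) + (P - y) by rewrite addrA subrK.
have dPy := ipBr hip2 (x - P) P y; rewrite dP dy subr0 in dPy.
have := nsD hip2 (x - P) (P - y); rewrite dPy mulr0 addr0 -xy => ->.
by rewrite lerDl (ip_ge0 hip2).
Qed.

End Systems.
End Realification.

(** * Eigenfields: orthogonality and completeness *)

Section Eigenfields.
Variable R : realType.
Notation R3 := (R * R * R)%type.
Notation mR := (measurableTypeR R).
Notation mR3 := (mR * mR * mR)%type.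
Notation mu3 := (@leb3 R).
Notation Re := (@complex.Re R).
Notation Im := (@complex.Im R).
Variables (G : set R3) (rho : R).
Hypothesis oG : open G.
Hypothesis Grho : G `<=` cube rho.
Let mG : measurable (G : set mR3) := open_measurable3 oG.
Notation ipG := (ipi mu3 (G : set mR3)).
Notation L2G := (L2type mu3 (open_measurable3 oG)).
Let hip := L2_hilbert mu3 mG.
Notation ip3 := (ip3 (oG := oG)).
Notation V3 := ('I_3 -> L2G).
Let hip3 := hip3 oG.
Notation reV := (reV oG).
Notation imV := (imV oG).
Notation reS := (reS oG).
Notation imS := (imS oG).
Notation curlcl := (curlcl (oG := oG)).
Notation vC := (vC oG).
Let z3 : V3 := fun=> 0.

Lemma cplxV_scale (a : R) (g g' : V3) : a%:C *: cplxV g g' = cplxV (a *: g) (a *: g').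
Proof.
apply/funext => x; apply/rowP => i; rewrite !mxE; apply: complex_eq.
  by rewrite ReM /= mul0r subr0.
by rewrite ImM /= mul0r addr0.
Qed.

Lemma opp_cplxV_scale (a : R) (g g' : V3) : - (a%:C *: cplxV g g') = cplxV ((- a) *: g) ((- a) *: g').
Proof.
rewrite -cplxV_scale -scaleNr; congr (_ *: _); apply: complex_eq => //=.
by rewrite oppr0.
Qed.

Lemma wgradZ (c : R) (h : L2G) (g : V3) : wgrad G h g -> wgrad G (c *: h) (fun i => c *: g i).
Proof.
move=> w f tf i; have sf := tst_sqint mG tf; have spf := tst_sqint mG (tst_partial i tf).
rewrite (ipZl hip c h (toL2 mG spf)) (ipZl hip c (g i) (toL2 mG sf)) /= (w f tf i).
by rewrite mulrN.
Qed.

(** The weak Neumann problem: the divergence of [g] is [- a h], with vanishing normal trace. *)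
Definition nd_weak (a : R) (h : L2G) (g : V3) : Prop := wgrad G h g /\
  forall (k : L2G) (l : V3), wgrad G k l -> ip3 g l = a * ipG h k.

Lemma nd_weak0 a : nd_weak a 0 z3.
Proof.
split; first exact: wgrad0.
by move=> k l _; rewrite (ip0l hip3) (ip0l hip) mulr0.
Qed.

Lemma nd_weak_eigenspace a h h' g g' : nd_weak a h g -> nd_weak a h' g' ->
  Defs.eigenspace (fun u w => operNd G u (- w)) a (cplxV g g').
Proof.
move=> [w H] [w' H']; rewrite /Defs.eigenspace opp_cplxV_scale.
(* Used for [c = 1] and [c = - a]: the field and its image must both belong to A_gamma. *)
have tr (c : R) : weak_div G (cplxV (c *: g) (c *: g')) (cplxS (- (c * a) *: h) (- (c * a) *: h')) /\
     zero_normal_trace G (cplxV (c *: g) (c *: g')).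
  apply: (green_zero_trace (L2_cplxV _ _) (L2s_cplxS _ _)) => k l wkl.
  rewrite reV_cplxV imV_cplxV reS_cplxS imS_cplxS !(ipZl hip3) (H _ _ wkl) (H' _ _ wkl).
  by rewrite !(ipZl hip) !mulNr !mulrA !addrN.
have [wd1 tr1] := tr 1; have [_ tra] := tr (- a).
rewrite !scale1r mul1r in wd1 tr1.
split.
- by split => //; exists (cplxS h h'); exact: H1_cplx.
- split => //; exists (cplxS ((- a) *: h) ((- a) *: h')).
  exact: (H1_cplx (wgradZ (- a) w) (wgradZ (- a) w')).
exists (cplxS (- a *: h) (- a *: h')); apply: (And3 (L2s_cplxS _ _) wd1).
apply/(weak_gradE oG (L2s_cplxS _ _) (L2_cplxV _ _)).
rewrite reS_cplxS imS_cplxS reV_cplxV imV_cplxV; split; exact: wgradZ.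
Qed.

Lemma spaceA_L2 u : spaceA G u -> L2 G u. Proof. by move=> [h []]. Qed.
Lemma nd_L2 a u : Defs.eigenspace (fun u w => operNd G u (- w)) a u -> L2 G u.
Proof. by move=> [[/spaceA_L2]]. Qed.

Lemma reim_scale (a : R) u : L2 G u -> reV (a%:C *: u) = a *: reV u /\ imV (a%:C *: u) = a *: imV u.
Proof.
move=> hu; have := cplxV_scale a (reV u) (imV u); rewrite (cplxV_re_im oG hu) => ->.
by rewrite reV_cplxV imV_cplxV.
Qed.

(** The real form of an eigenfield: [D] is its divergence, and Green's formula carries the boundary
    condition. *)
Let ndp (a : R) (U : V3) := exists2 D : L2G, wgrad G D (fun i => (- a) *: U i) &
  forall (h : L2G) (g : V3), wgrad G h g -> ip3 U g = - ipG D h.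

Let nd_ndp a u : Defs.eigenspace (fun u w => operNd G u (- w)) a u -> ndp a (reV u) /\ ndp a (imV u).
Proof.
move=> E; have hu := nd_L2 E; have [[_ tr] [sAw _] [d [hd wd wg]]] := E.
have hw := spaceA_L2 sAw.
have [w1 w2] := (weak_gradE oG hd hw).1 wg.
have N : - (a%:C *: u) = (- a)%:C *: u.
  by rewrite -scaleNr; congr (_ *: _); apply: complex_eq => //=; rewrite oppr0.
rewrite N in w1 w2; have [e1 e2] := reim_scale (- a) hu; rewrite {}e1 in w1; rewrite {}e2 in w2.
have gr := @zero_trace_green R G rho oG Grho u d hu hd wd tr.
split; [exists (reS d) => //|exists (imS d) => //] => h g wgr; have [g1 g2] := gr h g wgr;
  by apply/eqP; rewrite -addr_eq0; apply/eqP.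
Qed.

(** Green's formula used both ways shows that [a] and [b] times (U, U') both equal (D, D'). *)
Let ndp_orth a b U U' : a != b -> ndp a U -> ndp b U' -> ip3 U U' = 0.
Proof.
move=> ab [D w H] [D' w' H'].
have e1 := H _ _ w'; have e2 := H' _ _ w.
rewrite (ipZr hip3 (- b)) in e1; rewrite (ipZr hip3 (- a)) (ipC hip3 U') (ipC hip D') in e2.
have : (a - b) * ip3 U U' = 0 by rewrite mulrBl -!mulNr in e1 e2 *; move: e1 e2; rewrite !mulNr => /oppr_inj -> /oppr_inj ->; rewrite subrr.
by move/eqP; rewrite mulf_eq0 subr_eq0 (negPf ab) => /eqP.
Qed.

Lemma inner_eq0 u v : L2 G u -> L2 G v ->
  [/\ ip3 (reV u) (reV v) = 0, ip3 (imV u) (imV v) = 0, ip3 (imV u) (reV v) = 0 & ip3 (reV u) (imV v) = 0] ->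
  inner G u v = 0.
Proof. by move=> hu hv [e1 e2 e3 e4]; rewrite (inner_formula oG hu hv) e1 e2 e3 e4 addr0 subr0. Qed.

Lemma nd_orth a b u v : a != b -> Defs.eigenspace (fun u w => operNd G u (- w)) a u ->
  Defs.eigenspace (fun u w => operNd G u (- w)) b v -> inner G u v = 0.
Proof.
move=> ab Eu Ev; have [u1 u2] := nd_ndp Eu; have [v1 v2] := nd_ndp Ev.
by apply: (inner_eq0 (nd_L2 Eu) (nd_L2 Ev)); split; apply: ndp_orth ab _ _.
Qed.

Lemma V0_L2 u : spaceV0 G u -> L2 G u. Proof. by move=> [[]]. Qed.
Lemma S_L2 a u : Defs.eigenspace (operS G) a u -> L2 G u. Proof. by move=> [/V0_L2]. Qed.

Let crp (a : R) (U : V3) := [/\ curlcl U, curlcl (a *: U) & wrot G U (a *: U)].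

Let S_crp a u : Defs.eigenspace (operS G) a u -> crp a (reV u) /\ crp a (imV u).
Proof.
move=> E; have hu := S_L2 E; have [/(spaceV0_curlcl oG Grho)[c1 c2] sw /(weak_rotE oG hu (V0_L2 sw))] := E.
have [-> ->] := reim_scale a hu; move=> [r1 r2].
have cZ := subspaceZ a (curlcl_subspace oG).
exact: (conj (And3 c1 (cZ _ c1) r1) (And3 c2 (cZ _ c2) r2)).
Qed.

Let crp_orth a b U U' : a != b -> crp a U -> crp b U' -> ip3 U U' = 0.
Proof.
move=> ab [c1 c2 c3] [d1 d2 d3]; have := curl_symmetric Grho c1 c2 c3 d1 d2 d3.
rewrite (ipZl hip3) (ipZr hip3) => /eqP; rewrite -subr_eq0 -mulrBl mulf_eq0 subr_eq0 (negPf ab).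
by move=> /eqP.
Qed.

Lemma S_orth a b u v : a != b -> Defs.eigenspace (operS G) a u -> Defs.eigenspace (operS G) b v -> inner G u v = 0.
Proof.
move=> ab Eu Ev; have [u1 u2] := S_crp Eu; have [v1 v2] := S_crp Ev.
by apply: (inner_eq0 (S_L2 Eu) (S_L2 Ev)); split; apply: crp_orth ab _ _.
Qed.

Lemma curl_eigenspace (l : R) (e e' : V3) : curlcl e -> curlcl e' -> wrot G e (l *: e) ->
  wrot G e' (l *: e') -> Defs.eigenspace (operS G) l (cplxV e e').
Proof.
move=> c c' w w'; rewrite /Defs.eigenspace cplxV_scale; split.
- exact: (curlcl_spaceV0 Grho).
- by apply: (curlcl_spaceV0 Grho); exact: (subspaceZ l (curlcl_subspace oG)).
by apply/(weak_rotE oG (L2_cplxV _ _) (L2_cplxV _ _)); rewrite !reV_cplxV !imV_cplxV.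
Qed.

Lemma eigenfunctions_orthonormal (T : vfield R -> vfield R -> Prop) P ev e :
  eigenfunctions G T P ev e ->
  (forall a b u v, a != b -> Defs.eigenspace T a u -> Defs.eigenspace T b v -> inner G u v = 0) ->
  (forall j, Defs.eigenspace T (ev j) (e j)) /\ (forall j k, inner G (e j) (e k) = (j == k)%:R).
Proof.
move=> [Pev H] orth.
have mem j : Defs.eigenspace T (ev j) (e j).
  by have [E _ _] := H _ (Pev j); exact: (E (exist (fun k => ev k == ev j) j (eqxx _))).
split => // j k; have [jk|jk] := eqVneq (ev k) (ev j); last first.
  rewrite (orth _ _ _ _ _ (mem j) (mem k)) 1?eq_sym//.
  by have [e0|//] := eqVneq j k; rewrite e0 eqxx in jk.
have [_ O _] := H _ (Pev j).
have kk : ev k == ev j by apply/eqP.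
by have := O (exist (fun k => ev k == ev j) j (eqxx _)) (exist (fun k => ev k == ev j) k kk).
Qed.

Hypothesis domG : smooth_bounded_domain G.

(* A field orthogonal to all eigenfields is orthogonal to every gradient and
   every rotation, hence lies in B_H. *)
Lemma eigenfields_complete (y : bool -> V3) :
  (forall a f, a != 0 -> Defs.eigenspace (fun u w => operNd G u (- w)) a f -> ip2 y (vC f) = 0) ->
  (forall a f, a != 0 -> Defs.eigenspace (operS G) a f -> ip2 y (vC f) = 0) ->
  (forall f, spaceBH G f -> ip2 y (vC f) = 0) -> ip2 y y = 0.
Proof.
move=> hA hS hH.
have split2 (g : V3) : ip2 y (vC (cplxV g z3)) = 0 -> ip2 y (vC (cplxV z3 g)) = 0 ->
    forall b, ip3 (y b) g = 0.
  have z (x : V3) : ip3 x z3 = 0 by rewrite (ipC hip3) (ip0l hip3).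
  by rewrite !ip2E !vC_cplxV !z add0r addr0 => ? ? [].
have gr b (h : L2G) (g : V3) : wgrad G h g -> ip3 (y b) g = 0.
  apply: (gradients_spanned domG) => {}h {}g a a0 wg hg.
  have n1 : nd_weak a h g by split.
  have E1 := hA _ _ a0 (nd_weak_eigenspace n1 (nd_weak0 a)).
  exact: split2 E1 (hA _ _ a0 (nd_weak_eigenspace (nd_weak0 a) n1)) b.
have rt b Phi : testv G Phi -> \sum_i ipG (y b i) (rotf Phi i) = 0.
  apply: (curl_spanned Grho) => e l l0 ce we.
  have c0 := (curlcl_subspace oG).1.
  have w0 : wrot G z3 (l *: z3).
    have -> : l *: z3 = z3 by exact: scaler0.
    move=> Psi t; transitivity (0 : R); last symmetry; apply: big1 => i _.
      exact: (ip0l hip (toL2 mG (tst_sqint mG (tst_rotf i t)))).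
    exact: (ip0l hip (toL2 mG (tst_sqint mG (t i)))).
  have E1 := hS _ _ l0 (curl_eigenspace ce c0 we w0).
  exact: split2 E1 (hS _ _ l0 (curl_eigenspace c0 ce w0 we)) b.
pose r := cplxV (y false) (y true).
have hr : L2 G r by exact: L2_cplxV.
have yr : vC r = y by rewrite vC_cplxV; apply/funext => -[].
have := hH r; rewrite yr; apply; apply/(spaceBHE oG Grho); split.
  by apply/(spaceBE oG hr) => h g wg; rewrite reV_cplxV imV_cplxV !(gr _ _ _ wg).
by apply/(weak_rot0E oG hr) => Phi t; rewrite reV_cplxV imV_cplxV !rt.
Qed.

End Eigenfields.

(** * Partial Fourier sums as orthogonal projections *)

Section FourierSum.
Variables (R : realType) (G : set (R * R * R)) (rho : nat).
Variables (q : nat -> vfield R) (h : 'I_rho -> vfield R) (qP qM : nat -> vfield R).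

Definition fourier_index (m n : nat) : seq (nat + 'I_rho + (nat + nat)) :=
  [seq inl (inl j) | j <- iota 0 m] ++ ([seq inl (inr i) | i <- index_enum 'I_rho] ++
  ([seq inr (inl k) | k <- iota 0 n] ++ [seq inr (inr k) | k <- iota 0 n])).

Lemma fourier_index_uniq m n : uniq (fourier_index m n).
Proof.
rewrite /fourier_index cat_uniq map_inj_uniq ?iota_uniq; last by move=> ? ? [].
apply/andP; split => //; apply/andP; split.
  apply/hasPn => x; rewrite !mem_cat => /orP[/mapP[i _ ->]|/orP[/mapP[k _ ->]|/mapP[k _ ->]]];
    by apply/mapP => -[].
rewrite cat_uniq map_inj_uniq ?index_enum_uniq; last by move=> ? ? [].
apply/andP; split => //; apply/andP; split.
  by apply/hasPn => x; rewrite mem_cat => /orP[/mapP[k _ ->]|/mapP[k _ ->]]; apply/mapP => -[].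
rewrite cat_uniq !map_inj_uniq ?iota_uniq; do ?[by move=> ? ? []].
apply/andP; split => //; apply/andP; split => //.
by apply/hasPn => x /mapP[k _ ->]; apply/mapP => -[].
Qed.

Lemma fourier_sum_proj f m n : fourier_sum G q h qP qM f m n =
  proj_sum G (union_system q h qP qM) f (fourier_index m n).
Proof.
rewrite /proj_sum /fourier_index !big_cat !big_map /= addrA.
have E k (F : nat -> vfield R) : \sum_(j <- iota 0 k) F j = \sum_(j < k) F j.
  by rewrite -(big_mkord xpredT) /index_iota subn0.
by rewrite !E -big_split.
Qed.

Lemma fourier_index_exhaust (s : seq (nat + 'I_rho + (nat + nat))) :
  exists N, forall m n, (N <= m)%N -> (N <= n)%N -> {subset s <= fourier_index m n}.
Proof.
pose b (i : nat + 'I_rho + (nat + nat)) : nat :=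
  match i with inl (inl j) => j | inl (inr _) => 0 | inr (inl k) => k | inr (inr k) => k end.
exists (\max_(i <- s) b i).+1 => m n Nm Nn i si.
have : (b i <= \max_(i <- s) b i)%N by exact: leq_bigmax_seq.
rewrite -ltnS /fourier_index !mem_cat; case: i {si} => [[j|i]|[k|k]] /= bi.
- by rewrite map_f// mem_iota add0n (leq_trans bi).
- by rewrite [X in _ || (X || _)]map_f ?mem_index_enum// orbT.
- by rewrite [X in _ || (_ || (X || _))]map_f ?mem_iota ?add0n ?(leq_trans bi)// !orbT.
- by rewrite [X in _ || (_ || (_ || X))]map_f ?mem_iota ?add0n ?(leq_trans bi)// !orbT.
Qed.

End FourierSum.

Theorem mainTheorem3 (R : realType) (G : set (R * R * R)) (rho : nat)
    (mu : nat -> R) (q : nat -> vfield R)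
    (h : 'I_rho -> vfield R)
    (lamP lamM : nat -> R) (qP qM : nat -> vfield R)
    (domG : smooth_bounded_domain G)
    (genusG : has_genus (boundary G) rho)
    (* - grad div q_j = mu_j q_j *)
    (eigNd : eigenfunctions G (fun u w => operNd G u (- w))
               (fun a => a != 0) mu q)
    (basisBH : orthonormal_basis G (spaceBH G) h)
    (* rot q_k^+ = lambda_k^+ q_k^+ and rot q_k^- = - lambda_k^- q_k^- *)
    (eigSP : eigenfunctions G (operS G) (fun a => 0 < a) lamP qP)
    (eigSM : eigenfunctions G (operS G) (fun a => a < 0)
               (fun k => - lamM k) qM) :
  orthonormal_basis G (L2 G) (union_system q h qP qM) /\
  (forall f : vfield R, L2 G f ->
     (fun mn : nat * nat =>
        L2norm G (f - fourier_sum G q h qP qM f mn.1 mn.2))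
       @ filter_prod \oo \oo --> (0 : R)).
Proof.

have [_ oG _ bG _] := domG; have [M GM] := bounded_cube bG.
pose e := union_system q h qP qM.
have [qE qO] := eigenfunctions_orthonormal eigNd (nd_orth oG GM).
have [pE pO] := eigenfunctions_orthonormal eigSP (S_orth oG GM).
have [mE mO] := eigenfunctions_orthonormal eigSM (S_orth oG GM).
have [hE hO hD] := basisBH.
have qA j : spaceA G (q j) by have [[]] := qE j.
have pV k : spaceV0 G (qP k) by have [] := pE k.
have mV k : spaceV0 G (qM k) by have [] := mE k.
have hB i : spaceB G (h i) by have [] := (spaceBHE oG GM (h i)).1 (hE i).
have L2e i : L2 G (e i).
  case: i => [[j|i]|[k|k]]; [exact: spaceA_L2 (qA j)|by have [] := hE i|exact: (V0_L2 (pV k))|exact: (V0_L2 (mV k))].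
have sym0 i j : inner G (e i) (e j) = 0 -> inner G (e j) (e i) = 0.
  by move=> ij; rewrite (inner_conj oG (L2e j) (L2e i)) ij conjc0.
have hq i j : inner G (h i) (q j) = 0 by have [_ H] := hB i; exact: H.
have Vq u j : spaceV0 G u -> inner G u (q j) = 0 by move=> [[_ H] _]; exact: H.
have Vh u i : spaceV0 G u -> inner G u (h i) = 0 by move=> [_ H]; exact: H.
have pm k l : inner G (qP k) (qM l) = 0.
  apply: (S_orth oG GM _ (pE k) (mE l)).
  have pk := eigSP.1 k; have ml := eigSM.1 l; by rewrite gt_eqF// (lt_trans ml pk).
(* Different families are orthogonal by the definitions of B and V^0, except the last two, which are
   separated by the signs of the eigenvalues. *)
have ortho i j : inner G (e i) (e j) = (i == j)%:R.
  case: i j => [[j|i]|[k|k]] [[j'|i']|[k'|k']].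
  - exact: qO.
  - exact: (sym0 (inl (inr i')) (inl (inl j)) (hq i' j)).
  - exact: (sym0 (inr (inl k')) (inl (inl j)) (Vq _ j (pV k'))).
  - exact: (sym0 (inr (inr k')) (inl (inl j)) (Vq _ j (mV k'))).
  - exact: hq.
  - exact: hO.
  - exact: (sym0 (inr (inl k')) (inl (inr i)) (Vh _ i (pV k'))).
  - exact: (sym0 (inr (inr k')) (inl (inr i)) (Vh _ i (mV k'))).
  - exact: (Vq _ j' (pV k)).
  - exact: (Vh _ i' (pV k)).
  - exact: pO.
  - exact: pm.
  - exact: (Vq _ j' (mV k)).
  - exact: (Vh _ i' (mV k)).
  - exact: (sym0 (inr (inl k')) (inr (inr k)) (pm k' k)).
  - exact: mO.
(* By density, orthogonality to the listed eigenfunctions extends to whole eigenspaces. *)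
have complete y : (forall p, ip2 y (realf oG e p) = 0) -> ip2 y y = 0.
  move=> hy; apply: (eigenfields_complete GM domG).
  - move=> a f a0 Ef.
    have L2q (j : {j | mu j == a}) : L2 G (q (val j)) := L2e (inl (inl (val j))).
    apply: (basis_orth L2q (eigNd.2 a a0) _ (nd_L2 Ef) Ef) => p.
    exact: (hy (inl (inl (val p.1)), p.2)).
  - move=> a f a0 Ef; have [a_gt|a_lt|aa] := ltrgt0P a; last by rewrite aa eqxx in a0.
      have L2q (j : {j | lamP j == a}) : L2 G (qP (val j)) := L2e (inr (inl (val j))).
      apply: (basis_orth L2q (eigSP.2 a a_gt) _ (S_L2 Ef) Ef) => p.
      exact: (hy (inr (inl (val p.1)), p.2)).
    have L2q (j : {j | - lamM j == a}) : L2 G (qM (val j)) := L2e (inr (inr (val j))).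
    apply: (basis_orth L2q (eigSM.2 a a_lt) _ (S_L2 Ef) Ef) => p.
    exact: (hy (inr (inr (val p.1)), p.2)).
  - move=> f Bf; have hf : L2 G f by have [] := Bf.
    have L2h j : L2 G (h j) := L2e (inl (inr j)).
    apply: (basis_orth L2h basisBH _ hf Bf) => p.
    exact: (hy (inl (inr p.1), p.2)).
(* The bound holds for every larger finite index set, so it gives both density and convergence of
   the series with independent cut-offs [m] and [n]. *)
have approx f : L2 G f -> forall eps : R, 0 < eps -> exists s0 : seq (nat + 'I_rho + (nat + nat)), forall s, uniq s ->
    {subset s0 <= s} -> L2norm G (f - proj_sum G e f s) < eps.
  move=> hf eps eps0.
  pose S (x : bool -> 'I_3 -> L2type (@leb3 R) (open_measurable3 oG)) := exists t : seq (R * (_ * bool)),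
    x = \sum_(p <- t) p.1 *: realf oG e p.2.
  have sS : subspace S.
    split; first by exists [::]; rewrite big_nil.
    move=> a x y [t ->] [t' ->]; exists ([seq (a * p.1, p.2) | p <- t] ++ t').
    rewrite big_cat big_map scaler_sumr; congr (_ + _); apply: eq_bigr => p _; exact: scalerA.
  have [||x [t ->] xt] := @dense_ipcl _ _ _ (hip2 oG) S (vC oG f) sS _ (eps ^+ 2).
  - move=> y yS; apply: complete => p; have := yS (realf oG e p); apply.
    by exists [:: (1, p)]; rewrite big_seq1 scale1r.
  - exact: exprn_gt0.
  exists [seq p.2.1 | p <- t] => s us ts.
  have hd : L2 G (f - proj_sum G e f s).
    have -> : f - proj_sum G e f s = (-1) *: proj_sum G e f s + f by rewrite scaleN1r addrC.
    by apply: (L2_lin oG) => //; exact: (L2_sum oG).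
  rewrite (L2normE oG hd) -[eps]ger0_norm ?ltW// -sqrtr_sqr ltr_sqrt ?exprn_gt0//.
  apply: le_lt_trans xt; apply: best_approximation => // p pt.
  by apply: ts; exact: map_f.
split.
  split => // f hf eps eps0; have [s0 hs0] := approx f hf eps eps0.
  exists (undup s0), (fun i => inner G f (e i)); apply: hs0; first exact: undup_uniq.
  by move=> i; rewrite mem_undup.
move=> f hf; apply/cvgrPdist_lt => eps eps0.
have [s0 hs0] := approx f hf eps eps0; have [N hN] := fourier_index_exhaust s0.
exists ([set m | (N <= m)%N], [set n | (N <= n)%N]); first by split; exists N.
move=> [m n] /= [Nm Nn]; rewrite sub0r normrN ger0_norm; last exact: sqrtr_ge0.
rewrite fourier_sum_proj; apply: hs0; [exact: fourier_index_uniq|exact: hN].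
Qed.
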